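(* Let $(\delta_n)_{n\in\mathbb N},(\alpha_n)_{n\in\mathbb N}\subset(0,\infty)$ and assume that there exist $\delta,\gamma\ge0$ with $\delta_n\to\delta$ and $\alpha_n\delta_n^2\to\gamma$. Let $h_n\to0$ and $\alpha_nh_n\to0$. Assume in addition that $\xi_1$ is bounded. For $f\in C_b(\mathbb R^d)$ let $$J_nf:=\frac1{\alpha_n}\log\big(I_{n,\delta_n}e^{\alpha_nf}\big).$$ Then there exists a strongly continuous convex monotone semigroup $(T_{\gamma,\delta}(t))_{t\ge0}$ on $C_b(\mathbb R^d)$ with generator $B_{\gamma,\delta}\colon D(B_{\gamma,\delta})\to C_b(\mathbb R^d)$ such that $$T_{\gamma,\delta}(t)f=\lim_{n\to\infty}J_n^{k_n^t}f=\lim_{n\to\infty}\frac1{\alpha_n}\log\Big(\mathcal E\Big[\exp\Big(\alpha_nf\big(X^{n,\delta_n,\,\cdot}_{k_n^th_n}\big)\Big)\Big]\Big)$$ for all $t\ge0$, $f\in C_b(\mathbb R^d)$ and sequences $(k_n^t)_{n\in\mathbb N}\subset\mathbb N$ with $k_n^th_n\to t$. Moreover: (i) $C_b^\infty(\mathbb R^d)\subset D(B_{\gamma,\delta})$ and $(B_{\gamma,\delta}f)(x)=\frac12\mathcal E\big[\delta^2\xi_1^TD^2f(x)\xi_1+\gamma|Df(x)^T\xi_1|^2\big]+Df(x)^T\psi(x)$ for all $f\in C_b^\infty(\mathbb R^d)$ and $x\in\mathbb R^d$. (ii) $\|T_{\gamma,\delta}(t)f-T_{\gamma,\delta}(t)g\|_\infty\le\|f-g\|_\infty$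 for all $t\ge0$ and $f,g\in C_b(\mathbb R^d)$. (iii) For every $\epsilon>0$, $r,T\ge0$ and compact $K\subset\mathbb R^d$ there exist $c\ge0$ and a compact $K'\subset\mathbb R^d$ with $\|T_{\gamma,\delta}(t)f-T_{\gamma,\delta}(t)g\|_{\infty,K}\le c\|f-g\|_{\infty,K'}+\epsilon$ for all $t\in[0,T]$ and $f,g\in C_b(\mathbb R^d)$ with $\|f\|_\infty,\|g\|_\infty\le r$. (iv) For every $r,t\ge0$, $f\in\mathrm{Lip}_b(\mathbb R^d,r)$ and $x\in\mathbb R^d$, $\|T_{\gamma,\delta}(t)(\tau_xf)-\tau_xT_{\gamma,\delta}(t)f\|_\infty\le Le^{Lt}rt|x|$. Furthermore, $T_{\gamma,\delta}(t)\colon\mathrm{Lip}_b(\mathbb R^d,r)\to\mathrm{Lip}_b(\mathbb R^d,e^{Lt}r)$ for all $r,t\ge0$.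
   Context: $C_b(\mathbb R^d)$ is the space of bounded continuous $f:\mathbb R^d\to\mathbb R$ with the mixed topology (strongest locally convex topology coinciding on $\|\cdot\|_\infty$-bounded sets with the topology of uniform convergence on compacts); for sequences, $f_n\to f$ iff $\sup_n\|f_n\|_\infty<\infty$ and $\|f-f_n\|_{\infty,K}:=\sup_{x\in K}|f(x)-f_n(x)|\to0$ for all compact $K$. All limits in $C_b(\mathbb R^d)$ refer to it. $f_n\downarrow f$ means pointwise decreasing convergence. $\mathrm{Lip}_b(\mathbb R^d,r)$: $r$-Lipschitz functions with sup norm at most $r$; $C_b^\infty(\mathbb R^d)$: bounded infinitely differentiable functions with all derivatives bounded; $(\tau_xf)(y):=f(x+y)$; $Df$, $D^2f$: gradient and Hessian; $\mathbb R_+:=[0,\infty)$. A strongly continuous convex monotone semigroup on $C_b(\mathbb R^d)$ is a family $(S(t))_{t\ge0}$ of operators on $C_b(\mathbb R^d)$ such that: each $S(t)$ is monotone and convex (pointwise order) with $S(t)f_n\downarrow0$ whenever $f_n\downarrow0$; $S(0)f=f$ and $S(s+t)f=S(s)S(t)f$; $\sup_{t\in[0,T]}\|S(t)r\|_\infty<\infty$ for all constants $r,T\ge0$; $\lim_{t\downarrow0}S(t)f=f$ for all $f$. Its generator is $f\mapsto\lim_{h\downarrow0}\frac{S(h)f-f}h$ with domain the set of $f$ for which this limit exists in $C_b(\mathbb R^d)$. Sublinear expectations (Peng): a sublinear expectation space $(\Omega,\mathcal H,\mathcal E)$ consists of a linear space $\mathcal H$ of functions $\Omega\to\mathbb R$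 containing the constants and a map $\mathcal E:\mathcal H\to\mathbb R$ that is monotone, constant preserving, subadditive and positively homogeneous; the functions of random vectors occurring below are understood to belong to $\mathcal H$. A sequence $(\xi_n)$ of $\mathbb R^d$-valued random vectors is i.i.d. if $\mathcal E[f(\xi_n)]=\mathcal E[f(\xi_1)]$ for all $f$, and $\xi_{n+1}$ is independent of $(\xi_1,\dots,\xi_n)$, i.e. $\mathcal E[f(\xi_1,\dots,\xi_{n+1})]=\mathcal E\big[\mathcal E[f(y,\xi_{n+1})]|_{y=(\xi_1,\dots,\xi_n)}\big]$ for all $f$ (bounded continuous test functions $f$). Setting: $\psi:\mathbb R^d\to\mathbb R^d$ is bounded and Lipschitz with Lipschitz constant $L$; $(h_n)\subset(0,\infty)$; $(\xi_n)_{n\in\mathbb N}$ is an i.i.d. sequence of $\mathbb R^d$-valued random vectors on a sublinear expectation space $(\Omega,\mathcal H,\mathcal E)$ with $\mathcal E[|\xi_1|^3]<\infty$ and $\mathcal E[a^T\xi_1]=0$ for all $a\in\mathbb R^d$. For $n\in\mathbb N$, $\delta>0$, $x\in\mathbb R^d$, $f\in C_b(\mathbb R^d)$: $X_0^{n,\delta,x}:=x$, $X^{n,\delta,x}_{(k+1)h_n}:=X^{n,\delta,x}_{kh_n}+h_n\psi(X^{n,\delta,x}_{kh_n})+\delta\sqrt{h_n}\,\xi_{k+1}$ for $k\in\mathbb N_0$, and $(I_{n,\delta}f)(x):=\mathcal E[f(x+h_n\psi(x)+\delta\sqrt{h_n}\,\xi_1)]$. *)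

(* Defs.v *)
From HB Require Import structures.
From mathcomp Require Import all_boot all_order all_algebra.
From mathcomp Require Import all_classical all_reals all_analysis.
Set Implicit Arguments.
Unset Strict Implicit.
Unset Printing Implicit Defensive.
Import Order.TTheory GRing.Theory Num.Theory.
Import numFieldNormedType.Exports.
Local Open Scope classical_set_scope.
Local Open Scope ring_scope.

(** * Euclidean structure of R^d *)

(* The library norm on ['rV[R]_d] is the max norm. It induces the Euclidean
   topology, but Lipschitz constants refer to the Euclidean norm [enorm]. *)
Definition dot {R : realType} {d : nat} (u v : 'rV[R]_d) : R :=
  \sum_(i < d) u 0 i * v 0 i.

Definition enorm {R : realType} {d : nat} (u : 'rV[R]_d) : R :=
  Num.sqrt (dot u u).

(** * Bounded continuous functions *)

Definition Cb {R : realType} {T : topologicalType} : set (T -> R) :=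
  [set f | continuous f /\ bounded_fun f].

(* [sup] is real-valued, so this is the supremum of [|f|] over [A] only if [f]
   is bounded on [A]; moreover [supnorm set0 f = 0]. *)
Definition supnorm {R : realType} {T : Type} (A : set T) (f : T -> R) : R :=
  sup [set `|f x| | x in A].

(* Convergence of sequences in C_b(R^d) for the mixed topology. *)
Definition Cb_cvg {R : realType} {d : nat}
    (f_ : nat -> 'rV[R]_d -> R) (f : 'rV[R]_d -> R) : Prop :=
  [/\ forall n, Cb (f_ n),
      Cb f,
      exists M : R, forall n, supnorm setT (f_ n) <= M
    & forall K : set 'rV[R]_d, compact K ->
        (fun n => supnorm K (fun x => f x - f_ n x)) @ \oo --> (0 : R)].

(* Limit as h tends to 0 from the right. The filter of right neighbourhoods
   of 0 has a countable base, so this limit is determined by sequences. *)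
Definition Cb_cvg_at0 {R : realType} {d : nat}
    (f_ : R -> 'rV[R]_d -> R) (f : 'rV[R]_d -> R) : Prop :=
  forall h : nat -> R, (forall n, 0 < h n) -> h @ \oo --> (0 : R) ->
    Cb_cvg (fun n => f_ (h n)) f.

Definition decr_to0 {R : realType} {T : Type} (f_ : nat -> T -> R) : Prop :=
  forall x, (forall n, f_ n.+1 x <= f_ n x) /\ f_ ^~ x @ \oo --> (0 : R).

Definition Lipb {R : realType} {d : nat} (r : R) : set ('rV[R]_d -> R) :=
  [set f | (forall x y, `|f x - f y| <= r * enorm (x - y)) /\
           (forall x, `|f x| <= r)].

Definition translate {R : realType} {d : nat} (x : 'rV[R]_d)
  (f : 'rV[R]_d -> R) : 'rV[R]_d -> R := fun y => f (x + y).

(** * Derivatives *)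

Definition partial {R : realType} {d : nat} (i : 'I_d)
    (f : 'rV[R]_d -> R) : 'rV[R]_d -> R :=
  fun x => 'D_(delta_mx 0 i) f x.

Definition grad {R : realType} {d : nat} (f : 'rV[R]_d -> R)
  (x : 'rV[R]_d) : 'rV[R]_d := \row_(i < d) partial i f x.

Definition hess {R : realType} {d : nat} (f : 'rV[R]_d -> R)
  (x : 'rV[R]_d) : 'M[R]_d := \matrix_(i < d, j < d) partial i (partial j f) x.

(* The empty sequence [s] gives the conditions on [f] itself. *)
Definition Cbinfty {R : realType} {d : nat} : set ('rV[R]_d -> R) :=
  [set f | forall s : seq 'I_d,
     (forall x, differentiable (foldr partial f s) x) /\
     bounded_fun (foldr partial f s)].

(** * Semigroups *)

(* An operator on C_b(R^d) is a map on all functions; its values are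
   constrained only on C_b(R^d). Likewise only times t >= 0 matter. *)
Record convex_monotone_semigroup {R : realType} {d : nat}
    (S : R -> ('rV[R]_d -> R) -> 'rV[R]_d -> R) : Prop := {
  cms_Cb : forall t f, 0 <= t -> Cb f -> Cb (S t f) ;
  cms_monotone : forall t f g, 0 <= t -> Cb f -> Cb g ->
    (forall x, f x <= g x) -> forall x, S t f x <= S t g x ;
  cms_convex : forall t f g (l : R), 0 <= t -> Cb f -> Cb g -> 0 <= l <= 1 ->
    forall x, S t (fun y => l * f y + (1 - l) * g y) x
              <= l * S t f x + (1 - l) * S t g x ;
  cms_continuous_above : forall t (f_ : nat -> 'rV[R]_d -> R), 0 <= t ->
    (forall n, Cb (f_ n)) -> decr_to0 f_ -> decr_to0 (fun n => S t (f_ n)) ;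
  cms_0 : forall f, Cb f -> S 0 f = f ;
  cms_add : forall s t f, 0 <= s -> 0 <= t -> Cb f ->
    S (s + t) f = S s (S t f) ;
  cms_bounded : forall r T : R, 0 <= r -> 0 <= T ->
    exists M : R, forall t, 0 <= t <= T -> supnorm setT (S t (cst r)) <= M ;
  cms_strongly_continuous : forall f, Cb f -> Cb_cvg_at0 (S ^~ f) f
}.

(* Graph of the generator: [f] belongs to its domain and is mapped to [g]. *)
Definition generator {R : realType} {d : nat}
    (S : R -> ('rV[R]_d -> R) -> 'rV[R]_d -> R) (f g : 'rV[R]_d -> R) : Prop :=
  Cb f /\ Cb_cvg_at0 (fun h x => (S h f x - f x) / h) g.

(** * Sublinear expectations *)

(* Only the values of [E] on [H] are constrained. *)
Record sublinear_expectation {R : realType} {Omega : Type}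
    (H : set (Omega -> R)) (E : (Omega -> R) -> R) : Prop := {
  se_add : forall X Y, H X -> H Y -> H (fun w => X w + Y w) ;
  se_scale : forall (c : R) X, H X -> H (fun w => c * X w) ;
  se_cst : forall c : R, H (cst c) ;
  se_monotone : forall X Y, H X -> H Y -> (forall w, X w <= Y w) -> E X <= E Y ;
  se_constant : forall c : R, E (cst c) = c ;
  se_subadditive : forall X Y, H X -> H Y -> E (fun w => X w + Y w) <= E X + E Y ;
  se_homogeneous : forall (c : R) X, 0 <= c -> H X -> E (fun w => c * X w) = c * E X
}.

(* The first [n] random vectors, as the rows of a matrix. *)
Definition rvs {R : realType} {d : nat} {Omega : Type}
    (xi : nat -> Omega -> 'rV[R]_d) (n : nat) (w : Omega) : 'M[R]_(n, d) :=
  \matrix_(i < n) xi i w.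

(* Indices start at 0: [xi 0] is the first random vector. *)
Record iid {R : realType} {d : nat} {Omega : Type} (H : set (Omega -> R))
    (E : (Omega -> R) -> R) (xi : nat -> Omega -> 'rV[R]_d) : Prop := {
  iid_test : forall n (f : 'M[R]_(n, d) -> R), Cb f ->
    H (fun w => f (rvs xi n w)) ;
  iid_identical : forall n (f : 'rV[R]_d -> R), Cb f ->
    E (fun w => f (xi n w)) = E (fun w => f (xi 0%N w)) ;
  iid_independent : forall n (f : 'M[R]_(n, d) * 'rV[R]_d -> R), Cb f ->
    E (fun w => f (rvs xi n w, xi n w))
    = E (fun w => E (fun w' => f (rvs xi n w, xi n w')))
}.

(** * The Euler scheme *)

Section Euler.
Context {R : realType} {d : nat} {Omega : Type}.
Variables (E : (Omega -> R) -> R) (xi : nat -> Omega -> 'rV[R]_d).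
Variables (psi : 'rV[R]_d -> 'rV[R]_d).

(* [euler h delta x k] is the random vector at time [k * h] started in [x]. *)
Fixpoint euler (h delta : R) (x : 'rV[R]_d) (k : nat) (w : Omega) : 'rV[R]_d :=
  if k is k'.+1 then
    let y := euler h delta x k' w in
    y + h *: psi y + (delta * Num.sqrt h) *: xi k' w
  else x.

Definition euler_op (h delta : R) (f : 'rV[R]_d -> R) : 'rV[R]_d -> R :=
  fun x => E (fun w => f (x + h *: psi x + (delta * Num.sqrt h) *: xi 0%N w)).

Definition entropic_op (alpha h delta : R) (f : 'rV[R]_d -> R) :
    'rV[R]_d -> R :=
  fun x => alpha^-1 * ln (euler_op h delta (fun y => expR (alpha * f y)) x).

Definition entropic_generator (gamma delta : R) (f : 'rV[R]_d -> R) :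
    'rV[R]_d -> R :=
  fun x =>
    2^-1 * E (fun w => delta ^+ 2 * dot (xi 0%N w *m hess f x) (xi 0%N w)
                       + gamma * `|dot (grad f x) (xi 0%N w)| ^+ 2)
    + dot (grad f x) (psi x).

End Euler.

(* Main.v *)
Require Import Defs.
From mathcomp Require Import all_boot all_order all_algebra.
From mathcomp Require Import all_classical all_reals all_analysis.
From mathcomp Require Import ring lra.
Import Order.TTheory GRing.Theory Num.Theory.
Import numFieldNormedType.Exports.
Local Open Scope classical_set_scope.
Local Open Scope ring_scope.
Set Implicit Arguments.
Unset Strict Implicit.
Unset Printing Implicit Defensive.

(** The one-step operators [J_n] are monotone and convex, commute with the
    addition of constants, almost commute with translations, and satisfy
    [J_n v = v + h_n G(x, Dv, D^2 v) + o(h_n)] for smooth [v], uniformly as long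
    as the derivatives of [v] are bounded by a constant. Here
    [G(x, p, A) = E[delta^2 xi^T A xi + gamma |p^T xi|^2] / 2 + p^T psi(x)]. All
    that concerns the limit is derived from these facts, which are collected in
    [approx_scheme].

    Convexity takes the place of a comparison principle for the limit equation.
    Let [f] be Lipschitz, let [u_k = J_n^k f], and let
    [M] be a mollification at scale [eps]. As [M] is an average of translations,
    Jensen's inequality gives [J_n (M u) <= M (J_n u) + O(h_n eps)]
    ([smooth_jensen]). With consistency, [v_k = M u_k] is a smooth supersolution:
    [v_(k+1) >= v_k + h_n (G(v_k) - O(eps) - o(1))] ([smooth_supersolution]).
    Interpolate [v] linearly in time and apply [J_m] for another index [m]: its
    increments are [h_m G(v) + o(h_m)], hence at most those of [v], up to small
    errors ([block_comparison]). Therefore [J_m^j f <= J_n^k f + O(eps) + o(1)]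
    as soon as [k h_n] and [j h_m] are both close to [t]
    ([one_sided_convergence]). The two indices play the same role, so the
    iterates form a Cauchy sequence, uniformly in space.

    The mollifier is a composition of averages over short segments parallel to
    the coordinate axes. Its derivatives are difference quotients of shorter
    compositions ([steklovs_expansion]), so one-dimensional calculus suffices,
    and the constants of the resulting second-order expansion are linear in the
    Lipschitz constant of the function ([smooth_jet]). The iterates are hence
    equicontinuous in time, and functions with a small Lipschitz constant hardly
    move, however large they are. A truncated cone of small slope therefore
    serves as a barrier: by convexity, a perturbation of the initial value
    outside a large ball is absorbed into a small multiple of it
    ([local_dependence]). This is (iii), uniformly along the scheme; it extends
    the convergence to all bounded continuous functions and yields the semigroup
    property ([limit_add]). The remaining properties of the semigroup, (ii) and
    (iv) pass to the limit from the iterates. For (i), the increment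
    [J_n^(i+1) f - J_n^i f] is, up to [o(h_n)], that of [J_n^i] at [f] in direction
    [h_n B f], and convexity squeezes it between the increments in the directions
    [- B f] and [B f], which are close to [B f] for short times
    ([iter_generator_estimate]).

    For the entropic operators, convexity is Hoelder's inequality, and
    consistency follows by expanding the exponential and the logarithm to second
    order ([one_step_consistent]). The first-order term vanishes since [xi_1] is
    centred, its square produces [gamma |p^T xi|^2 / 2], and the remainders vanish
    because [alpha_n delta_n sqrt h_n] is the geometric mean of
    [alpha_n delta_n^2] and [alpha_n h_n]. By independence, the exponential of
    [alpha_n J_n^k f] is the expectation along [k] steps of the Euler scheme
    ([exp_euler]). *)


(** * The Euclidean norm and its topology *)

Section Euclid.
Context {R : realType} {d : nat}.
Implicit Types (u v w x y : 'rV[R]_d) (a b c r : R).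

Lemma dotC u v : dot u v = dot v u.
Proof. by apply: eq_bigr => i _; rewrite mulrC. Qed.

Lemma dotDl u v w : dot (u + v) w = dot u w + dot v w.
Proof. by rewrite -big_split; apply: eq_bigr => i _; rewrite mxE mulrDl. Qed.

Lemma dotZl a u v : dot (a *: u) v = a * dot u v.
Proof. by rewrite mulr_sumr; apply: eq_bigr => i _; rewrite mxE mulrA. Qed.

Lemma dotDr u v w : dot w (u + v) = dot w u + dot w v.
Proof. by rewrite dotC dotDl !(dotC w). Qed.

Lemma dotZr a u v : dot v (a *: u) = a * dot v u.
Proof. by rewrite dotC dotZl dotC. Qed.

Lemma dotNl u v : dot (- u) v = - dot u v.
Proof. by rewrite -scaleN1r dotZl mulN1r. Qed.

Lemma dotNr u v : dot v (- u) = - dot v u.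
Proof. by rewrite dotC dotNl dotC. Qed.

Lemma dot0l v : dot 0 v = 0.
Proof. by rewrite -(scale0r 0) dotZl mul0r. Qed.

Lemma dot_ge0 u : 0 <= dot u u.
Proof. by apply: sumr_ge0 => i _; rewrite -expr2 sqr_ge0. Qed.

Lemma enorm_ge0 u : 0 <= enorm u.
Proof. exact: sqrtr_ge0. Qed.

Lemma enorm_sqr u : enorm u ^+ 2 = dot u u.
Proof. by rewrite sqr_sqrtr// dot_ge0. Qed.

Lemma enorm0 : enorm (0 : 'rV[R]_d) = 0.
Proof. by rewrite /enorm dot0l sqrtr0. Qed.

Lemma enormZ a u : enorm (a *: u) = `|a| * enorm u.
Proof.
by rewrite /enorm dotZl dotZr mulrA -expr2 sqrtrM ?sqr_ge0// sqrtr_sqr.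
Qed.

Lemma enormN u : enorm (- u) = enorm u.
Proof. by rewrite /enorm dotNl dotNr opprK. Qed.

Lemma enormBC u v : enorm (u - v) = enorm (v - u).
Proof. by rewrite -enormN opprB. Qed.

Lemma coord_le_enorm u i : `|u 0 i| <= enorm u.
Proof.
rewrite -(ler_pXn2r (_ : 0 < 2)%N) ?nnegrE ?enorm_ge0// enorm_sqr.
rewrite real_normK ?num_real// /dot (bigD1 i)//= -expr2 lerDl.
by apply: sumr_ge0 => j _; rewrite -expr2 sqr_ge0.
Qed.

Lemma cauchy_schwarz u v : `|dot u v| <= enorm u * enorm v.
Proof.
rewrite -(ler_pXn2r (_ : 0 < 2)%N) ?nnegrE ?mulr_ge0 ?enorm_ge0//.
rewrite exprMn !enorm_sqr real_normK ?num_real//.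
have := dot_ge0 v; rewrite le_eqVlt => /orP[/eqP v0|v0].
  suff -> : dot u v = 0 by rewrite expr0n/= mulr_ge0 ?dot_ge0.
  rewrite /dot big1// => i _; have := coord_le_enorm v i.
  by rewrite /enorm -v0 sqrtr0 normr_le0 => /eqP ->; rewrite mulr0.
have := dot_ge0 (dot v v *: u - dot u v *: v).
rewrite dotDl !dotDr !dotNl !dotNr !dotZl !dotZr (dotC v u) => h.
rewrite -(ler_pM2l v0).
lra.
Qed.

Lemma enormD u v : enorm (u + v) <= enorm u + enorm v.
Proof.
rewrite -(ler_pXn2r (_ : 0 < 2)%N) ?nnegrE ?addr_ge0 ?enorm_ge0//.
rewrite enorm_sqr dotDl !dotDr sqrrD !enorm_sqr (dotC v u).
by have := le_trans (ler_norm _) (cauchy_schwarz u v); lra.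
Qed.

Lemma enorm_delta (i : 'I_d) : enorm (delta_mx 0 i : 'rV[R]_d) = 1.
Proof.
rewrite /enorm /dot (bigD1 i)//= big1 ?addr0 => [|j ji].
  by rewrite !mxE !eqxx mulr1 sqrtr1.
by rewrite !mxE (negbTE ji) andbF mulr0.
Qed.

Lemma norm_le_enorm u : `|u| <= enorm u.
Proof.
rewrite [leLHS]/Num.norm /= mx_normrE; apply/bigmax_leP.
by split; [exact: enorm_ge0|case=> i j _ /=; rewrite ord1 coord_le_enorm].
Qed.

Lemma enorm_le_sum u : enorm u <= \sum_i `|u 0 i|.
Proof.
rewrite {1}(row_sum_delta u).
have : forall s : seq 'I_d, enorm (\sum_(i <- s) u 0 i *: delta_mx 0 i)
    <= \sum_(i <- s) `|u 0 i|.
  elim=> [|i s ih]; first by rewrite !big_nil enorm0.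
  rewrite !big_cons; apply: le_trans (enormD _ _) _.
  by rewrite lerD// enormZ enorm_delta mulr1.
exact.
Qed.

Lemma enorm_le_norm u : enorm u <= d%:R * `|u|.
Proof.
apply: le_trans (enorm_le_sum u) _.
rewrite mulr_natl -[X in _ *+ X]card_ord -sumr_const; apply: ler_sum => i _.
rewrite [leRHS]/Num.norm /= mx_normrE.
by apply: (le_bigmax _ (fun ij : 'I_1 * 'I_d => `|u ij.1 ij.2|) (0, i)).
Qed.


(** The topology comes from the max norm; every estimate below is in the
    Euclidean norm, so balls of the latter are used as neighbourhoods. *)
Lemma near_eball x r : 0 < r -> \forall y \near x, enorm (y - x) <= r.
Proof.
move=> r0; have dp : 0 < d%:R + 1 :> R by rewrite ltr_wpDl.
apply/nbhs_ballP; exists (r / (d%:R + 1)); first by rewrite /= divr_gt0.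
move=> y; rewrite -ball_normE /ball_/= ltr_pdivlMr// mulrC distrC => /ltW h.
apply: le_trans (enorm_le_norm _) _; apply: le_trans h.
by rewrite ler_wpM2r// lerDl.
Qed.

Lemma continuous_eballP (f : 'rV[R]_d -> R) :
  (forall x e, 0 < e -> exists2 r, 0 < r &
     forall y, enorm (y - x) <= r -> `|f y - f x| <= e) -> continuous f.
Proof.
move=> h x. have F : Filter (nbhs x) by exact: nbhs_filter.
apply/(@cvgrPdist_le _ _ _ (nbhs x) F) => e e0.
have [r r0 hr] := h x e e0.
apply: (@filterS _ (nbhs x) F _ _ _ (near_eball x r0)) => y yx.
by rewrite distrC; exact: hr.
Qed.

Lemma continuous_near_dist (f : 'rV[R]_d -> R) x e : continuous f -> 0 < e ->
  \forall y \near x, `|f x - f y| <= e.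
Proof.
move=> cf e0; have F : Filter (nbhs x) by exact: nbhs_filter.
exact: (proj1 (@cvgrPdist_le _ _ _ (nbhs x) F f (f x)) (cf x) e e0).
Qed.

Lemma enorm_continuous : continuous (@enorm R d).
Proof.
apply: continuous_eballP => x e e0; exists e => // y; apply: le_trans.
rewrite ler_norml; apply/andP; split.
  have := enormD y (x - y); rewrite addrC subrK enormBC => h.
  by rewrite lerNl opprB lerBlDl.
by have := enormD x (y - x); rewrite addrC subrK lerBlDl.
Qed.

Lemma compact_eball r : compact [set x : 'rV[R]_d | enorm x <= r].
Proof.
apply: bounded_closed_compact.
  exists r; split; first exact: num_real.
  move=> M rM x /= xr; apply: le_trans (norm_le_enorm _) _.
  exact: le_trans xr (ltW rM).
rewrite (_ : mkset _ = (@enorm R d) @^-1` [set z | z <= r])//.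
apply: closed_comp => [x _|]; first exact: enorm_continuous.
exact: closed_le.
Qed.

Lemma compact_sub_eball (K : set 'rV[R]_d) : compact K ->
  exists2 r, 0 <= r & forall x, K x -> enorm x <= r.
Proof.
move=> /compact_bounded[M0 [_ /(_ (M0 + 1))]].
set M := M0 + 1 => KM; exists (d%:R * Num.max M 0).
  by rewrite mulr_ge0// le_max lexx orbT.
move=> x /KM; rewrite ltrDl ltr01 => /(_ isT) /= xM; apply: le_trans (enorm_le_norm _) _.
by rewrite ler_wpM2l// le_max xM.
Qed.

(** Only one of the two points has to lie in the ball, which is what is needed
    when the other one is reached by a small increment. *)
Lemma unif_continuous_eball (f : 'rV[R]_d -> R) r e : continuous f -> 0 < e ->
  exists2 rho, 0 < rho & forall x y, enorm x <= r -> enorm (y - x) <= rho ->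
    `|f y - f x| <= e.
Proof.
move=> cf e0.
have /compact_near_coveringP/near_covering_withinP cov := @compact_eball r.
pose P (rho : R) (x : 'rV[R]_d) :=
  forall y, enorm (y - x) <= rho -> `|f y - f x| <= e.
have : \forall rho \near (0 : R)^'+,
    [set x : 'rV[R]_d | enorm x <= r] `<=` P rho.
  apply: cov => x _.
  have : \forall y \near x, `|f x - f y| <= e / 2.
    by apply: continuous_near_dist => //; rewrite divr_gt0.
  rewrite -nbhs_nearE => /nbhs_ballP[/= s s0 hs].
  have dp : 0 < d%:R + 1 :> R by rewrite ltr_wpDl.
  exists ([set x' : 'rV[R]_d | enorm (x' - x) <= s / 4], [set rho | 0 < rho <= s / 4]).
    split; first by apply: near_eball; rewrite divr_gt0.
    rewrite /=; near=> rho; apply/andP; split => //; near: rho.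
    by apply: nbhs_right_le; rewrite divr_gt0.
  move=> [x' rho] /= [x'x /andP[_ rhos]] _ y yx'.
  have bx z : enorm (z - x) <= s / 2 -> `|f x - f z| <= e / 2.
    move=> zx; apply: hs; rewrite -ball_normE /ball_/= distrC.
    apply: le_lt_trans (norm_le_enorm _) _; apply: le_lt_trans zx _; lra.
  have hx' : `|f x - f x'| <= e / 2 by apply: bx; lra.
  have hy : `|f x - f y| <= e / 2.
    apply: bx; have -> : y - x = (y - x') + (x' - x) by rewrite addrA subrK.
    by apply: le_trans (enormD _ _) _; lra.
  have -> : f y - f x' = - (f x - f y) + (f x - f x') by ring.
  by apply: le_trans (ler_normD _ _) _; rewrite normrN; lra.
move=> [rho /= rho0 h].
exists (rho / 2); first by rewrite divr_gt0.
move=> x y xr yx; apply: (h (rho / 2)) => //=; last by rewrite divr_gt0.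
by rewrite sub0r normrN gtr0_norm; lra.
Unshelve. all: by end_near. Qed.

End Euclid.

(** * Suprema, bounded and Lipschitz functions *)

Section Functions.
Context {R : realType}.

Lemma bounded_fun_bnd {T : Type} (f : T -> R) :
  bounded_fun f <-> exists M : R, forall x, `|f x| <= M.
Proof.
split=> [[M [_ h]]|[M h]].
  by exists (M + 1) => x; apply: (h (M + 1)) => //; rewrite ltrDl.
exists M; split; first exact: num_real.
by move=> N MN x _ /=; apply: le_trans (h x) (ltW MN).
Qed.

Lemma supnorm_le {T : Type} (A : set T) (f : T -> R) (M : R) : 0 <= M ->
  (forall x, A x -> `|f x| <= M) -> supnorm A f <= M.
Proof.
move=> M0 h; rewrite /supnorm.
have [[x Ax]|/set0P/negP/negPn/eqP ->] := pselect (A !=set0).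
  by apply: ge_sup; [exists (`|f x|), x|move=> _ [y Ay <-]; exact: h].
by rewrite image_set0 sup0.
Qed.

Lemma le_supnorm {T : Type} (A : set T) (f : T -> R) (x : T) :
  (exists M : R, forall y, A y -> `|f y| <= M) -> A x -> `|f x| <= supnorm A f.
Proof.
move=> [M h] Ax; apply: ub_le_sup; last by exists x.
by exists M => _ [y Ay <-]; exact: h.
Qed.

Lemma supnorm_ge0 {T : Type} (A : set T) (f : T -> R) : 0 <= supnorm A f.
Proof.
rewrite /supnorm; have [[x Ax]|/set0P/negP/negPn/eqP ->] := pselect (A !=set0).
  have [[_ h]|h] := pselect (has_sup [set `|f x| | x in A]).
    by apply: (le_trans (normr_ge0 (f x))); apply: ub_le_sup => //; exists x.
  by rewrite sup_out.
by rewrite image_set0 sup0.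
Qed.

End Functions.

Section Lipschitz.
Context {R : realType} {d : nat}.
Implicit Types (f g : 'rV[R]_d -> R) (x y z : 'rV[R]_d) (a c r : R).

Definition lip r f := forall x y, `|f x - f y| <= r * enorm (x - y).
Definition bnd f := exists M : R, forall x, `|f x| <= M.

Lemma Cb_bnd f : Cb f -> bnd f.
Proof. by move=> [_ /bounded_fun_bnd]. Qed.

Lemma CbP f : continuous f -> bnd f -> Cb f.
Proof. by move=> cf bf; split => //; exact/bounded_fun_bnd. Qed.

Lemma lip_continuous r f : lip r f -> continuous f.
Proof.
move=> fr; apply: continuous_eballP => x e e0.
exists (e / (`|r| + 1)); first by rewrite divr_gt0// ltr_wpDl.
move=> y; rewrite ler_pdivlMr ?ltr_wpDl// => h.
apply: le_trans (fr _ _) _; apply: le_trans h.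
rewrite mulrC ler_wpM2l ?enorm_ge0//.
by apply: le_trans (ler_norm r) _; rewrite lerDl.
Qed.

Lemma lip_Cb r f : lip r f -> bnd f -> Cb f.
Proof. by move=> /lip_continuous; exact: CbP. Qed.

Lemma Cb_cst c : Cb (cst c : 'rV[R]_d -> R).
Proof. by apply: CbP; [move=> x; exact: cst_continuous|exists `|c|]. Qed.

Lemma bndD f g : bnd f -> bnd g -> bnd (fun x => f x + g x).
Proof.
move=> [M fM] [N gN]; exists (M + N) => x.
by apply: le_trans (ler_normD _ _) _; rewrite lerD.
Qed.

Lemma bndZ c f : bnd f -> bnd (fun x => c * f x).
Proof. by move=> [M fM]; exists (`|c| * M) => x; rewrite normrM ler_wpM2l. Qed.

Lemma bndB f g : bnd f -> bnd g -> bnd (fun x => f x - g x).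
Proof.
move=> [M fM] [N gN]; exists (M + N) => x.
by apply: le_trans (ler_normB _ _) _; rewrite lerD.
Qed.

Lemma bnd_translate z f : bnd f -> bnd (translate z f).
Proof. by move=> [M fM]; exists M => x; exact: fM. Qed.

Lemma CbD f g : Cb f -> Cb g -> Cb (fun x => f x + g x).
Proof.
move=> [cf bf] [cg bg]; apply: CbP.
  by move=> x; apply: continuousD; [exact: cf|exact: cg].
by apply: bndD; apply: Cb_bnd.
Qed.

Lemma CbZ c f : Cb f -> Cb (fun x => c * f x).
Proof.
move=> [cf bf]; apply: CbP; last by apply: bndZ; apply: Cb_bnd.
by move=> x; apply: continuousM; [exact: cst_continuous|exact: cf].
Qed.

Lemma CbB f g : Cb f -> Cb g -> Cb (fun x => f x - g x).
Proof.
move=> [cf bf] [cg bg]; apply: CbP.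
  by move=> x; apply: continuousB; [exact: cf|exact: cg].
by apply: bndB; apply: Cb_bnd.
Qed.

Lemma Cb_translate z f : Cb f -> Cb (translate z f).
Proof.
move=> [cf bf]; apply: CbP; last by apply: bnd_translate; apply: Cb_bnd.
move=> x; rewrite /translate; apply: continuous_comp; last exact: cf.
by apply: continuousD; [exact: cst_continuous|exact: id].
Qed.

Lemma lip_le r r' f : r <= r' -> lip r f -> lip r' f.
Proof.
move=> rr' fr x y; apply: le_trans (fr x y) _.
by rewrite ler_wpM2r ?enorm_ge0.
Qed.

Lemma lip_cst c : lip 0 (cst c).
Proof. by move=> x y; rewrite /cst subrr normr0 mul0r. Qed.

Lemma lipD r s f g : lip r f -> lip s g -> lip (r + s) (fun x => f x + g x).
Proof.
move=> fr gs x y; have -> : f x + g x - (f y + g y) = (f x - f y) + (g x - g y).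
  by ring.
by apply: le_trans (ler_normD _ _) _; rewrite mulrDl lerD.
Qed.

Lemma lipB r s f g : lip r f -> lip s g -> lip (r + s) (fun x => f x - g x).
Proof.
move=> fr gs x y; have -> : f x - g x - (f y - g y) = (f x - f y) - (g x - g y).
  by ring.
by apply: le_trans (ler_normB _ _) _; rewrite mulrDl lerD.
Qed.

Lemma lipZ c r f : lip r f -> lip (`|c| * r) (fun x => c * f x).
Proof. by move=> fr x y; rewrite -mulrBr normrM -mulrA ler_wpM2l. Qed.

Lemma lip_translate z r f : lip r f -> lip r (translate z f).
Proof.
move=> fr x y; apply: le_trans (fr _ _) _.
by rewrite opprD addrACA subrr add0r.
Qed.

Lemma lip_move z r f x : lip r f -> `|f (x + z) - f x| <= r * enorm z.
Proof. by move=> fr; apply: le_trans (fr _ _) _; rewrite addrAC subrr add0r. Qed.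

End Lipschitz.


(** * Primitives on the line *)

Section OneDim.
Context {R : realType}.
Implicit Types (g G : R -> R) (a b c r s t : R).
Notation mu := (@lebesgue_measure R).

Lemma continuous_itv_integrable g a b : continuous g ->
  mu.-integrable `[a, b] (EFin \o g).
Proof.
move=> cg; apply: continuous_compact_integrable; first exact: segment_compact.
exact: continuous_subspaceT.
Qed.

Lemma primitive_exists g c : continuous g ->
  exists G, forall s, c < s -> is_derive s 1 G (g s).
Proof.
move=> cg; exists (fun x => \int[mu]_(t in `[c, x]) g t) => s cs.
have [] := @continuous_FTC1_closed _ g c s (s + 1) _
  (continuous_itv_integrable c (s + 1) cg) cs (cg s).
  by rewrite ltrDl.
by move=> dG <-; rewrite derive1E; exact: derivableP.
Qed.

Lemma is_derive_itv_continuous G g a b :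
  (forall s, a <= s <= b -> is_derive s 1 G (g s)) ->
  {within `[a, b], continuous G}.
Proof.
move=> dG; apply: derivable_within_continuous => s.
by rewrite in_itv/= => /dG [].
Qed.

Lemma Rintegral_primitive G g a b : a < b -> continuous g ->
  (forall s, a <= s <= b -> is_derive s 1 G (g s)) ->
  \int[mu]_(t in `[a, b]) g t = G b - G a.
Proof.
move=> ab cg dG; rewrite /Rintegral (@continuous_FTC2 _ g G)//.
- exact: continuous_subspaceT.
- have cG s : a <= s <= b -> {for s, continuous G}.
    by move=> /dG [dGs _]; apply/differentiable_continuous/derivable1_diffP.
  split.
  + by move=> s; rewrite in_itv/= => /andP[/ltW ? /ltW ?]; have [] := dG s _; [apply/andP|].
  + apply: cvg_at_right_filter; apply: cG; by rewrite lexx ltW.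
  + apply: cvg_at_left_filter; apply: cG; by rewrite lexx ltW.
- move=> s; rewrite in_itv/= => /andP[/ltW ? /ltW ?]; rewrite derive1E.
  by have [] := dG s _; [apply/andP|].
Qed.

Lemma mean_value_le G g a b (M : R) : a <= b ->
  (forall s, a <= s <= b -> is_derive s 1 G (g s)) ->
  (forall s, a <= s <= b -> `|g s| <= M) -> `|G b - G a| <= M * (b - a).
Proof.
move=> ab dG gM; have dG' s : s \in `]a, b[ -> is_derive s 1 G (g s).
  by rewrite in_itv/= => /andP[/ltW ? /ltW ?]; apply: dG; apply/andP.
have [c + ->] := MVT_segment ab dG' (is_derive_itv_continuous dG).
rewrite in_itv/= => /gM cM; rewrite normrM (@ger0_norm _ (b - a)) ?subr_ge0//.
by rewrite ler_wpM2r// subr_ge0.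
Qed.

(** The error of the rectangle rule is quadratic. The points [a] and [b] come
    in either order, as the expansion is used for increments of both signs. *)
Lemma primitive_expansion G g r c a b :
  (forall s t, `|g s - g t| <= r * `|s - t|) ->
  (forall s, c < s -> is_derive s 1 G (g s)) -> c < a -> c < b ->
  `|G b - G a - (b - a) * g a| <= r * (b - a) ^+ 2.
Proof.
move=> gr dG ca cb.
have r0 : 0 <= r.
  by have := gr 1 0; rewrite subr0 normr1 mulr1; exact: le_trans.
pose K s := G s - s * g a.
have dK s : c < s -> is_derive s 1 K (g s - g a).
  move=> cs; have := dG s cs => dGs.
  have : is_derive s 1 K (g s - (s * 0 + g a * 1)).
    by apply: is_deriveB; apply: is_deriveM.
  by rewrite mulr0 add0r mulr1.
have -> : G b - G a - (b - a) * g a = K b - K a by rewrite /K; ring.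
have main x y : c < x -> x <= y -> (x = a \/ y = a) ->
    `|K y - K x| <= r * (y - x) ^+ 2.
  move=> cx xy xya; rewrite expr2 mulrA.
  apply: (@mean_value_le _ (fun s => g s - g a)) => // s /andP[xs sy].
    by apply: dK; exact: lt_le_trans xs.
  apply: le_trans (gr _ _) _; rewrite ler_wpM2l// ler_norml.
  by case: xya => <-; lra.
have [ab|/ltW ba] := leP a b; first by apply: main => //; left.
rewrite distrC (_ : (b - a) ^+ 2 = (a - b) ^+ 2); last by ring.
by apply: main => //; right.
Qed.

End OneDim.

(** * Averages along a coordinate axis *)

Section Steklov.
Context {R : realType} {d : nat}.
Variable eps : R.
Hypothesis eps_gt0 : 0 < eps.
Implicit Types (u v w : 'rV[R]_d -> R) (x y z : 'rV[R]_d) (a b c r s t : R).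
Notation mu := (@lebesgue_measure R).
Notation e i := (delta_mx 0 i : 'rV[R]_d).

Definition steklov (i : 'I_d) u : 'rV[R]_d -> R :=
  fun x => eps^-1 * \int[mu]_(s in `[0, eps]) u (x + s *: e i).

Definition diffq (i : 'I_d) u : 'rV[R]_d -> R :=
  fun x => eps^-1 * (u (x + eps *: e i) - u x).

Lemma line_lip r u x i : lip r u -> forall s t,
  `|u (x + s *: e i) - u (x + t *: e i)| <= r * `|s - t|.
Proof.
move=> ur s t; apply: le_trans (ur _ _) _.
by rewrite opprD addrACA subrr add0r -scalerBl enormZ enorm_delta mulr1.
Qed.

Lemma lip_line_continuous r (g : R -> R) :
  (forall s t, `|g s - g t| <= r * `|s - t|) -> continuous g.
Proof.
move=> gr s; apply/cvgrPdist_le => q q0; near=> t.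
apply: le_trans (gr _ _) _; apply: (@le_trans _ _ ((`|r| + 1) * `|s - t|)).
  rewrite ler_wpM2r//; apply: le_trans (ler_norm r) _; by rewrite lerDl.
rewrite mulrC -ler_pdivlMr ?ltr_wpDl//; near: t.
apply: (@cvgr_dist_le _ _ _ _ _ (fun y : R => y) s) => //.
by rewrite divr_gt0// ltr_wpDl.
Unshelve. all: by end_near. Qed.

Lemma line_integrable r u x i a b : lip r u ->
  mu.-integrable `[a, b] (EFin \o (fun s => u (x + s *: e i))).
Proof.
move=> ur; apply: continuous_itv_integrable.
exact/lip_line_continuous/(line_lip x i ur).
Qed.

Lemma steklovD r s i u v : lip r u -> lip s v ->
  steklov i (fun x => u x + v x) = fun x => steklov i u x + steklov i v x.
Proof.
move=> ur vs; apply/funext => x; rewrite /steklov -mulrDr; congr (_ * _).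
by rewrite RintegralD//; apply: line_integrable; eassumption.
Qed.

Lemma steklovZ r i a u : lip r u ->
  steklov i (fun x => a * u x) = fun x => a * steklov i u x.
Proof.
move=> ur; apply/funext => x; rewrite /steklov mulrCA; congr (_ * _).
by rewrite RintegralZl//; apply: line_integrable; eassumption.
Qed.

Lemma steklovB r s i u v : lip r u -> lip s v ->
  steklov i (fun x => u x - v x) = fun x => steklov i u x - steklov i v x.
Proof.
move=> ur vs; apply/funext => x; rewrite /steklov -mulrBr; congr (_ * _).
by rewrite RintegralB//; apply: line_integrable; eassumption.
Qed.

Lemma steklov_cst i c : steklov i (cst c) = cst c.
Proof.
apply/funext => x; rewrite /steklov /cst Rintegral_cst//.
have -> : fine (mu `[0, eps]) = eps.
  by rewrite lebesgue_measure_itv/= lte_fin eps_gt0 /= oppr0 addr0.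
by rewrite mulrCA mulVf ?mulr1// gt_eqF.
Qed.
Lemma steklov_le r s i u v x : lip r u -> lip s v -> (forall y, u y <= v y) ->
  steklov i u x <= steklov i v x.
Proof.
move=> ur vs uv; rewrite /steklov ler_pM2l ?invr_gt0//.
by apply: le_Rintegral => //; apply: line_integrable; eassumption.
Qed.

Lemma steklov_norm_le r i u x (M : R) : lip r u -> (forall y, `|u y| <= M) ->
  `|steklov i u x| <= M.
Proof.
move=> ur uM; have Ml := @lip_cst R d M; have Ml' := @lip_cst R d (- M).
have h y : - M <= u y <= M by rewrite -ler_norml.
rewrite ler_norml; apply/andP; split.
  have := steklov_le i x Ml' ur; rewrite steklov_cst; apply => y.
  by case/andP: (h y).
have := steklov_le i x ur Ml; rewrite steklov_cst; apply => y.
by case/andP: (h y).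
Qed.

Lemma steklov_bnd r i u : lip r u -> bnd u -> bnd (steklov i u).
Proof. by move=> ur [M uM]; exists M => x; exact: steklov_norm_le ur uM. Qed.

Lemma steklov_translate i z u :
  steklov i (translate z u) = translate z (steklov i u).
Proof. by apply/funext => x; rewrite /steklov /translate; under eq_Rintegral do rewrite addrA. Qed.

Lemma steklov_lip i r u : lip r u -> lip r (steklov i u).
Proof.
move=> ur x y.
have ux : lip r (translate x u) by exact: lip_translate.
have uy : lip r (translate y u) by exact: lip_translate.
have tr z : steklov i u z = steklov i (translate z u) 0.
  by rewrite steklov_translate /translate addr0.
rewrite !tr; have := steklovB i ux uy => /(congr1 (@^~ 0)) /= <-.
apply: (@steklov_norm_le (r + r)) => [|z]; first exact: lipB.
by apply: le_trans (ur _ _) _; rewrite opprD addrACA subrr addr0.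
Qed.

Lemma diffqB i u v : diffq i (fun x => u x - v x) = fun x => diffq i u x - diffq i v x.
Proof. by apply/funext => x; rewrite /diffq; ring. Qed.

Lemma diffqZ i a u : diffq i (fun x => a * u x) = fun x => a * diffq i u x.
Proof. by apply/funext => x; rewrite /diffq; ring. Qed.

Lemma diffq_lip i r u : lip r u -> lip (2 * r / eps) (diffq i u).
Proof.
move=> ur x y; rewrite /diffq -mulrBr normrM gtr0_norm ?invr_gt0//.
rewrite mulrAC [X in _ <= X]mulrC ler_wpM2l ?invr_ge0 ?(ltW eps_gt0)//.
have -> : u (x + eps *: e i) - u x - (u (y + eps *: e i) - u y) =
  (u (x + eps *: e i) - u (y + eps *: e i)) - (u x - u y) by ring.
apply: le_trans (ler_normB _ _) _; rewrite -mulrA mulr_natl mulr2n.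
by apply: lerD => //; apply: le_trans (ur _ _) _; rewrite opprD addrACA subrr addr0.
Qed.

Lemma diffq_le i r u x : lip r u -> `|diffq i u x| <= r.
Proof.
move=> ur; rewrite /diffq normrM gtr0_norm ?invr_gt0// ler_pdivrMl// mulrC.
by apply: le_trans (lip_move _ _ ur) _; rewrite enormZ enorm_delta mulr1 gtr0_norm.
Qed.

Lemma diffq_norm_le i u x (M : R) : (forall y, `|u y| <= M) ->
  `|diffq i u x| <= 2 * M / eps.
Proof.
move=> uM; rewrite /diffq normrM gtr0_norm ?invr_gt0// mulrC.
rewrite ler_pM2r ?invr_gt0//; apply: le_trans (ler_normB _ _) _.
by rewrite mulr_natl mulr2n lerD.
Qed.

Lemma steklov_diffq i j r u : lip r u ->
  steklov i (diffq j u) = diffq j (steklov i u).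
Proof.
move=> ur; have ur' := lip_translate (eps *: e j) ur.
have -> : diffq j u = fun x => eps^-1 * (translate (eps *: e j) u x - u x).
  by apply/funext => x; rewrite /diffq /translate [x + _]addrC.
rewrite (steklovZ _ _ (lipB ur' ur)) (steklovB _ ur' ur) steklov_translate.
by apply/funext => x; rewrite /diffq /translate [x + _]addrC.
Qed.

(** A primitive on a half-line suffices: [c] is chosen below all the points at
    which the average is taken. *)
Lemma steklov_primitive i r u x c : lip r u -> c < 0 -> exists G,
  (forall s, c < s -> is_derive s 1 G (u (x + s *: e i))) /\
  forall t, c < t ->
    steklov i u (x + t *: e i) = eps^-1 * (G (t + eps) - G t).
Proof.
move=> ur c0; pose g s := u (x + s *: e i).
have [G dG] := primitive_exists c (lip_line_continuous (line_lip x i ur)).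
exists G; split=> // t ct; rewrite /steklov; congr (_ * _).
have -> : G (t + eps) - G t = G (eps + t) - G (0 + t).
  by rewrite add0r (addrC eps).
under eq_Rintegral do rewrite -addrA -scalerDl.
have := @Rintegral_primitive _ (fun s => G (s + t)) (fun s => g (t + s)) 0 eps eps_gt0.
rewrite /g; apply.
  apply: (@lip_line_continuous r) => a b; apply: le_trans (line_lip _ _ ur _ _) _.
  by rewrite opprD addrACA subrr add0r.
move=> s /andP[s0 _]; rewrite (addrC t).
have cst0 : c < s + t by rewrite ltr_wpDl.
have := is_derive1_comp (f := G) (g := shift t) (dG _ cst0) (is_derive_shift s 1 t).
by rewrite mulr1.
Qed.

(** Averaging in direction [i] turns the difference quotient [diffq i u] into a
    derivative: both ends of the interval of integration move by [t], and the
    integrand is Lipschitz. *)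
Lemma steklov_expansion i r u x t : lip r u ->
  `|steklov i u (x + t *: e i) - steklov i u x - t * diffq i u x|
  <= 2 * r / eps * t ^+ 2.
Proof.
move=> ur; have c0 : - (`|t| + 1) < 0 :> R by rewrite oppr_lt0 ltr_wpDl.
have ct : - (`|t| + 1) < t by have := ler_norm (- t); rewrite normrN; lra.
have [G [dG sG]] := steklov_primitive i x ur c0.
have := sG 0 c0; rewrite scale0r addr0 add0r => sG0.
rewrite sG// sG0 /diffq.
have h2 := primitive_expansion (line_lip x i ur) dG c0 ct.
rewrite scale0r addr0 subr0 in h2.
have ce : - (`|t| + 1) < eps by exact: lt_trans eps_gt0.
have cte : - (`|t| + 1) < t + eps by rewrite ltr_wpDr// ltW.
have h1 := primitive_expansion (line_lip x i ur) dG ce cte.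
rewrite addrK in h1.
have -> : eps^-1 * (G (t + eps) - G t) - eps^-1 * (G eps - G 0) -
    t * (eps^-1 * (u (x + eps *: e i) - u x)) =
  eps^-1 * ((G (t + eps) - G eps - t * u (x + eps *: e i)) -
    (G t - G 0 - t * u x)) by ring.
rewrite normrM gtr0_norm ?invr_gt0// [2 * r / eps]mulrC -mulrA ler_pM2l ?invr_gt0//.
apply: le_trans (ler_normB _ _) _; rewrite -mulrA mulr_natl mulr2n.
exact: lerD.
Qed.

(** Averages are uniform limits of convex combinations of translates, which is
    how a convex operator interacts with them. *)
Lemma steklov_riemann i r u x (N : nat) : lip r u ->
  `|steklov i u x - N.+1%:R^-1 *
    \sum_(j < N.+1) u (x + (eps * j%:R / N.+1%:R) *: e i)| <= r * eps / N.+1%:R.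
Proof.
move=> ur; have [G [dG sG]] := steklov_primitive i x ur (ltrN10 R).
have := sG 0 (ltrN10 R); rewrite scale0r addr0 add0r => ->.
pose p (j : nat) : R := eps * j%:R / N.+1%:R.
have p0 j : -1 < p j.
  by apply: lt_le_trans (ltrN10 R) _; rewrite !mulr_ge0// ltW.
have -> : G eps - G 0 = \sum_(j < N.+1) (G (p j.+1) - G (p j)).
  rewrite -(big_mkord xpredT (fun j => G (p j.+1) - G (p j))) telescope_sumr//.
  by rewrite /p mulr0 mul0r mulfK// pnatr_eq0.
have -> : N.+1%:R^-1 * \sum_(j < N.+1) u (x + (eps * j%:R / N.+1%:R) *: e i) =
  eps^-1 * \sum_(j < N.+1) (p j.+1 - p j) * u (x + p j *: e i).
  rewrite !mulr_sumr; apply: eq_bigr => j _.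
  have -> : p j.+1 - p j = eps / N.+1%:R by rewrite /p -[j.+1]addn1 natrD; ring.
  by rewrite !mulrA mulVf ?gt_eqF// mul1r.
rewrite -mulrBr -sumrB normrM gtr0_norm ?invr_gt0// ler_pdivrMl//.
apply: le_trans (ler_norm_sum _ _ _) _.
apply: (@le_trans _ _ (\sum_(j < N.+1) (r * (eps / N.+1%:R) ^+ 2))).
  apply: ler_sum => j _.
  have -> : eps / N.+1%:R = p j.+1 - p j by rewrite /p -[j.+1]addn1 natrD; ring.
  exact: (primitive_expansion (line_lip x i ur) dG).
rewrite sumr_const card_ord -mulr_natl le_eqVlt; apply/orP; left; apply/eqP.
by field.
Qed.

Lemma steklov_close i r u x : lip r u -> `|steklov i u x - u x| <= r * eps.
Proof.
move=> /(steklov_riemann i x 0); rewrite big_ord1 mulr0 mul0r scale0r addr0.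
by rewrite invr1 mul1r mulr1.
Qed.

End Steklov.


(** * Second-order jets *)

Section Taylor.
Context {R : realType} {d : nat}.
Implicit Types (u v w f : 'rV[R]_d -> R) (x y z : 'rV[R]_d) (a b c r s t C : R).
Implicit Types (p g : 'rV[R]_d -> 'rV[R]_d) (A : 'rV[R]_d -> 'M[R]_d).
Notation e i := (delta_mx 0 i : 'rV[R]_d).

Definition bform (A : 'M[R]_d) x y : R := dot (x *m A) y.

Definition bform_le C (A : 'M[R]_d) :=
  forall x y, `|bform A x y| <= C * enorm x * enorm y.

(** The smoothness that the consistency of the scheme consumes. Stating it as
    an expansion with one constant, rather than through derivatives, lets it
    hold alike for functions with bounded derivatives and for mollified
    Lipschitz functions. *)
Record jet C v p A : Prop := {
  jet_grad : forall x, enorm (p x) <= C ;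
  jet_hess : forall x, bform_le C (A x) ;
  jet_taylor : forall x y,
    `|v (x + y) - v x - dot (p x) y - 2^-1 * bform (A x) y y| <= C * enorm y ^+ 3
}.

Definition grad_expansion C w g := forall x y,
  `|w (x + y) - w x - dot (g x) y| <= C * enorm y ^+ 2.

Lemma bformE (A : 'M[R]_d) x y : bform A x y = \sum_i \sum_j x 0 i * A i j * y 0 j.
Proof.
rewrite /bform /dot exchange_big/=; apply: eq_bigr => j _.
by rewrite mxE mulr_suml.
Qed.

Lemma bform_le_entries C (A : 'M[R]_d) : (forall i j, `|A i j| <= C) ->
  bform_le (d%:R ^+ 2 * C) A.
Proof.
move=> AC x y; rewrite bformE; apply: le_trans (ler_norm_sum _ _ _) _.
apply: (@le_trans _ _ (\sum_(i < d) \sum_(j < d) (C * enorm x * enorm y))).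
  apply: ler_sum => i _; apply: le_trans (ler_norm_sum _ _ _) _.
  apply: ler_sum => j _; rewrite !normrM [`|x 0 i| * _]mulrC.
  by rewrite !ler_pM ?mulr_ge0// coord_le_enorm.
by rewrite !sumr_const !card_ord -mulrnA -[X in X <= _]mulr_natl natrM expr2 !mulrA.
Qed.

Lemma enorm_row_le (f : 'I_d -> R) C : (forall i, `|f i| <= C) ->
  enorm (\row_i f i) <= d%:R * C.
Proof.
move=> fC; apply: le_trans (enorm_le_sum _) _.
rewrite mulr_natl -[X in _ *+ X]card_ord -sumr_const.
by apply: ler_sum => i _; rewrite mxE.
Qed.

(** Moving along the coordinate axes one after the other turns expansions in
    each coordinate direction, with Lipschitz slopes, into a gradient. *)
Lemma grad_expansion_partial C w (g : 'I_d -> 'rV[R]_d -> R) : 0 <= C ->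
  (forall i, lip C (g i)) ->
  (forall i x t, `|w (x + t *: e i) - w x - t * g i x| <= C * t ^+ 2) ->
  grad_expansion (d%:R ^+ 2 * C) w (fun x => \row_i g i x).
Proof.
move=> C0 gC wg x y.
have main (s : seq 'I_d) z :
    `|w (z + \sum_(i <- s) y 0 i *: e i) - w z - \sum_(i <- s) y 0 i * g i z|
    <= (size s)%:R ^+ 2 * C * enorm y ^+ 2.
  elim: s z => [|j s ih] z; first by rewrite !big_nil addr0 !subrr normr0 expr0n !mul0r.
  rewrite !big_cons addrA; set z' := z + y 0 j *: e j.
  set T := \sum_(i <- s) _ *: _.
  have -> : w (z' + T) - w z - (y 0 j * g j z + \sum_(i <- s) y 0 i * g i z) =
    (w (z' + T) - w z' - \sum_(i <- s) y 0 i * g i z') +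
    (w z' - w z - y 0 j * g j z) +
    \sum_(i <- s) y 0 i * (g i z' - g i z).
    by under [X in _ = _ + X]eq_bigr do rewrite mulrBr; rewrite sumrB; ring.
  have yj := coord_le_enorm y j; have y0 := enorm_ge0 y.
  have h1 := ih z'.
  have h2 : `|w z' - w z - y 0 j * g j z| <= C * enorm y ^+ 2.
    apply: le_trans (wg _ _ _) _; rewrite ler_wpM2l// -real_normK ?num_real//.
    by rewrite ler_pXn2r.
  have h3 : `|\sum_(i <- s) y 0 i * (g i z' - g i z)|
      <= (size s)%:R * (C * enorm y ^+ 2).
    apply: le_trans (ler_norm_sum _ _ _) _.
    apply: (@le_trans _ _ (\sum_(i <- s) (C * enorm y ^+ 2))).
      apply: ler_sum => i _; rewrite normrM expr2 mulrCA.
      apply: ler_pM => //; first exact: coord_le_enorm.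
      apply: le_trans (lip_move _ _ (gC i)) _.
      by rewrite enormZ enorm_delta mulr1 ler_wpM2l.
    by rewrite big_const_seq count_predT iter_addr_0 mulr_natl.
  apply: le_trans (ler_normD _ _) _; apply: le_trans (lerD (ler_normD _ _) h3) _.
  apply: le_trans (lerD (lerD h1 h2) (lexx _)) _.
  have -> : (size (j :: s))%:R = (size s)%:R + 1 :> R by rewrite /= natr1.
  have := mulr_ge0 C0 (sqr_ge0 (enorm y)).
  set K := C * _; rewrite -!mulrA -/K => K0.
  have : 0 <= (size s)%:R * K by rewrite mulr_ge0.
  by nra.
have := main (enum 'I_d) x; rewrite size_enum_ord !big_enum/= -row_sum_delta.
by congr (`|_ - _| <= _); apply: eq_bigr => i _; rewrite mxE mulrC.
Qed.

(** A pointwise expansion with quadratic error is a derivative, so that the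
    mean value theorem applies along lines. *)
Lemma is_derive_quadratic (phi : R -> R) t a C :
  (forall s, `|phi (t + s) - phi t - s * a| <= C * s ^+ 2) ->
  is_derive t 1 phi a.
Proof.
move=> h.
have lim : (fun s => s^-1 *: ((phi \o shift t) (s *: 1) - phi t)) @ 0^' --> a.
  apply/cvgrPdist_le => q q0; near=> s.
  have s0 : s != 0 by near: s; exact: nbhs_dnbhs_neq.
  rewrite /= [s *: 1]mulr1 [s + t]addrC.
  have -> : a - s^-1 *: (phi (t + s) - phi t) =
      - s^-1 * (phi (t + s) - phi t - s * a).
    by rewrite /GRing.scale/=; field.
  rewrite normrM normrN normfV ler_pdivrMl ?normr_gt0//.
  apply: le_trans (h s) _; rewrite -real_normK ?num_real// expr2 mulrCA.
  rewrite ler_wpM2l// (@le_trans _ _ ((`|C| + 1) * `|s|))//.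
    rewrite ler_wpM2r//; apply: le_trans (ler_norm C) _; by rewrite lerDl.
  rewrite mulrC -ler_pdivlMr ?ltr_wpDl//; near: s.
  apply: dnbhs0_le; rewrite divr_gt0// ltr_wpDl//.
apply: DeriveDef; first by apply/cvg_ex; exists a.
exact/cvg_lim.
Unshelve. all: by end_near. Qed.

(** Along the segment from [x] to [x + y], the derivative of the remainder is the
    first-order error of the gradient, hence quadratic in [y]. *)
Lemma taylor2 C C' w g A : 0 <= C -> grad_expansion C' w g ->
  (forall i, grad_expansion C (fun x => g x 0 i) (fun x => row i (A x)))  ->
  forall x y, `|w (x + y) - w x - dot (g x) y - 2^-1 * bform (A x) y y|
    <= d%:R * C * enorm y ^+ 3.
Proof.
move=> C0 wg gA x y.
pose phi t := w (x + t *: y) - t * dot (g x) y - 2^-1 * t ^+ 2 * bform (A x) y y.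
pose phi' t := dot (g (x + t *: y)) y - dot (g x) y - t * bform (A x) y y.
have dphi t : is_derive t 1 phi (phi' t).
  apply: (@is_derive_quadratic _ _ _ (C' * enorm y ^+ 2
    + 2^-1 * `|bform (A x) y y|)) => s.
  have -> : phi (t + s) - phi t - s * phi' t =
    (w ((x + t *: y) + s *: y) - w (x + t *: y) - dot (g (x + t *: y)) (s *: y))
    - 2^-1 * bform (A x) y y * s ^+ 2.
    by rewrite /phi /phi' dotZr scalerDl addrA; field.
  apply: le_trans (ler_normB _ _) _; rewrite mulrDl; apply: lerD.
    apply: le_trans (wg _ _) _; rewrite enormZ exprMn real_normK ?num_real//.
    by rewrite [s ^+ 2 * _]mulrC mulrA.
  by rewrite normrM (@ger0_norm _ (s ^+ 2)) ?sqr_ge0// normrM (@ger0_norm _ 2^-1).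
have -> : w (x + y) - w x - dot (g x) y - 2^-1 * bform (A x) y y = phi 1 - phi 0.
  by rewrite /phi scale1r scale0r addr0; ring.
have := @mean_value_le _ phi phi' 0 1 (d%:R * C * enorm y ^+ 3) ler01.
rewrite subr0 mulr1; apply => // t /andP[t0 t1].
have -> : phi' t = \sum_i y 0 i *
    ((g (x + t *: y) 0 i) - g x 0 i - dot (row i (A x)) (t *: y)).
  rewrite /phi' bformE /dot mulr_sumr -!sumrB; apply: eq_bigr => i _.
  rewrite !mulrBr -[in LHS]mulrC -[g x 0 i * _]mulrC; congr (_ - _).
  rewrite !mulr_sumr; apply: eq_bigr => j _; rewrite !mxE; ring.
apply: le_trans (ler_norm_sum _ _ _) _.
rewrite -mulrA mulr_natl -[X in _ *+ X]card_ord -sumr_const.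
apply: ler_sum => i _; rewrite normrM exprS mulrCA.
apply: ler_pM => //; first exact: coord_le_enorm.
apply: le_trans (gA i x (t *: y)) _.
rewrite ler_wpM2l// enormZ exprMn ger0_norm// ler_piMl ?sqr_ge0//.
by rewrite expr_le1.
Qed.

End Taylor.

(** * Mollification by iterated averages *)

Section Smoothing.
Context {R : realType} {d : nat}.
Variable eps : R.
Hypothesis eps_gt0 : 0 < eps.
Implicit Types (u v w : 'rV[R]_d -> R) (x y z : 'rV[R]_d) (a b c r t : R).
Implicit Types (i j : 'I_d) (s : seq 'I_d).
Notation e i := (delta_mx 0 i : 'rV[R]_d).

Definition steklovs s u := foldr (steklov eps) u s.

Lemma steklovs_lip s r u : lip r u -> lip r (steklovs s u).
Proof. by move=> ur; elim: s => //= i s ih; exact: steklov_lip. Qed.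

Lemma steklovs_norm_le s r u x (M : R) : lip r u -> (forall y, `|u y| <= M) ->
  `|steklovs s u x| <= M.
Proof.
move=> ur uM; elim: s x => //= i s ih x.
exact: (steklov_norm_le eps_gt0 i x (steklovs_lip s ur) ih).
Qed.

Lemma steklovs_bnd s r u : lip r u -> bnd u -> bnd (steklovs s u).
Proof. by move=> ur [M uM]; exists M => x; exact: (steklovs_norm_le _ _ ur uM). Qed.

Lemma steklovsD s r r' u v : lip r u -> lip r' v ->
  steklovs s (fun x => u x + v x) = fun x => steklovs s u x + steklovs s v x.
Proof.
move=> ur vr; elim: s => //= i s ->.
by rewrite (steklovD _ i (steklovs_lip s ur) (steklovs_lip s vr)).
Qed.

Lemma steklovsZ s r a u : lip r u ->
  steklovs s (fun x => a * u x) = fun x => a * steklovs s u x.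
Proof.
move=> ur; elim: s => //= i s ->.
by rewrite (steklovZ _ i a (steklovs_lip s ur)).
Qed.

Lemma steklovsB s r r' u v : lip r u -> lip r' v ->
  steklovs s (fun x => u x - v x) = fun x => steklovs s u x - steklovs s v x.
Proof.
move=> ur vr; elim: s => //= i s ->.
by rewrite (steklovB _ i (steklovs_lip s ur) (steklovs_lip s vr)).
Qed.

Lemma steklovs_close s r u x : lip r u ->
  `|steklovs s u x - u x| <= (size s)%:R * (r * eps).
Proof.
move=> ur; elim: s x => /= [|i s ih] x; first by rewrite subrr normr0 mul0r.
have := steklov_close eps_gt0 i x (steklovs_lip s ur).
rewrite -natr1 mulrDl mul1r => h.
rewrite -[_ - _](subrKA (steklovs s u x)) addrC.
apply: le_trans (ler_normD _ _) _; rewrite lerD// ih.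
Qed.

(** Each average in direction [i] buys one derivative in direction [i]; the
    other averages commute with it. *)
Lemma steklovs_expansion s i r u x t : i \in s -> lip r u ->
  `|steklovs s u (x + t *: e i) - steklovs s u x
    - t * diffq eps i (steklovs (rem i s) u) x| <= 2 * r / eps * t ^+ 2.
Proof.
move=> + ur; elim: s x => //= j s ih x; rewrite inE [i == j]eq_sym.
have [->{j} _|ji /= si] := eqVneq j i.
  exact: (steklov_expansion eps_gt0 i x t (steklovs_lip s ur)).
set w := steklovs s u; set w' := steklovs (rem i s) u.
have wr : lip r w by exact: steklovs_lip.
have wtr := lip_translate (t *: e i) wr.
have wr' : lip r w' by exact: steklovs_lip.
have qr := diffq_lip eps_gt0 i wr'.
have := @steklov_norm_le _ _ _ eps_gt0 _ j
  (fun z => (translate (t *: e i) w z - w z) - t * diffq eps i w' z) x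
  (2 * r / eps * t ^+ 2) (lipB (lipB wtr wr) (lipZ t qr)).
rewrite (steklovB _ j (lipB wtr wr) (lipZ t qr)) (steklovB _ j wtr wr).
rewrite (steklovZ _ j t qr) steklov_translate (steklov_diffq _ _ _ wr').
rewrite /translate [_ + x]addrC; apply => y; rewrite [_ + y]addrC.
exact: ih.
Qed.

(** Two averages per coordinate direction, as each derivative in that direction
    uses up one of them; the Lipschitz continuity of [u] itself pays for the
    cubic remainder. *)
Definition smooth u := steklovs (enum 'I_d ++ enum 'I_d) u.

Let s2 := enum 'I_d ++ enum 'I_d.

(** A derivative in direction [i] replaces one average by a difference quotient,
    which is why [i] is removed from the list of directions. *)
Definition smooth_grad u x : 'rV[R]_d :=
  \row_i diffq eps i (steklovs (rem i s2) u) x.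

Definition smooth_hess u x : 'M[R]_d :=
  \matrix_(i, j) diffq eps i (diffq eps j (steklovs (rem j (rem i s2)) u)) x.

Lemma mem_rem_s2 i j : j \in rem i s2.
Proof.
have is2 : i \in s2 by rewrite mem_cat mem_enum.
have := permP (perm_to_rem is2) (pred1 j).
rewrite /s2 count_cat !(count_uniq_mem _ (enum_uniq 'I_d)) !mem_enum/= => h.
rewrite -has_pred1 has_count; move: h; case: (i == j) => /= h.
  by have <- : 1%N = count_mem j (rem i s2) by case: h.
by have <- : 2%N = count_mem j (rem i s2) by exact: h.
Qed.

Definition smooth_cst : R :=
  d%:R + d%:R ^+ 2 * (2 / eps) + d%:R ^+ 3 * (4 / eps ^+ 2).

Lemma smooth_cst_ge0 : 0 <= smooth_cst.
Proof.
by have e0 := ltW eps_gt0; rewrite !addr_ge0// mulr_ge0// divr_ge0// exprn_ge0.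
Qed.

(** The constant is linear in the Lipschitz constant of [u] and independent of
    its sup norm. This makes flat functions of arbitrary height almost
    stationary under the scheme. *)
Lemma smooth_jet r u : 0 <= r -> lip r u ->
  jet (smooth_cst * r) (smooth u) (smooth_grad u) (smooth_hess u).
Proof.
move=> r0 ur; have e0 := ltW eps_gt0.
have rs i : lip r (steklovs (rem i s2) u) by exact: steklovs_lip.
have rrs i j : lip r (steklovs (rem j (rem i s2)) u) by exact: steklovs_lip.
have t1 : 0 <= d%:R * r by rewrite mulr_ge0.
have t2 : 0 <= d%:R ^+ 2 * (2 / eps) * r by rewrite !mulr_ge0// invr_ge0.
have t3 : 0 <= d%:R ^+ 3 * (4 / eps ^+ 2) * r.
  by rewrite !mulr_ge0// invr_ge0 exprn_ge0.
have ->: smooth_cst * r = d%:R * r + d%:R ^+ 2 * (2 / eps) * r +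
  d%:R ^+ 3 * (4 / eps ^+ 2) * r by rewrite /smooth_cst !mulrDl.
split.
- move=> x; apply: (@le_trans _ _ (d%:R * r)); last by lra.
  by apply: enorm_row_le => i; exact: diffq_le.
- move=> x; have : bform_le (d%:R ^+ 2 * (2 * r / eps)) (smooth_hess u x).
    apply: bform_le_entries => i j; rewrite mxE.
    by apply: diffq_le => //; exact: diffq_lip.
  move=> h y z; apply: le_trans (h y z) _.
  rewrite ler_wpM2r ?enorm_ge0// ler_wpM2r ?enorm_ge0//.
  by rewrite (_ : d%:R ^+ 2 * (2 * r / eps) = d%:R ^+ 2 * (2 / eps) * r);
    [lra|ring].
- have C4 : 0 <= 4 * r / eps ^+ 2 by rewrite divr_ge0 ?exprn_ge0 ?mulr_ge0.
  have C2 : 0 <= 2 * r / eps by rewrite divr_ge0 ?mulr_ge0.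
  have E1 : grad_expansion (d%:R ^+ 2 * (2 * r / eps)) (smooth u) (smooth_grad u).
    apply: grad_expansion_partial => //.
      by move=> i; exact: diffq_lip.
    move=> i x t; apply: steklovs_expansion => //.
    by rewrite mem_cat mem_enum.
  have E2 i : grad_expansion (d%:R ^+ 2 * (4 * r / eps ^+ 2))
      (fun x => smooth_grad u x 0 i) (fun x => row i (smooth_hess u x)).
    rewrite (_ : (fun x => smooth_grad u x 0 i) = diffq eps i (steklovs (rem i s2) u));
      last by apply/funext => x; rewrite mxE.
    rewrite (_ : (fun x => row i (smooth_hess u x)) = fun x => \row_j
      diffq eps i (diffq eps j (steklovs (rem j (rem i s2)) u)) x); last first.
      by apply/funext => x; apply/rowP => j; rewrite !mxE.
    apply: grad_expansion_partial => //.
      move=> j; rewrite (_ : 4 * r / eps ^+ 2 = 2 * (2 * r / eps) / eps).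
        by apply: diffq_lip => //; exact: diffq_lip.
      by field; rewrite gt_eqF.
    move=> j x t; set w := steklovs (rem i s2) u.
    set w' := steklovs _ u.
    have := @diffq_norm_le _ _ _ eps_gt0 i (fun y => translate (t *: e j) w y - w y
      - t * diffq eps j w' y) x (2 * r / eps * t ^+ 2).
    rewrite !diffqB diffqZ (_ : 2 * (_ * _) / _ = 4 * r / eps ^+ 2 * t ^+ 2); last first.
      by field; rewrite gt_eqF.
    rewrite [X in `|X - _ - _|](_ : _ = diffq eps i w (x + t *: e j)); last first.
      by rewrite /diffq /translate ![t *: _ + _]addrC addrAC.
    apply => y; rewrite /translate [_ + y]addrC.
    by apply: steklovs_expansion => //; exact: mem_rem_s2.
  move=> x y; apply: le_trans (taylor2 _ E1 E2 x y) _.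
    by rewrite mulr_ge0 ?exprn_ge0.
  rewrite ler_wpM2r ?exprn_ge0 ?enorm_ge0//.
  rewrite (_ : d%:R * (d%:R ^+ 2 * (4 * r / eps ^+ 2)) =
    d%:R ^+ 3 * (4 / eps ^+ 2) * r); [lra|ring].
Qed.

Lemma smooth_gradB r r' u v x : lip r u -> lip r' v ->
  smooth_grad (fun x => u x - v x) x = smooth_grad u x - smooth_grad v x.
Proof.
by move=> ur vr; apply/rowP => i; rewrite !mxE (steklovsB _ ur vr) diffqB.
Qed.

Lemma smooth_hessB r r' u v x : lip r u -> lip r' v ->
  smooth_hess (fun x => u x - v x) x = smooth_hess u x - smooth_hess v x.
Proof.
move=> ur vr; apply/matrixP => i j.
by rewrite !mxE (steklovsB _ ur vr) !diffqB.
Qed.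

Definition smooth_cst0 : R := d%:R * (2 / eps) + d%:R ^+ 2 * (4 / eps ^+ 2).

Lemma smooth_cst0_ge0 : 0 <= smooth_cst0.
Proof.
by have e0 := ltW eps_gt0; rewrite !addr_ge0// mulr_ge0// divr_ge0// exprn_ge0.
Qed.

(** The jet depends on [u] through its sup norm, at the price of negative powers
    of [eps]: functions that are uniformly close have close jets. *)
Lemma smooth_jet_close r r' u v (M : R) x : lip r u -> lip r' v ->
  (forall y, `|u y - v y| <= M) ->
  enorm (smooth_grad u x - smooth_grad v x) <= smooth_cst0 * M /\
  bform_le (smooth_cst0 * M) (smooth_hess u x - smooth_hess v x).
Proof.
move=> ur vr uvM; have e0 := ltW eps_gt0.
have uv := lipB ur vr.
have M0 : 0 <= M by apply: le_trans (uvM 0).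
have t1 : 0 <= d%:R * (2 / eps) * M by rewrite !mulr_ge0// invr_ge0.
have t2 : 0 <= d%:R ^+ 2 * (4 / eps ^+ 2) * M.
  by rewrite !mulr_ge0// invr_ge0 exprn_ge0.
rewrite -(smooth_gradB x ur vr) -(smooth_hessB x ur vr) /smooth_cst0 mulrDl.
have M1 s y : `|steklovs s (fun x => u x - v x) y| <= M.
  exact: (steklovs_norm_le _ _ uv).
split.
  apply: (@le_trans _ _ (d%:R * (2 * M / eps))).
    by apply: enorm_row_le => i; exact: diffq_norm_le.
  by rewrite (_ : d%:R * (2 * M / eps) = d%:R * (2 / eps) * M); [lra|ring].
move=> y z; have : bform_le (d%:R ^+ 2 * (2 * (2 * M / eps) / eps))
    (smooth_hess (fun x => u x - v x) x).
  apply: bform_le_entries => i j; rewrite mxE.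
  by apply: diffq_norm_le => // a; exact: diffq_norm_le.
move=> h; apply: le_trans (h y z) _.
rewrite ler_wpM2r ?enorm_ge0// ler_wpM2r ?enorm_ge0//.
rewrite (_ : d%:R ^+ 2 * (2 * (2 * M / eps) / eps) = d%:R ^+ 2 * (4 / eps ^+ 2) * M).
  by lra.
by field; rewrite gt_eqF.
Qed.

Lemma smooth_lip r u : lip r u -> lip r (smooth u).
Proof. exact: steklovs_lip. Qed.

Lemma smooth_bnd r u : lip r u -> bnd u -> bnd (smooth u).
Proof. exact: steklovs_bnd. Qed.

Lemma smooth_close r u x : lip r u ->
  `|smooth u x - u x| <= (d + d)%:R * (r * eps).
Proof. by move=> /(steklovs_close s2 x); rewrite size_cat size_enum_ord. Qed.

End Smoothing.


(** * Functions with bounded derivatives of all orders *)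

Section SmoothFunctions.
Context {R : realType} {d : nat}.
Implicit Types (u v w f : 'rV[R]_d -> R) (x y z : 'rV[R]_d) (a b c r s t C : R).
Notation e i := (delta_mx 0 i : 'rV[R]_d).

Lemma is_derive_line f x y t : differentiable f (x + t *: y) ->
  is_derive t 1 (fun t => f (x + t *: y)) (dot (grad f (x + t *: y)) y).
Proof.
move=> df; set z := x + t *: y.
have -> : dot (grad f z) y = 'D_y f z.
  rewrite deriveE// {2}(row_sum_delta y) linear_sum; apply: eq_bigr => i _.
  by rewrite linearZ/= mxE /partial deriveE// mulrC.
have E : (fun h : R => h^-1 *: (((fun t => f (x + t *: y)) \o shift t) (h *: 1) -
    f (x + t *: y))) = (fun h : R => h^-1 *: ((f \o shift z) (h *: y) - f z)).
  apply/funext => h /=; rewrite [h *: 1]mulr1 scalerDl /z.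
  by congr (_ *: (f _ - _)); rewrite addrCA.
have dy : derivable f z y by exact: diff_derivable.
apply: DeriveDef; first by rewrite /derivable E.
by rewrite /derive E.
Qed.

Lemma uniform_bound (I : finType) (F : I -> 'rV[R]_d -> R) :
  (forall i, bnd (F i)) -> exists2 M, 0 <= M & forall i x, `|F i x| <= M.
Proof.
move=> /choice[M FM]; exists (\sum_i `|M i|); first exact: sumr_ge0.
move=> i x; apply: le_trans (FM i x) _; rewrite (bigD1 i)//=.
by apply: le_trans (ler_norm _) _; rewrite lerDl sumr_ge0.
Qed.

Lemma dot_le_entries x y C : 0 <= C -> (forall i, `|x 0 i| <= C) ->
  `|dot x y| <= d%:R * C * enorm y.
Proof.
move=> C0 xC; apply: le_trans (ler_norm_sum _ _ _) _.
apply: (@le_trans _ _ (\sum_(i < d) C * enorm y)).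
  by apply: ler_sum => i _; rewrite normrM ler_pM// coord_le_enorm.
by rewrite sumr_const card_ord -[X in X <= _]mulr_natl mulrA.
Qed.

Lemma differentiable_lip f C : 0 <= C -> (forall x, differentiable f x) ->
  (forall i x, `|partial i f x| <= C) -> lip (d%:R * C) f.
Proof.
move=> C0 df fC x y.
have := @mean_value_le _ (fun t => f (y + t *: (x - y)))
  (fun t => dot (grad f (y + t *: (x - y))) (x - y)) 0 1
  (d%:R * C * enorm (x - y)) ler01.
rewrite scale1r scale0r addr0 subrKC subr0 mulr1; apply => t _.
  exact: is_derive_line.
by apply: dot_le_entries => // i; rewrite mxE.
Qed.

Lemma differentiable_grad_expansion f C : 0 <= C ->
  (forall x, differentiable f x) -> (forall i, lip C (partial i f)) ->
  grad_expansion (d%:R * C) f (grad f).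
Proof.
move=> C0 df fC x y.
pose phi t := f (x + t *: y) - t * dot (grad f x) y.
pose phi' t := dot (grad f (x + t *: y) - grad f x) y.
have dphi t : is_derive t 1 phi (phi' t).
  have -> : phi' t = dot (grad f (x + t *: y)) y -
      (t * 0 + dot (grad f x) y * 1) by rewrite /phi' dotDl dotNl; ring.
  apply: is_deriveB; last exact: is_deriveM.
  exact: is_derive_line.
have -> : f (x + y) - f x - dot (grad f x) y = phi 1 - phi 0.
  by rewrite /phi scale1r scale0r addr0; ring.
have := @mean_value_le _ phi phi' 0 1 (d%:R * C * enorm y ^+ 2) ler01.
rewrite subr0 mulr1; apply => // t /andP[t0 t1].
rewrite expr2 mulrA -[_ * C * _]mulrA.
apply: dot_le_entries => [|i]; first by rewrite mulr_ge0 ?enorm_ge0.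
rewrite !mxE; apply: le_trans (lip_move _ _ (fC i)) _.
rewrite ler_wpM2l// enormZ ger0_norm// ler_piMl ?enorm_ge0//.
Qed.

(** The Hessian arises transposed, as the gradient of the gradient; both
    matrices have the same quadratic form. *)
Lemma bform_tr (A : 'M[R]_d) x : bform A^T x x = bform A x x.
Proof.
rewrite !bformE exchange_big/=; apply: eq_bigr => i _; apply: eq_bigr => j _.
by rewrite mxE; ring.
Qed.

Lemma bform_le_ge C C' (A : 'M[R]_d) : C <= C' -> bform_le C A -> bform_le C' A.
Proof.
move=> CC AC x y; apply: le_trans (AC x y) _.
by rewrite ler_wpM2r ?enorm_ge0// ler_wpM2r ?enorm_ge0.
Qed.

Lemma Cbinfty_jet f : Cbinfty f -> exists C,
  [/\ 0 <= C, lip C f, bnd f, jet C f (grad f) (hess f) &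
  (forall x y, enorm (grad f x - grad f y) <= C * enorm (x - y)) /\
  (forall x y, bform_le (C * enorm (x - y)) (hess f x - hess f y))].
Proof.
move=> fs.
have df (l : seq 'I_d) x : differentiable (foldr partial f l) x by exact: (fs l).1.
have bf (l : seq 'I_d) : bnd (foldr partial f l).
  by apply/bounded_fun_bnd; exact: (fs l).2.
have [M1 M10 fM1] := uniform_bound (fun i : 'I_d => bf [:: i]).
have [M2 M20 fM2] := uniform_bound (fun ij : 'I_d * 'I_d => bf [:: ij.1; ij.2]).
have [M3 M30 fM3] := uniform_bound (fun ij : 'I_d * 'I_d * 'I_d =>
  bf [:: ij.1.1; ij.1.2; ij.2]).
have d0 : 0 <= d%:R :> R by [].
have l0 : lip (d%:R * M1) f by apply: differentiable_lip => //; exact: df [::].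
have l1 i : lip (d%:R * M2) (partial i f).
  apply: differentiable_lip => //; first exact: df [:: i].
  by move=> j; exact: fM2 (j, i).
have l2 i j : lip (d%:R * M3) (partial i (partial j f)).
  apply: differentiable_lip => //; first exact: df [:: i; j].
  by move=> k; exact: fM3 (k, i, j).
have E1 : grad_expansion (d%:R * (d%:R * M2)) f (grad f).
  by apply: differentiable_grad_expansion => //; [exact: mulr_ge0|exact: df [::]].
have E2 i : grad_expansion (d%:R * (d%:R * M3)) (fun x => grad f x 0 i)
    (fun x => row i (hess f x)^T).
  rewrite (_ : (fun x => grad f x 0 i) = partial i f); last first.
    by apply/funext => x; rewrite mxE.
  rewrite (_ : (fun x => row i (hess f x)^T) = grad (partial i f)); last first.
    by apply/funext => x; apply/rowP => j; rewrite !mxE.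
  by apply: differentiable_grad_expansion => //; [exact: mulr_ge0|exact: df [:: i]].
pose D := d%:R + d%:R ^+ 2 + d%:R ^+ 3 : R.
have D0 : 0 <= D by rewrite !addr_ge0 ?exprn_ge0.
pose C := D * (M1 + M2 + M3).
have dM1 : 0 <= d%:R * M1 by rewrite mulr_ge0.
have dM2 : 0 <= d%:R * M2 by rewrite mulr_ge0.
have dM3 : 0 <= d%:R * M3 by rewrite mulr_ge0.
have ddM1 : 0 <= d%:R ^+ 2 * M1 by rewrite mulr_ge0 ?exprn_ge0.
have ddM2 : 0 <= d%:R ^+ 2 * M2 by rewrite mulr_ge0 ?exprn_ge0.
have ddM3 : 0 <= d%:R ^+ 2 * M3 by rewrite mulr_ge0 ?exprn_ge0.
have dddM1 : 0 <= d%:R ^+ 3 * M1 by rewrite mulr_ge0 ?exprn_ge0.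
have dddM2 : 0 <= d%:R ^+ 3 * M2 by rewrite mulr_ge0 ?exprn_ge0.
have dddM3 : 0 <= d%:R ^+ 3 * M3 by rewrite mulr_ge0 ?exprn_ge0.
have EC : C = (d%:R * M1 + d%:R * M2 + d%:R * M3) +
  (d%:R ^+ 2 * M1 + d%:R ^+ 2 * M2 + d%:R ^+ 2 * M3) +
  (d%:R ^+ 3 * M1 + d%:R ^+ 3 * M2 + d%:R ^+ 3 * M3) by rewrite /C /D; ring.
exists C; split.
- by rewrite mulr_ge0 ?addr_ge0.
- apply: lip_le l0; lra.
- exact: bf [::].
- split.
  + move=> x; apply: (@le_trans _ _ (d%:R * M1)); last by lra.
    by apply: enorm_row_le => i; exact: fM1.
  + move=> x; apply: (@bform_le_ge (d%:R ^+ 2 * M2)); first by lra.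
    apply: bform_le_entries => i j; rewrite mxE. exact: fM2 (i, j) x.
  + move=> x y; rewrite -(bform_tr (hess f x)).
    apply: le_trans (taylor2 _ E1 E2 x y) _; first by rewrite !mulr_ge0.
    rewrite ler_wpM2r ?exprn_ge0 ?enorm_ge0//.
    by rewrite (_ : d%:R * (d%:R * (d%:R * M3)) = d%:R ^+ 3 * M3); [lra|ring].
- split=> x y; have xy0 := enorm_ge0 (x - y).
  + apply: (@le_trans _ _ (d%:R * (d%:R * M2 * enorm (x - y)))).
      rewrite (_ : grad f x - grad f y = \row_i (partial i f x - partial i f y)).
        by apply: enorm_row_le => i; exact: l1.
      by apply/rowP => i; rewrite !mxE.
    rewrite (_ : d%:R * (d%:R * M2 * _) = d%:R ^+ 2 * M2 * enorm (x - y)).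
      by rewrite ler_wpM2r//; lra.
    by ring.
  + apply: (@bform_le_ge (d%:R ^+ 2 * (d%:R * M3 * enorm (x - y)))).
      rewrite (_ : d%:R ^+ 2 * _ = d%:R ^+ 3 * M3 * enorm (x - y)); last by ring.
      by rewrite ler_wpM2r//; lra.
    by apply: bform_le_entries => i j; rewrite !mxE; exact: l2.
Qed.

End SmoothFunctions.


(** * Approximation schemes *)

(** The properties of the one-step operators on which convergence rests; [h n]
    is the step size and [G] the Hamiltonian of the limit equation. Consistency
    is uniform over all functions with the same jet constant: the mollified
    iterates of one scheme, which change with the step size, are inserted as
    test functions into another scheme. *)
Record approx_scheme {R : realType} {d : nat}
    (J : nat -> ('rV[R]_d -> R) -> 'rV[R]_d -> R) (h : nat -> R) (L K : R)
    (G : 'rV[R]_d -> 'rV[R]_d -> 'M[R]_d -> R) : Prop := {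
  as_h_gt0 : forall n, 0 < h n ;
  as_h_cvg : h @ \oo --> (0 : R) ;
  as_L_ge0 : 0 <= L ;
  as_K_ge0 : 0 <= K ;
  as_Cb : forall n f, Cb f -> Cb (J n f) ;
  as_mono : forall n f g, Cb f -> Cb g -> (forall x, f x <= g x) ->
    forall x, J n f x <= J n g x ;
  as_add : forall n f c, Cb f -> J n (fun x => f x + c) = fun x => J n f x + c ;
  as_cst : forall n c, J n (cst c) = cst c ;
  as_convex : forall n f g (l : R) x, Cb f -> Cb g -> 0 <= l <= 1 ->
    J n (fun y => l * f y + (1 - l) * g y) x <= l * J n f x + (1 - l) * J n g x ;
  as_lip : forall n f r, 0 <= r -> lip r f -> bnd f ->
    lip (r * (1 + L * h n)) (J n f) ;
  as_translate : forall n f r x z, 0 <= r -> lip r f -> bnd f ->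
    `|J n (translate z f) x - J n f (z + x)| <= L * h n * r * enorm z ;
  as_consistent : forall C eta, 0 <= C -> 0 < eta -> exists N, forall n,
    (N <= n)%N -> forall v p A, Cb v -> jet C v p A ->
    forall x, `|J n v x - v x - h n * G x (p x) (A x)| <= eta * h n ;
  as_G0 : forall x, G x 0 0 = 0 ;
  as_G_close : forall C a x p q A B, 0 <= C -> 0 <= a ->
    enorm p <= C -> enorm q <= C -> enorm (p - q) <= a -> bform_le a (A - B) ->
    `|G x p A - G x q B| <= K * (1 + C) * a ;
  as_G_lip : forall x y p A, `|G x p A - G y p A| <= K * enorm p * enorm (x - y)
}.

Section Scheme.
Context {R : realType} {d : nat}.
Variables (J : nat -> ('rV[R]_d -> R) -> 'rV[R]_d -> R) (h : nat -> R) (L K : R).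
Variable (G : 'rV[R]_d -> 'rV[R]_d -> 'M[R]_d -> R).
Hypothesis S : approx_scheme J h L K G.
Implicit Types (f g u v w : 'rV[R]_d -> R) (x y z : 'rV[R]_d).
Implicit Types (a b c r s t C T eps eta sigma tau : R) (n m k j i : nat).
Notation D2 := ((d + d)%:R : R).

Let h0 n : 0 < h n. Proof. exact: as_h_gt0 S n. Qed.
Let h0' n : 0 <= h n. Proof. exact/ltW/h0. Qed.
Let L0 : 0 <= L. Proof. exact: as_L_ge0 S. Qed.
Let K0 : 0 <= K. Proof. exact: as_K_ge0 S. Qed.

Lemma exists_small a b : 0 <= a -> 0 < b -> exists2 e, 0 < e & a * e <= b.
Proof.
move=> a0 b0; exists (b / (a + 1)); first by rewrite divr_gt0// ltr_wpDl.
rewrite mulrA ler_pdivrMr ?ltr_wpDl// mulrC ler_pM2l//; lra.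
Qed.

Lemma h_small e : 0 < e -> exists N, forall n, (N <= n)%N -> h n <= e.
Proof.
move=> e0; have /cvgrPdist_le/(_ e e0)[N _ hN] := as_h_cvg S.
by exists N => n /hN /=; rewrite sub0r normrN gtr0_norm.
Qed.

Lemma contraction n f g a x : Cb f -> Cb g -> (forall y, `|f y - g y| <= a) ->
  `|J n f x - J n g x| <= a.
Proof.
move=> Cf Cg fg.
have half u v : Cb u -> Cb v -> (forall y, `|u y - v y| <= a) ->
    J n u x - J n v x <= a.
  move=> Cu Cv uv; rewrite lerBlDl -[leRHS]/((fun x => J n v x + a) x).
  rewrite -(as_add S)//; apply: (as_mono S) => //.
    by apply: CbD => //; exact: Cb_cst.
  by move=> y; have := le_trans (ler_norm _) (uv y); rewrite lerBlDl.
rewrite ler_norml half// andbT lerNl opprB half// => y; rewrite distrC.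
exact: fg.
Qed.

Lemma iter_Cb n k f : Cb f -> Cb (iter k (J n) f).
Proof. by move=> Cf; elim: k => //= k ih; exact: (as_Cb S). Qed.

Lemma iter_mono n k f g x : Cb f -> Cb g -> (forall y, f y <= g y) ->
  iter k (J n) f x <= iter k (J n) g x.
Proof.
move=> Cf Cg fg; elim: k x => //= k ih x.
by apply: (as_mono S) => //; exact: iter_Cb.
Qed.

Lemma iter_add n k f c : Cb f ->
  iter k (J n) (fun x => f x + c) = fun x => iter k (J n) f x + c.
Proof.
move=> Cf; elim: k => //= k ->; rewrite (as_add S)//; exact: iter_Cb.
Qed.

Lemma iter_cst n k c : iter k (J n) (cst c) = cst c.
Proof. by elim: k => //= k ->; exact: (as_cst S). Qed.

Lemma iter_convex n k f g (l : R) x : Cb f -> Cb g -> 0 <= l <= 1 ->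
  iter k (J n) (fun y => l * f y + (1 - l) * g y) x <=
  l * iter k (J n) f x + (1 - l) * iter k (J n) g x.
Proof.
move=> Cf Cg l01; elim: k x => //= k ih x.
have Cfk := iter_Cb n k Cf; have Cgk := iter_Cb n k Cg.
apply: le_trans (as_convex S n x Cfk Cgk l01).
apply: (as_mono S) => //; first by apply: iter_Cb; apply: CbD; exact: CbZ.
by apply: CbD; exact: CbZ.
Qed.

Lemma iter_contraction n k f g a x : Cb f -> Cb g ->
  (forall y, `|f y - g y| <= a) -> `|iter k (J n) f x - iter k (J n) g x| <= a.
Proof.
move=> Cf Cg fg; elim: k x => //= k ih x.
by apply: contraction => //; exact: iter_Cb.
Qed.

Lemma iter_norm_le n k f (M : R) x : Cb f -> (forall y, `|f y| <= M) ->
  `|iter k (J n) f x| <= M.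
Proof.
move=> Cf fM; have := @iter_contraction n k f (cst 0) M x Cf (Cb_cst 0).
by rewrite iter_cst /cst subr0; apply => y; rewrite subr0.
Qed.

Lemma iter_bnd n k f : Cb f -> bnd (iter k (J n) f).
Proof. by move=> /(iter_Cb n k)/Cb_bnd. Qed.

Lemma growth_ge1 n : 1 <= 1 + L * h n.
Proof. by rewrite lerDl mulr_ge0. Qed.

Lemma growth_le n k T : k%:R * h n <= T -> (1 + L * h n) ^+ k <= expR (L * T).
Proof.
move=> kT; apply: (@le_trans _ _ (expR (L * h n) ^+ k)).
  by apply: lerXn2r; rewrite ?nnegrE ?expR_ge0 ?expR_ge1Dx// addr_ge0// mulr_ge0.
by rewrite -expRM_natl ler_expR mulrCA ler_wpM2l.
Qed.

Lemma iter_lip_growth n k f r : 0 <= r -> lip r f -> bnd f ->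
  lip (r * (1 + L * h n) ^+ k) (iter k (J n) f).
Proof.
move=> r0 fr bf; elim: k => [|k ih]; first by rewrite expr0 mulr1.
rewrite exprSr mulrA /=; apply: (as_lip S) => //.
  by rewrite mulr_ge0// exprn_ge0// (le_trans ler01)// growth_ge1.
by apply: iter_bnd; exact: lip_Cb fr bf.
Qed.

Lemma iter_lip n k f r T : 0 <= r -> lip r f -> bnd f -> k%:R * h n <= T ->
  lip (r * expR (L * T)) (iter k (J n) f).
Proof.
move=> r0 fr bf kT; apply: lip_le (iter_lip_growth n k r0 fr bf).
by rewrite ler_wpM2l// growth_le.
Qed.

Lemma iter_translate n k f r T x z : 0 <= r -> lip r f -> bnd f ->
  k%:R * h n <= T ->
  `|iter k (J n) (translate z f) x - iter k (J n) f (z + x)|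
  <= L * expR (L * T) * r * (k%:R * h n) * enorm z.
Proof.
move=> r0 fr bf kT; have Cf := lip_Cb fr bf.
have z0 := enorm_ge0 z; have e0 := expR_ge0 (L * T).
elim: k kT x => [|k ih] kT x.
  by rewrite mul0r mulr0 mul0r /= /translate subrr normr0.
have kT' : k%:R * h n <= T.
  by apply: le_trans kT; rewrite ler_wpM2r// ler_nat.
rewrite -[_ - _](subrKA (J n (translate z (iter k (J n) f)) x)).
apply: le_trans (ler_normD _ _) _; rewrite -natr1 [(_ + 1) * _]mulrDl mul1r.
rewrite [leRHS](_ : _ = L * expR (L * T) * r * (k%:R * h n) * enorm z +
   L * h n * (r * expR (L * T)) * enorm z); last by ring.
apply: lerD.
  apply: contraction; [apply/iter_Cb/Cb_translate/Cf|apply/Cb_translate/iter_Cb/Cf|].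
  by move=> y; exact: ih.
apply: (as_translate S) => //; [exact: mulr_ge0|exact: iter_lip|exact: iter_bnd].
Qed.

(** * Jensen inequality for averages of translates *)

Lemma Cb_average (u : nat -> 'rV[R]_d -> R) N : (forall j, Cb (u j)) ->
  Cb (fun x => N.+1%:R^-1 * \sum_(j < N.+1) u j x).
Proof.
move=> Cu; apply: CbZ; elim: N.+1 => [|M ih].
  by under eq_fun do rewrite big_ord0; exact: Cb_cst.
by under eq_fun do rewrite big_ord_recr/=; exact: CbD.
Qed.

Lemma average_le n (u : nat -> 'rV[R]_d -> R) N x : (forall j, Cb (u j)) ->
  J n (fun y => N.+1%:R^-1 * \sum_(j < N.+1) u j y) x <=
  N.+1%:R^-1 * \sum_(j < N.+1) J n (u j) x.
Proof.
move=> Cu; elim: N => [|N ih].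
  rewrite big_ord1 invr1 mul1r le_eqVlt; apply/orP; left; apply/eqP.
  by congr (J n _ x); apply/funext => y; rewrite big_ord1 mul1r.
have split_avg (F : nat -> R) : N.+2%:R^-1 * \sum_(j < N.+2) F j =
    (N.+1%:R / N.+2%:R) * (N.+1%:R^-1 * \sum_(j < N.+1) F j) +
    (1 - N.+1%:R / N.+2%:R) * F N.+1.
  rewrite big_ord_recr/= mulrDr mulrA; congr (_ * _ + _ * _).
    by rewrite mulrAC mulfV ?pnatr_eq0// mul1r.
  have -> : N.+2%:R = N.+1%:R + 1 :> R by rewrite natr1.
  have : N.+1%:R + 1 != 0 :> R by rewrite natr1 pnatr_eq0.
  by set a := N.+1%:R => a0; field.
have l01 : 0 <= (N.+1%:R / N.+2%:R : R) <= 1.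
  by rewrite divr_ge0// ler_pdivrMr// mul1r ler_nat leqnSn.
under [X in J n X x]eq_fun do rewrite (split_avg (fun j => u j _)).
rewrite (split_avg (fun j => J n (u j) x)).
apply: le_trans (as_convex S n x (Cb_average N Cu) (Cu _) l01) _.
by rewrite lerD2r ler_wpM2l//; case/andP: l01.
Qed.

Lemma le_of_forall_invn a b c : (forall N : nat, a <= b + c / N.+1%:R) -> a <= b.
Proof.
move=> H; apply/ler_addgt0Pr => q q0.
have [c0|c0] := leP c 0.
  apply: le_trans (H 0%N) _; rewrite invr1 mulr1; lra.
have [N _ HN] := near_infty_natSinv_lt (PosNum (divr_gt0 q0 c0)).
apply: le_trans (H N) _; rewrite lerD2l mulrC -ler_pdivlMr//.
by apply/ltW; have := HN N (leqnn _).
Qed.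

(** Jensen's inequality for Riemann sums, up to the error made by commuting the
    operator with translations of length at most [eps]. *)
Lemma steklov_jensen eps n (i0 : 'I_d) u r x : 0 < eps -> 0 <= r -> lip r u -> bnd u ->
  J n (steklov eps i0 u) x <=
  steklov eps i0 (J n u) x + L * h n * r * eps.
Proof.
move=> eps0 r0 ur bu; have Cu := lip_Cb ur bu; have e0 := ltW eps0.
have Jr := as_lip S n r0 ur bu.
set r' := r * (1 + L * h n) in Jr.
apply: (@le_of_forall_invn _ _ ((r + r') * eps)) => N.
pose q (j : nat) : 'rV[R]_d := (eps * j%:R / N.+1%:R) *: delta_mx 0 i0.
have qe (j : 'I_N.+1) : enorm (q j) <= eps.
  rewrite /q enormZ enorm_delta mulr1 ger0_norm ?divr_ge0 ?mulr_ge0//.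
  by rewrite ler_pdivrMr// ler_wpM2l// ler_nat ltnW.
pose avg (f : 'rV[R]_d -> R) y := N.+1%:R^-1 * \sum_(j < N.+1) translate (q j) f y.
have Cavg f : Cb f -> Cb (avg f).
  by move=> Cf; apply: (@Cb_average (fun j => translate (q j) f)) => j;
    exact: Cb_translate.
have close s f y : lip s f -> `|steklov eps i0 f y - avg f y| <= s * eps / N.+1%:R.
  move=> fs; have := steklov_riemann eps0 i0 y N fs.
  by under eq_bigr do rewrite addrC.
have A0 : J n (steklov eps i0 u) x <= J n (avg u) x + r * eps / N.+1%:R.
  rewrite addrC -lerBlDr; apply: le_trans (ler_norm _) _.
  apply: contraction => [||y]; [|exact: Cavg|exact: close].
  by apply: lip_Cb (steklov_lip eps0 i0 ur) (steklov_bnd eps0 i0 ur bu).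
have A1 : J n (avg u) x <= avg (J n u) x + L * h n * r * eps.
  apply: le_trans (@average_le n (fun j => translate (q j) u) N x _) _.
    by move=> j; exact: Cb_translate.
  have -> : L * h n * r * eps =
      N.+1%:R^-1 * \sum_(j < N.+1) (L * h n * r * eps).
    by rewrite sumr_const card_ord -[X in _ = _ * X]mulr_natl mulrA mulVf ?mul1r ?pnatr_eq0.
  rewrite /avg -mulrDr -big_split ler_pM2l ?invr_gt0//; apply: ler_sum => j _.
  rewrite -lerBlDl; apply: le_trans (ler_norm _) _.
  apply: le_trans (as_translate S n x _ r0 ur bu) _.
  by rewrite ler_wpM2l// !mulr_ge0.
have A2 : avg (J n u) x <= steklov eps i0 (J n u) x + r' * eps / N.+1%:R.
  rewrite -lerBlDl; apply: le_trans (ler_norm _) _; rewrite distrC.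
  exact: close.
apply: le_trans A0 _; apply: le_trans (lerD (le_trans A1 (lerD A2 (lexx _))) (lexx _)) _.
by rewrite le_eqVlt; apply/orP; left; apply/eqP; ring.
Qed.

Lemma smooth_jensen eps n u r x : 0 < eps -> 0 <= r -> lip r u -> bnd u ->
  J n (smooth eps u) x <= smooth eps (J n u) x + D2 * (L * h n * r * eps).
Proof.
move=> eps0 r0 ur bu; rewrite -[in D2](size_enum_ord d) -size_cat /smooth.
have Jr := as_lip S n r0 ur bu.
elim: (_ ++ _) x => [|i0 s ih] x /=; first by rewrite mul0r addr0.
set c := L * _ * _ * _ in ih *.
have sr := steklovs_lip eps0 s ur; have sb := steklovs_bnd eps0 s ur bu.
apply: le_trans (steklov_jensen n i0 x eps0 r0 sr sb) _.
rewrite -natr1 mulrDl mul1r addrA lerD2r.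
have cr := @lip_cst R d ((size s)%:R * c).
have sJr := steklovs_lip eps0 s Jr.
have := @steklov_le _ _ _ eps0 _ _ i0 _ _ x (as_lip S n r0 sr sb) (lipD sJr cr) ih.
by rewrite (steklovD _ i0 sJr cr) steklov_cst.
Qed.

End Scheme.


(** * Regularity in time *)

Section Convergence.
Context {R : realType} {d : nat}.
Variables (J : nat -> ('rV[R]_d -> R) -> 'rV[R]_d -> R) (h : nat -> R) (L K : R).
Variable (G : 'rV[R]_d -> 'rV[R]_d -> 'M[R]_d -> R).
Hypothesis S : approx_scheme J h L K G.
Implicit Types (f g u v w : 'rV[R]_d -> R) (x y z : 'rV[R]_d).
Implicit Types (a b c r s t C T eps eta sigma tau kappa : R) (n m k j i N P Q : nat).
Notation D2 := ((d + d)%:R : R).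

Let h0 n : 0 < h n. Proof. exact: as_h_gt0 S n. Qed.
Let h0' n : 0 <= h n. Proof. exact/ltW/h0. Qed.
Let L0 : 0 <= L. Proof. exact: as_L_ge0 S. Qed.
Let K0 : 0 <= K. Proof. exact: as_K_ge0 S. Qed.

Let rate_ge0 C : 0 <= C -> 0 <= K * (1 + C) * C.
Proof.
by move=> C0; apply: mulr_ge0 => //; apply: mulr_ge0 => //; apply: addr_ge0.
Qed.

Lemma iter_drift n k v c x : Cb v -> (forall y, `|J n v y - v y| <= c) ->
  `|iter k (J n) v x - v x| <= k%:R * c.
Proof.
move=> Cv vc; elim: k => [|k ih]; first by rewrite subrr normr0 mul0r.
rewrite -natr1 mulrDl mul1r iterSr.
rewrite -[_ - _](subrKA (iter k (J n) v x)) addrC.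
apply: le_trans (ler_normD _ _) _; apply: lerD => //.
apply: (iter_contraction S) => //; exact: (as_Cb S).
Qed.

Lemma G_bound C x p A : 0 <= C -> enorm p <= C -> bform_le C A ->
  `|G x p A| <= K * (1 + C) * C.
Proof.
move=> C0 pC AC; rewrite -[G x p A]subr0 -(as_G0 S x).
by apply: (as_G_close S) => //; rewrite ?enorm0 ?subr0.
Qed.

Lemma jet_drift C eta : 0 <= C -> 0 < eta -> exists N, forall n, (N <= n)%N ->
  forall v p A, Cb v -> jet C v p A -> forall x,
  `|J n v x - v x| <= h n * (K * (1 + C) * C + eta).
Proof.
move=> C0 eta0; have [N HN] := as_consistent S C0 eta0.
exists N => n Nn v p A Cv jv x; have := HN n Nn v p A Cv jv x => H1.
have H2 := G_bound x C0 (jet_grad jv x) (jet_hess jv x).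
rewrite -[_ - v x](subrK (h n * G x (p x) (A x))).
apply: le_trans (ler_normD _ _) _; rewrite mulrDr addrC; apply: lerD.
  by rewrite normrM gtr0_norm// ler_wpM2l.
by rewrite [h n * eta]mulrC.
Qed.

Lemma smooth_Cb eps r u : 0 < eps -> lip r u -> bnd u -> Cb (smooth eps u).
Proof.
by move=> e0 ur bu; apply: lip_Cb (smooth_lip e0 ur) (smooth_bnd e0 ur bu).
Qed.

(** Smoothing costs [r * eps]; the smoothed function moves at most linearly in
    time. *)
Lemma time_regularity eps r eta : 0 < eps -> 0 <= r -> 0 < eta ->
  let C := smooth_cst (d := d) eps * r in
  exists N, forall n, (N <= n)%N -> forall k f, lip r f -> bnd f -> forall x,
  `|iter k (J n) f x - f x| <=
    2 * (D2 * (r * eps)) + k%:R * h n * (K * (1 + C) * C + eta).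
Proof.
move=> e0 r0 eta0 C.
have C0 : 0 <= C by rewrite mulr_ge0// smooth_cst_ge0.
have [N HN] := jet_drift C0 eta0.
exists N => n Nn k f fr bf x; have Cf := lip_Cb fr bf.
have Cs := smooth_Cb e0 fr bf.
have H1 : `|iter k (J n) f x - iter k (J n) (smooth eps f) x| <= D2 * (r * eps).
  apply: (iter_contraction S) => // y; rewrite distrC.
  exact: smooth_close.
have H2 := iter_drift k x Cs (HN n Nn _ _ _ Cs (smooth_jet e0 r0 fr)).
have H3 := smooth_close e0 x fr.
rewrite -[_ - f x](subrKA (iter k (J n) (smooth eps f) x)).
rewrite -[iter k (J n) (smooth eps f) x - f x](subrKA (smooth eps f x)).
apply: le_trans (ler_normD _ _) _.
apply: le_trans (lerD (lexx _) (ler_normD _ _)) _.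
apply: le_trans (lerD H1 (lerD H2 H3)) _.
by rewrite le_eqVlt; apply/orP; left; apply/eqP; ring.
Qed.

(** Equicontinuity in time: first make [eps] small, then the time. *)
Lemma time_regularity_short r sigma : 0 <= r -> 0 < sigma ->
  exists2 tau, 0 < tau & exists N, forall n, (N <= n)%N ->
  forall k f, lip r f -> bnd f -> k%:R * h n <= tau ->
  forall x, `|iter k (J n) f x - f x| <= sigma.
Proof.
move=> r0 s0; have s2 : 0 < sigma / 2 by rewrite divr_gt0.
have [eps e0 He] := @exists_small R (2 * (D2 * r)) _ (mulr_ge0 (ler0n _ 2) (mulr_ge0 (ler0n _ _) r0)) s2.
set C := smooth_cst (d := d) eps * r.
have C0 : 0 <= C by rewrite mulr_ge0// smooth_cst_ge0.
have M0 : 0 <= K * (1 + C) * C + 1 by apply: addr_ge0 => //; exact: rate_ge0.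
have [tau tau0 Ht] := exists_small M0 s2.
have [N HN] := time_regularity e0 r0 (@ltr01 R).
exists tau => //; exists N => n Nn k f fr bf kt x.
apply: le_trans (HN n Nn k f fr bf x) _; rewrite -/C.
have -> : sigma = sigma / 2 + sigma / 2 by lra.
apply: lerD.
  by apply: le_trans He; rewrite !mulrA.
by apply: le_trans Ht; rewrite mulrC ler_wpM2l.
Qed.

(** Over a fixed time, flat functions hardly move: here [eps] is [1] and the
    Lipschitz constant is made small instead. *)
Lemma time_regularity_flat T sigma : 0 <= T -> 0 < sigma ->
  exists2 s, 0 < s & exists N, forall n, (N <= n)%N ->
  forall k f, lip s f -> bnd f -> k%:R * h n <= T ->
  forall x, `|iter k (J n) f x - f x| <= sigma.
Proof.
move=> T0 s0; have s2 : 0 < sigma / 3 by rewrite divr_gt0.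
pose c := smooth_cst (d := d) (1 : R).
have c0 : 0 <= c by exact: smooth_cst_ge0.
have A0 : 0 <= 2 * D2 + T * (K * (1 + c) * c).
  by apply: addr_ge0; apply: mulr_ge0 => //; exact: rate_ge0.
have [s' s'0 Hs] := exists_small A0 s2.
pose s := Num.min s' 1.
have s_gt0 : 0 < s by rewrite lt_min s'0 ltr01.
have [eta eta0 He] := exists_small T0 s2.
have [N HN] := time_regularity (@ltr01 R) (ltW s_gt0) eta0.
exists s => //; exists N => n Nn k f fr bf kt x.
apply: le_trans (HN n Nn k f fr bf x) _; rewrite -/c mulr1.
have ss' : s <= s' by rewrite ge_min lexx.
have s1 : s <= 1 by rewrite ge_min lexx orbT.
have H1 : k%:R * h n * (K * (1 + c * s) * (c * s) + eta) <= T * (K * (1 + c) * (c * s) + eta).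
  apply: ler_pM => //; first by rewrite mulr_ge0.
    by apply: addr_ge0 (ltW eta0); apply: rate_ge0; exact: mulr_ge0 (ltW _).
  rewrite lerD2r ler_wpM2r ?mulr_ge0 ?(ltW s_gt0)// ler_wpM2l// lerD2l.
  by rewrite ler_piMr.
have H2 : (2 * D2 + T * (K * (1 + c) * c)) * s <= sigma / 3.
  by apply: le_trans Hs; rewrite ler_wpM2l.
apply: le_trans (lerD (lexx _) H1) _.
have -> : 2 * (D2 * s) + T * (K * (1 + c) * (c * s) + eta) =
  (2 * D2 + T * (K * (1 + c) * c)) * s + T * eta by ring.
by apply: le_trans (lerD H2 He) _; lra.
Qed.

(** * Comparison of two schemes over one block of time *)

Section Block.
Variables (eps r kappa sigma : R).
Hypotheses (eps0 : 0 < eps) (r0 : 0 <= r) (sigma0 : 0 <= sigma).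

Let C := smooth_cst (d := d) eps * r.
Let c0 := smooth_cst0 (d := d) eps.
Let Gs u x := G x (smooth_grad eps u x) (smooth_hess eps u x).
Let err := kappa + D2 * (L * r * eps) + K * (1 + C) * (c0 * sigma).
Let bd := K * (1 + C) * C.

Let C0 : 0 <= C. Proof. by rewrite mulr_ge0// smooth_cst_ge0. Qed.
Let c00 : 0 <= c0. Proof. exact: smooth_cst0_ge0. Qed.

Definition consistent_at n := forall v p A, Cb v -> jet C v p A ->
  forall x, `|J n v x - v x - h n * G x (p x) (A x)| <= kappa * h n.

Let Gs_bound u x : lip r u -> `|Gs u x| <= bd.
Proof.
move=> ur; have j := smooth_jet eps0 r0 ur.
by apply: G_bound => //; [exact: jet_grad j x|exact: jet_hess j x].
Qed.

Let Gs_close u v x : lip r u -> lip r v -> (forall y, `|u y - v y| <= sigma) ->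
  `|Gs u x - Gs v x| <= K * (1 + C) * (c0 * sigma).
Proof.
move=> ur vr uv; have ju := smooth_jet eps0 r0 ur.
have jv := smooth_jet eps0 r0 vr.
have [H1 H2] := smooth_jet_close eps0 x ur vr uv.
by apply: (as_G_close S) => //; [exact: mulr_ge0|exact: jet_grad ju x|exact: jet_grad jv x].
Qed.

(** The decisive use of convexity: smoothing the iterates of the scheme yields
    a smooth supersolution, up to an error proportional to [eps]. *)
Lemma smooth_supersolution n u x : consistent_at n -> lip r u -> bnd u ->
  smooth eps u x + h n * (Gs u x - kappa - D2 * (L * r * eps))
  <= smooth eps (J n u) x.
Proof.
move=> cn ur bu; have Cs := smooth_Cb eps0 ur bu.
have H1 := cn _ _ _ Cs (smooth_jet eps0 r0 ur) x.
have H2 := smooth_jensen S n x eps0 r0 ur bu.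
move: H1; rewrite -/(Gs u x) ler_norml => /andP[H1 _].
have E : D2 * (L * h n * r * eps) = h n * (D2 * (L * r * eps)) by ring.
rewrite E in H2; rewrite !mulrBr [h n * kappa]mulrC; lra.
Qed.

Lemma smooth_supersolution_iter n u P x : consistent_at n -> lip r u -> bnd u ->
  (forall i, (i <= P)%N -> lip r (iter i (J n) u)) ->
  (forall i y, (i <= P)%N -> `|iter i (J n) u y - u y| <= sigma) ->
  smooth eps u x + P%:R * h n * (Gs u x - err) <= smooth eps (iter P (J n) u) x.
Proof.
move=> cn ur bu; have Cu := lip_Cb ur bu.
elim: P => [|P ih] Hl Hs; first by rewrite !mul0r addr0.
have {}ih := ih (fun i iP => Hl i (leqW iP)) (fun i y iP => Hs i y (leqW iP)).
have lP := Hl P (leqnSn P); have bP := iter_bnd S n P Cu.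
have := smooth_supersolution x cn lP bP; rewrite -iterS; apply: le_trans.
have := Gs_close x lP ur (fun y => Hs P y (leqnSn P)).
rewrite ler_norml => /andP[H1 _].
rewrite -natr1 !mulrDl mul1r addrA; apply: lerD => //.
by rewrite ler_wpM2l// /err; lra.
Qed.

(** Linear interpolation in time between the two ends of a block of the first
    scheme is a supersolution for the second one, whatever the ratio of the
    two step sizes. *)
Lemma block_comparison n m u P N x : consistent_at n -> consistent_at m ->
  lip r u -> bnd u ->
  (forall i, (i <= P)%N -> lip r (iter i (J n) u)) ->
  (forall i y, (i <= P)%N -> `|iter i (J n) u y - u y| <= sigma) ->
  iter N (J m) (smooth eps u) x <= smooth eps (iter P (J n) u) x +
    (`|N%:R * h m - P%:R * h n| * bd + (N%:R * h m + P%:R * h n) * err).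
Proof.
move=> cn cm ur bu Hl Hs; have Cu := lip_Cb ur bu.
have H1 y := smooth_supersolution_iter y cn ur bu Hl Hs.
have [->|N0] := posnP N.
  have := H1 x; rewrite mul0r sub0r normrN add0r /= ger0_norm ?mulr_ge0//.
  have := Gs_bound x ur; rewrite ler_norml => /andP[b1 _] H2.
  rewrite -mulrDr -lerBlDr; apply: le_trans H2; rewrite lerD2l -mulrN.
  by rewrite ler_wpM2l ?mulr_ge0//; lra.
set u' := iter P (J n) u.
have u'r : lip r u' by exact: Hl.
have bu' : bnd u' by refine (iter_bnd S n P Cu).
pose th i := i%:R / N%:R : R.
have NR : (N%:R : R) != 0 by rewrite pnatr_eq0 -lt0n.
have NR0 : (0 : R) < N%:R by rewrite ltr0n.
have th01 i : (i <= N)%N -> 0 <= th i <= 1.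
  by move=> iN; rewrite /th divr_ge0// ler_pdivrMr// mul1r ler_nat.
pose U i y := (1 - th i) * u y + th i * u' y.
have Ur i : (i <= N)%N -> lip r (U i).
  move=> /th01/andP[t0 t1].
  have := lipD (lipZ (1 - th i) ur) (lipZ (th i) u'r).
  by rewrite !ger0_norm ?subr_ge0// -mulrDl subrK mul1r.
have bU i : bnd (U i) by apply: bndD; apply: bndZ.
have Us i y : (i <= N)%N -> `|U i y - u y| <= sigma.
  move=> /th01/andP[t0 t1].
  rewrite (_ : U i y - u y = th i * (u' y - u y)); last by rewrite /U; ring.
  by rewrite normrM ger0_norm//; apply: le_trans (Hs P y (leqnn P)); rewrite ler_piMl.
have sU i y : smooth eps (U i) y =
    (1 - th i) * smooth eps u y + th i * smooth eps u' y.
  rewrite /smooth /U (steklovsD eps0 _ (lipZ (1 - th i) ur) (lipZ (th i) u'r)).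
  by rewrite !(steklovsZ eps0 _ _ ur, steklovsZ eps0 _ _ u'r).
pose e := `|N%:R * h m - P%:R * h n| * bd + (N%:R * h m + P%:R * h n) * err.
(* Up to the errors collected in [e], one step of the second scheme gains at
   most [h m * Gs u], one step of the interpolation at least
   [P * h n / N * Gs u]. *)
have step i y : (i < N)%N -> J m (smooth eps (U i)) y <=
    smooth eps (U i.+1) y + N%:R^-1 * e.
  move=> iN; have iN' := ltnW iN.
  have := cm _ _ _ (smooth_Cb eps0 (Ur i iN') (bU i))
    (smooth_jet eps0 r0 (Ur i iN')) y.
  rewrite -/(Gs (U i) y) ler_norml => /andP[_ H2].
  have := Gs_close y (Ur i iN') ur (fun y => Us i y iN').
  rewrite ler_norml => /andP[_ H3].
  have := Gs_bound y ur; rewrite ler_norml => /andP[b1 b2].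
  have H4 : smooth eps (U i.+1) y - smooth eps (U i) y =
      N%:R^-1 * (smooth eps u' y - smooth eps u y).
    have -> : N%:R^-1 = th i.+1 - th i by rewrite /th -natr1; ring.
    by rewrite !sU; ring.
  have H5 : N%:R^-1 * (P%:R * h n * (Gs u y - err)) <=
      N%:R^-1 * (smooth eps u' y - smooth eps u y).
    by rewrite ler_pM2l ?invr_gt0//; have := H1 y; rewrite -/u'; lra.
  have H6 : h m * Gs (U i) y <= h m * (Gs u y + K * (1 + C) * (c0 * sigma)).
    by rewrite ler_wpM2l//; lra.
  have D0 : 0 <= h m * (D2 * (L * r * eps)).
    by rewrite !mulr_ge0// ltW.
  have H7 : (N%:R * h m - P%:R * h n) * Gs u y <=
      `|N%:R * h m - P%:R * h n| * bd.
    apply: le_trans (ler_norm _) _; rewrite normrM ler_wpM2l//.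
    by rewrite ler_norml b1 b2.
  have H8 : h m * Gs u y - N%:R^-1 * (P%:R * h n * (Gs u y - err))
      + h m * err <= N%:R^-1 * e.
    rewrite -(ler_pM2l NR0) [leRHS]mulrA mulfV// mul1r /e.
    rewrite [leLHS](_ : _ = (N%:R * h m - P%:R * h n) * Gs u y +
      (N%:R * h m + P%:R * h n) * err); first by rewrite lerD2r.
    by field.
  have E : h m * err = kappa * h m + h m * (D2 * (L * r * eps)) +
    h m * (K * (1 + C) * (c0 * sigma)) by rewrite /err; ring.
  rewrite mulrDr in H6; rewrite E in H8; lra.
have main i : (i <= N)%N -> forall y, iter i (J m) (smooth eps u) y <=
    smooth eps (U i) y + i%:R * (N%:R^-1 * e).
  elim: i => [|i ih] iN y.
    by rewrite sU /th !mul0r subr0 mul1r !addr0.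
  have Csi := smooth_Cb eps0 (Ur i (ltnW iN)) (bU i).
  apply: le_trans (_ : J m (fun y => smooth eps (U i) y + i%:R * (N%:R^-1 * e)) y <= _).
    apply: (as_mono S) => //; first exact: (iter_Cb S _ _ (smooth_Cb eps0 ur bu)).
      by apply: CbD => //; exact: Cb_cst.
    exact: ih (ltnW iN).
  by rewrite (as_add S)// -[i.+1%:R]natr1; have := step i y iN; lra.
have := main N (leqnn N) x.
by rewrite sU /th mulfV// subrr mul0r add0r !mul1r mulrA mulfV// mul1r.
Qed.

(** The iterates inherit the time regularity of [u], as the scheme is a
    contraction and its powers commute; so every block is like the first. *)
Lemma blocks_comparison n m u P N Q x : consistent_at n -> consistent_at m ->
  lip r u -> bnd u ->
  (forall i, (i <= Q * P)%N -> lip r (iter i (J n) u)) ->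
  (forall i y, (i <= P)%N -> `|iter i (J n) u y - u y| <= sigma) ->
  iter (Q * N) (J m) (smooth eps u) x <= smooth eps (iter (Q * P) (J n) u) x +
    Q%:R * (`|N%:R * h m - P%:R * h n| * bd + (N%:R * h m + P%:R * h n) * err).
Proof.
set e := _ + _ * err => cn cm ur bu Hl Hs; have Cu := lip_Cb ur bu.
elim: Q x Hl => [|Q ih] x Hl; first by rewrite !mul0n mul0r addr0.
have {}ih y := ih y (fun i iQ => Hl i (leq_trans iQ (leq_mul (leqnSn Q) (leqnn P)))).
set v := iter (Q * P) (J n) u.
have vr : lip r v by apply: Hl; rewrite leq_mul.
have bv : bnd v by refine (iter_bnd S n _ Cu).
have Cs := smooth_Cb eps0 vr bv.
rewrite mulSn iterD; apply: le_trans
    (_ : iter N (J m) (fun y => smooth eps v y + Q%:R * e) x <= _).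
  apply: (iter_mono S) => //; first exact: (iter_Cb S _ _ (smooth_Cb eps0 ur bu)).
  by apply: CbD => //; exact: Cb_cst.
rewrite (iter_add S)// -natr1 mulrDl mul1r [leRHS]addrA addrAC lerD2r.
rewrite mulSn iterD -/v; apply: block_comparison => // [i iP|i y iP].
  by rewrite -iterD; apply: Hl; rewrite mulSn leq_add2r.
rewrite -iterD addnC iterD; apply: (iter_contraction S) => //.
  exact: (iter_Cb S).
by move=> z; exact: Hs.
Qed.

End Block.

End Convergence.


(** * Lipschitz approximation *)

Section LipschitzApproximation.
Context {R : realType} {d : nat}.
Implicit Types (f g : 'rV[R]_d -> R) (x y z : 'rV[R]_d).

(** The inf-convolution [inf_y (f y + c |x - y|)]: if [c] is large, the infimum
    only sees points [y] so close to [x] that [f] hardly varies. *)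
Lemma lip_approx f (M r eta : R) : continuous f -> (forall x, `|f x| <= M) ->
  0 < eta -> exists g c, [/\ 0 <= c, lip c g, (forall x, `|g x| <= M) &
    forall x, enorm x <= r -> `|f x - g x| <= eta].
Proof.
move=> cf fM eta0.
have M0 : 0 <= M by apply: le_trans (fM 0).
have [rho rho0 H] := unif_continuous_eball r cf eta0.
(* Beyond distance [rho] the penalty exceeds the oscillation [2 * M] of [f]. *)
pose c := 2 * M / rho; have c0 : 0 <= c by rewrite divr_ge0 ?mulr_ge0 ?(ltW rho0).
pose E x := [set f y + c * enorm (x - y) | y in setT].
have fMl y : - M <= f y <= M by rewrite -ler_norml.
have lE x : lbound (E x) (- M).
  move=> _ [y _ <-]; have := fMl y => /andP[h _].
  by apply: le_trans h _; rewrite lerDl mulr_ge0 ?enorm_ge0.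
have nE x : E x !=set0 by exists (f 0 + c * enorm (x - 0)), 0.
have leE x y : inf (E x) <= f y + c * enorm (x - y).
  by apply: ge_inf; [exists (- M); exact: lE|exists y].
exists (fun x => inf (E x)), c; split => //.
- have half x y : inf (E x) - inf (E y) <= c * enorm (x - y).
    rewrite lerBlDl -lerBlDr; apply: lb_le_inf => // _ [z _ <-].
    rewrite lerBlDr; apply: le_trans (leE x z) _.
    rewrite -addrA lerD2l -mulrDr ler_wpM2l//.
    by rewrite [leRHS]addrC; have := enormD (x - y) (y - z); rewrite addrA subrK.
  move=> x y; rewrite ler_norml half andbT lerNl opprB.
  by rewrite enormBC half.
- move=> x; rewrite ler_norml; apply/andP; split.
    by apply: lb_le_inf => //; exact: lE.
  apply: le_trans (leE x x) _; rewrite subrr enorm0 mulr0 addr0.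
  by have /andP[] := fMl x.
- move=> x xr; rewrite ger0_norm; last first.
    by rewrite subr_ge0; apply: le_trans (leE x x) _; rewrite subrr enorm0 mulr0 addr0.
  rewrite lerBlDr -lerBlDl; apply: lb_le_inf => // _ [y _ <-].
  have cxy0 : 0 <= c * enorm (x - y) by rewrite mulr_ge0 ?enorm_ge0.
  have [yx|/ltW yx] := leP (enorm (y - x)) rho.
    by have := H x y xr yx; rewrite ler_norml => /andP[]; lra.
  have : 2 * M <= c * enorm (x - y).
    by rewrite /c -mulrA ler_peMr ?mulr_ge0// mulrC ler_pdivlMr// mul1r enormBC.
  by have /andP[] := fMl x; have /andP[] := fMl y; lra.
Qed.

End LipschitzApproximation.

(** * Convergence on Lipschitz functions *)

Section Limit.
Context {R : realType} {d : nat}.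
Variables (J : nat -> ('rV[R]_d -> R) -> 'rV[R]_d -> R) (h : nat -> R) (L K : R).
Variable (G : 'rV[R]_d -> 'rV[R]_d -> 'M[R]_d -> R).
Hypothesis S : approx_scheme J h L K G.
Implicit Types (f g u v w : 'rV[R]_d -> R) (x y z : 'rV[R]_d).
Implicit Types (a b c r s t C T eps eta sigma tau rho kappa : R) (n m k j i N P Q : nat).
Notation D2 := ((d + d)%:R : R).

Let h0 n : 0 < h n. Proof. exact: as_h_gt0 S n. Qed.
Let h0' n : 0 <= h n. Proof. exact/ltW/h0. Qed.
Let L0 : 0 <= L. Proof. exact: as_L_ge0 S. Qed.
Let K0 : 0 <= K. Proof. exact: as_K_ge0 S. Qed.

Lemma rounding_error (s s' q t0 u u' q' rho : R) :
  s <= s' -> s' <= s + q -> q <= rho -> `|s' - t0| <= rho ->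
  u <= u' -> u' <= u + q' -> q' <= rho -> `|u' - t0| <= rho ->
  `|s - u| <= 4 * rho.
Proof. by rewrite !ler_norml; lra. Qed.

(** Both schemes run through [Q] blocks of approximately [t / Q] units of time,
    and the smoothed iterates of the first one dominate the second one block
    by block. Exchanging the two schemes gives the reverse inequality. *)
Lemma one_sided_convergence f r t eta : 0 <= r -> lip r f -> bnd f -> 0 <= t ->
  0 < eta -> exists2 rho, 0 < rho & exists N0, forall n m k j,
  (N0 <= n)%N -> (N0 <= m)%N -> `|k%:R * h n - t| <= rho ->
  `|j%:R * h m - t| <= rho ->
  forall x, iter j (J m) f x <= iter k (J n) f x + eta.
Proof.
move=> r0 fr bf t0 eta0; have Cf := lip_Cb fr bf.
pose T := t + 1; have T0 : 0 <= T by rewrite addr_ge0.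
(* The smoothing scale [eps] is fixed first, since the jet constant [C] and the
   closeness constant [c0] depend on it; then the tolerance [sigma] in time,
   the number [Q] of blocks and finally the step sizes. *)
pose r' := r * expR (L * T).
have r'0 : 0 <= r' by rewrite mulr_ge0// expR_ge0.
have rr' : r <= r' by rewrite ler_peMr// -expR0 ler_expR mulr_ge0.
have eta4 : 0 < eta / 4 by rewrite divr_gt0.
have D20 : 0 <= D2 by [].
have A1 : 0 <= 2 * (D2 * r') + 2 * T * (D2 * (L * r')).
  by apply: addr_ge0; rewrite !mulr_ge0.
have [eps eps0 Heps] := exists_small A1 eta4.
have A2 : 0 <= 2 * T by rewrite mulr_ge0.
have [kappa kappa0 Hkappa] := exists_small A2 eta4.
pose C := smooth_cst (d := d) eps * r'.
have C0 : 0 <= C by rewrite mulr_ge0// smooth_cst_ge0.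
have C1 : 0 <= 1 + C by apply: addr_ge0.
pose c0 := smooth_cst0 (d := d) eps.
have c00 : 0 <= c0 by exact: smooth_cst0_ge0.
have A3 : 0 <= 2 + 2 * T * (K * (1 + C) * c0).
  by apply: addr_ge0 => //; do 2!apply: mulr_ge0 => //; apply: mulr_ge0.
have [sigma sigma0 Hsigma] := exists_small A3 eta4.
pose bd := K * (1 + C) * C.
have bd0 : 0 <= bd by apply: mulr_ge0 => //; apply: mulr_ge0.
have A4 : 0 <= 4 * bd by apply: mulr_ge0.
have [rho1 rho10 Hrho1] := exists_small A4 eta4.
pose rho := Num.min rho1 1.
have rho0 : 0 < rho by rewrite lt_min rho10 ltr01.
have rho_le1 : rho <= 1 by rewrite ge_min lexx orbT.
have Hrho : 4 * bd * rho <= eta / 4.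
  by apply: le_trans Hrho1; rewrite ler_wpM2l// ge_min lexx.
have [tau tau0 [N1 HN1]] := time_regularity_short S r0 sigma0.
have Tt0 : 0 <= T / tau by rewrite divr_ge0// ltW.
pose Q := (Num.bound (T / tau)).+1.
have HQ : T <= Q%:R * tau.
  rewrite -ler_pdivrMr//; apply: le_trans (ltW (archi_boundP Tt0)) _.
  by rewrite ler_nat.
have Q0 : (0 : R) < Q%:R by rewrite ltr0n.
have [N2 HN2] := as_consistent S C0 kappa0.
pose e := Num.min rho tau / Q%:R.
have e0 : 0 < e by rewrite divr_gt0// lt_min rho0.
have [N3 HN3] := h_small S e0.
exists rho => //; exists (maxn N1 (maxn N2 N3)) => n m k j.
rewrite !geq_max => /and3P[n1 n2 n3] /and3P[m1 m2 m3].
move=> kt jt x; have ku := le_trans (ler_norm _) kt; have ju := le_trans (ler_norm _) jt.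
have kT : k%:R * h n <= T by rewrite /T -lerBlDl; exact: le_trans rho_le1.
have jT : j%:R * h m <= T by rewrite /T -lerBlDl; exact: le_trans rho_le1.
have Qh i : (N3 <= i)%N -> Q%:R * h i <= rho /\ Q%:R * h i <= tau.
  move=> /HN3; rewrite /e ler_pdivlMr// mulrC => H1.
  by split; apply: le_trans H1 _; rewrite ge_min lexx ?orbT.
have [Qn_rho Qn_tau] := Qh n n3; have [Qm_rho Qm_tau] := Qh m m3.
pose P := (k %/ Q)%N; pose N := (j %/ Q)%N.
have kE : k = (Q * P + k %% Q)%N by rewrite mulnC -divn_eq.
have jE : j = (Q * N + j %% Q)%N by rewrite mulnC -divn_eq.
have modh i l : (i %% Q)%:R * h l <= Q%:R * h l.
  by rewrite ler_wpM2r// ler_nat ltnW// ltn_pmod.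
have QP : Q%:R * (P%:R * h n) <= k%:R * h n.
  by rewrite mulrA -natrM ler_wpM2r// ler_nat {1}kE leq_addr.
have QN : Q%:R * (N%:R * h m) <= j%:R * h m.
  by rewrite mulrA -natrM ler_wpM2r// ler_nat {1}jE leq_addr.
have QP' : k%:R * h n <= Q%:R * (P%:R * h n) + Q%:R * h n.
  by rewrite {1}kE natrD natrM mulrDl -mulrA lerD2l.
have QN' : j%:R * h m <= Q%:R * (N%:R * h m) + Q%:R * h m.
  by rewrite {1}jE natrD natrM mulrDl -mulrA lerD2l.
have Ptau : P%:R * h n <= tau.
  by rewrite -(ler_pM2l Q0); apply: le_trans QP _; apply: le_trans HQ.
have short i l g : (N1 <= l)%N -> lip r g -> bnd g -> i%:R * h l <= tau ->
  forall y, `|iter i (J l) g y - g y| <= sigma by move=> Nl gr bg; exact: HN1.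
have fr' : lip r' f by exact: lip_le rr' fr.
have B := @blocks_comparison _ _ _ _ _ _ _ S eps r' kappa sigma eps0 r'0
  (ltW sigma0) n m f P N Q x (HN2 n n2) (HN2 m m2) fr' bf.
have {}B := B _ _.
have B1 i : (i <= Q * P)%N -> lip r' (iter i (J n) f).
  move=> iQP; apply: (iter_lip S) => //; apply: le_trans kT.
  by rewrite ler_wpM2r// ler_nat kE (leq_trans iQP)// leq_addr.
have B2 i y : (i <= P)%N -> `|iter i (J n) f y - f y| <= sigma.
  move=> iP; apply: short => //; apply: le_trans Ptau.
  by rewrite ler_wpM2r// ler_nat.
have {}B := B B1 B2.
have S1 : iter j (J m) f x <= iter (Q * N) (J m) f x + sigma.
  rewrite {1}jE iterD -lerBlDl; apply: le_trans (ler_norm _) _.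
  apply: (iter_contraction S) => //; first exact: (iter_Cb S).
  by apply: short => //; apply: le_trans (modh _ _) Qm_tau.
have S2 : iter (Q * N) (J m) f x <= iter (Q * N) (J m) (smooth eps f) x + D2 * (r' * eps).
  rewrite -lerBlDl; apply: le_trans (ler_norm _) _.
  apply: (iter_contraction S) => //; first exact: smooth_Cb eps0 fr bf.
  by move=> y; rewrite distrC; exact: smooth_close.
have S3 : smooth eps (iter (Q * P) (J n) f) x <= iter (Q * P) (J n) f x + D2 * (r' * eps).
  rewrite -lerBlDl; apply: le_trans (ler_norm _) _.
  by apply: smooth_close => //; exact: B1.
have S4 : iter (Q * P) (J n) f x <= iter k (J n) f x + sigma.
  rewrite {1}kE iterD -lerBlDl; apply: le_trans (ler_norm _) _.
  apply: (iter_contraction S) => //; first exact: (iter_Cb S).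
  by move=> y; rewrite distrC; apply: short => //; apply: le_trans (modh _ _) Qn_tau.
set err := kappa + _ + _ in B.
have err0 : 0 <= err.
  by rewrite !addr_ge0 ?(ltW kappa0)// !mulr_ge0// ltW.
have S5 : Q%:R * (`|N%:R * h m - P%:R * h n| * bd) <= 4 * bd * rho.
  rewrite mulrA [4 * bd]mulrC -[bd * 4 * rho]mulrA [leRHS]mulrC ler_wpM2r//.
  rewrite -(ger0_norm (ltW Q0)) -normrM mulrBr.
  exact: rounding_error QN QN' Qm_rho jt QP QP' Qn_rho kt.
have S6 : Q%:R * ((N%:R * h m + P%:R * h n) * err) <= 2 * T * err.
  rewrite mulrA ler_wpM2r// mulrDr (_ : 2 * T = T + T); last by ring.
  by apply: lerD; [exact: le_trans QN jT|exact: le_trans QP kT].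
have S7 : 2 * T * err = 2 * T * kappa + 2 * T * (D2 * (L * r')) * eps +
    2 * T * (K * (1 + C) * c0) * sigma by rewrite /err -/C -/c0; ring.
rewrite -/C -/bd mulrDr in B; rewrite mulrDl in Heps; rewrite mulrDl in Hsigma.
have E1 : 2 * (D2 * r') * eps = 2 * (D2 * (r' * eps)) by ring.
rewrite E1 in Heps; lra.
Qed.

Lemma lip_convergence f r t eta : 0 <= r -> lip r f -> bnd f -> 0 <= t ->
  0 < eta -> exists2 rho, 0 < rho & exists N0, forall n m k j,
  (N0 <= n)%N -> (N0 <= m)%N -> `|k%:R * h n - t| <= rho ->
  `|j%:R * h m - t| <= rho ->
  forall x, `|iter j (J m) f x - iter k (J n) f x| <= eta.
Proof.
move=> r0 fr bf t0 eta0.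
have [rho rho0 [N0 H]] := one_sided_convergence r0 fr bf t0 eta0.
exists rho => //; exists N0 => n m k j Nn Nm kt jt x.
rewrite ler_norml; apply/andP; split.
  by have := H m n j k Nm Nn jt kt x; lra.
by have := H n m k j Nn Nm kt jt x; lra.
Qed.

(** * Local dependence on the initial value *)

(** A truncated cone: of slope [s], and equal to its height [Lam] far out. *)
Definition barrier s Lam x := Num.min Lam (s * enorm x).

Lemma barrier_lip s Lam : 0 <= s -> lip s (barrier s Lam).
Proof.
move=> s0 x y; rewrite /barrier.
have half (u v : 'rV[R]_d) : s * enorm u - s * enorm v <= s * enorm (u - v).
  rewrite -mulrBr ler_wpM2l// lerBlDr.
  by have := enormD (u - v) v; rewrite subrK.
have h1 := half x y; have h2 := half y x; rewrite enormBC in h2.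
have h3 : 0 <= s * enorm (x - y) by rewrite mulr_ge0 ?enorm_ge0.
rewrite ler_norml /Num.min; case: ltP => a; case: ltP => b; lra.
Qed.

Lemma barrier_ge0 s Lam x : 0 <= s -> 0 <= Lam -> 0 <= barrier s Lam x.
Proof. by move=> s0 l0; rewrite le_min l0 mulr_ge0 ?enorm_ge0. Qed.

Lemma barrier_bnd s Lam : 0 <= s -> 0 <= Lam -> bnd (barrier s Lam).
Proof.
move=> s0 l0; exists Lam => x; rewrite ger0_norm ?barrier_ge0//.
by rewrite ge_min lexx.
Qed.

(** Convexity absorbs the perturbation of [f] outside a large ball into a
    small multiple of a flat barrier, which the scheme hardly moves. *)
Lemma local_dependence_half T r r0 eps : 0 <= T -> 0 <= r -> 0 <= r0 -> 0 < eps ->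
  exists2 r1, 0 <= r1 & exists N0, forall n k f g a x, (N0 <= n)%N ->
  k%:R * h n <= T -> Cb f -> Cb g -> (forall y, `|f y| <= r) ->
  (forall y, `|g y| <= r) -> 0 <= a ->
  (forall y, enorm y <= r1 -> `|f y - g y| <= a) -> enorm x <= r0 ->
  iter k (J n) f x <= iter k (J n) g x + a + eps.
Proof.
move=> T0 r_ge0 r00 eps0; have eps3 : 0 < eps / 3 by rewrite divr_gt0.
have A1 : 0 <= 2 * r by rewrite mulr_ge0.
have [lam1 lam10 H1] := exists_small A1 eps3.
pose lam := Num.min lam1 1.
have lam0 : 0 < lam by rewrite lt_min lam10 ltr01.
have laml : lam <= 1 by rewrite ge_min lexx orbT.
have H1' : 2 * r * lam <= eps / 3.
  by apply: le_trans H1; rewrite ler_wpM2l// ge_min lexx.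
(* So that [lam * phi] dominates [f - g <= 2 * r] outside the large ball. *)
pose Lam := 2 * r / lam; have Lam0 : 0 <= Lam by rewrite divr_ge0// ltW.
have [s1 s10 [N0 HN]] := time_regularity_flat S T0 eps3.
have [s2 s20 H2] := exists_small r00 eps3.
pose s := Num.min s1 s2.
have s0 : 0 < s by rewrite lt_min s10.
have ss1 : s <= s1 by rewrite ge_min lexx.
have ss2 : s <= s2 by rewrite ge_min lexx orbT.
pose phi := barrier s Lam.
have phil : lip s1 phi by apply: lip_le ss1 _; exact/barrier_lip/ltW.
have phib : bnd phi by apply: barrier_bnd => //; exact: ltW.
have Cphi := lip_Cb phil phib.
exists (Lam / s); first by rewrite divr_ge0// ltW.
exists N0 => n k f g a x Nn kT Cf Cg fr gr a0 fga xr0.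
have P1 : iter k (J n) f x <=
    iter k (J n) (fun y => (lam * (g y + phi y) + (1 - lam) * g y) + a) x.
  apply: (iter_mono S) => // [|y].
    by apply: CbD; [apply: CbD; apply: CbZ => //; exact: CbD|exact: Cb_cst].
  have -> : lam * (g y + phi y) + (1 - lam) * g y + a = g y + lam * phi y + a by ring.
  have p0 : 0 <= phi y by apply: barrier_ge0 => //; exact: ltW.
  have lp0 : 0 <= lam * phi y by rewrite mulr_ge0// ltW.
  have [yl|/ltW yl] := leP (enorm y) (Lam / s).
    by have := le_trans (ler_norm _) (fga y yl); lra.
  have : phi y = Lam.
    rewrite /phi /barrier; apply/min_idPl.
    by move: yl; rewrite ler_pdivrMr// mulrC.
  move=> ->; rewrite /Lam mulrCA mulfV ?gt_eqF// mulr1.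
  by move: (fr y) (gr y); rewrite !ler_norml => /andP[_ ?] /andP[? _]; lra.
have lam01 : 0 <= lam <= 1 by rewrite ltW.
have Cgp : Cb (fun y => g y + phi y) by exact: CbD.
rewrite (iter_add S) in P1; last by apply: CbD; exact: CbZ.
have P2 := iter_convex S n k x Cgp Cg lam01.
have P3 : iter k (J n) (fun y => g y + phi y) x <= iter k (J n) (fun y => phi y + r) x.
  apply: (iter_mono S) => // [|y]; first by apply: CbD => //; exact: Cb_cst.
  by rewrite addrC lerD2l; have := le_trans (ler_norm _) (gr y).
rewrite (iter_add S)// in P3.
have P4 : iter k (J n) phi x <= phi x + eps / 3.
  by rewrite -lerBlDl; apply: le_trans (ler_norm _) _; exact: HN.
have P5 : phi x <= eps / 3.
  apply: (@le_trans _ _ (s * enorm x)); first by rewrite ge_min lexx orbT.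
  apply: le_trans H2; rewrite mulrC ler_pM ?enorm_ge0// ltW//.
have := iter_norm_le S n k x Cg gr; rewrite ler_norml => /andP[P6 _].
have P7 : lam * iter k (J n) (fun y => g y + phi y) x <=
    lam * (eps / 3 + eps / 3 + r) by rewrite ler_pM2l//; lra.
have P8 : - (lam * iter k (J n) g x) <= lam * r.
  by rewrite -mulrN ler_pM2l//; lra.
have P9 : lam * (eps / 3 + eps / 3) <= eps / 3 + eps / 3 by rewrite ler_piMl//; lra.
move: P1 P2; rewrite mulrBl mul1r; lra.
Qed.

Lemma local_dependence T r r0 eps : 0 <= T -> 0 <= r -> 0 <= r0 -> 0 < eps ->
  exists2 r1, 0 <= r1 & exists N0, forall n k f g a x, (N0 <= n)%N ->
  k%:R * h n <= T -> Cb f -> Cb g -> (forall y, `|f y| <= r) ->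
  (forall y, `|g y| <= r) -> 0 <= a ->
  (forall y, enorm y <= r1 -> `|f y - g y| <= a) -> enorm x <= r0 ->
  `|iter k (J n) f x - iter k (J n) g x| <= a + eps.
Proof.
move=> T0 r_ge0 r00 eps0.
have [r1 r10 [N0 H]] := local_dependence_half T0 r_ge0 r00 eps0.
exists r1 => //; exists N0 => n k f g a x Nn kT Cf Cg fr gr a0 fga xr.
have fga' y : enorm y <= r1 -> `|g y - f y| <= a by rewrite distrC; exact: fga.
have := H n k f g a x Nn kT Cf Cg fr gr a0 fga xr.
have := H n k g f a x Nn kT Cg Cf gr fr a0 fga' xr.
by rewrite ler_norml; lra.
Qed.

(** Outside of a large ball the error of the Lipschitz approximation is
    irrelevant by local dependence. *)
Lemma Cb_convergence f t r0 eta : Cb f -> 0 <= t -> 0 <= r0 -> 0 < eta ->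
  exists2 rho, 0 < rho & exists N0, forall n m k j,
  (N0 <= n)%N -> (N0 <= m)%N -> `|k%:R * h n - t| <= rho ->
  `|j%:R * h m - t| <= rho ->
  forall x, enorm x <= r0 -> `|iter j (J m) f x - iter k (J n) f x| <= eta.
Proof.
move=> Cf t0 r00 eta0; have [M fM] := Cb_bnd Cf.
have M0 : 0 <= M by apply: le_trans (fM 0).
have T0 : 0 <= t + 1 by rewrite addr_ge0.
have eta5 : 0 < eta / 5 by rewrite divr_gt0.
have [r1 r10 [N1 H1]] := local_dependence T0 M0 r00 eta5.
have [g [c [c0 gc gM fg]]] := lip_approx r1 Cf.1 fM eta5.
have bg : bnd g by exists M.
have Cg := lip_Cb gc bg.
have [rho rho0 [N2 H2]] := lip_convergence c0 gc bg t0 eta5.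
exists (Num.min rho 1); first by rewrite lt_min rho0 ltr01.
exists (maxn N1 N2) => n m k j; rewrite !geq_max => /andP[n1 n2] /andP[m1 m2].
rewrite !le_min => /andP[k1 k2] /andP[j1 j2] x xr.
have kT : k%:R * h n <= t + 1 by move: k2; rewrite ler_norml; lra.
have jT : j%:R * h m <= t + 1 by move: j2; rewrite ler_norml; lra.
have A1 := H1 n k f g (eta / 5) x n1 kT Cf Cg fM gM (ltW eta5) fg xr.
have A2 := H1 m j f g (eta / 5) x m1 jT Cf Cg fM gM (ltW eta5) fg xr.
have A3 := H2 n m k j n2 m2 k1 j1 x.
by move: A1 A2 A3; rewrite !ler_norml; lra.
Qed.

End Limit.


(** * Convergence in the mixed topology *)

Section CbConvergence.
Context {R : realType} {d : nat}.
Implicit Types (f g : 'rV[R]_d -> R) (x y z : 'rV[R]_d).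

Lemma seq_lim_le (u : nat -> R) (l c : R) : u @ \oo --> l ->
  (exists N, forall n, (N <= n)%N -> u n <= c) -> l <= c.
Proof. by move=> ul [N HN]; apply: (cvgr_to_le ul); exists N. Qed.

Lemma Cb_cvg_eball (f_ : nat -> 'rV[R]_d -> R) f :
  (forall n, Cb (f_ n)) -> Cb f ->
  (exists M : R, forall n x, `|f_ n x| <= M) ->
  (forall r eta : R, 0 <= r -> 0 < eta -> exists N, forall n, (N <= n)%N ->
    forall x, enorm x <= r -> `|f_ n x - f x| <= eta) ->
  Cb_cvg f_ f.
Proof.
move=> Cf_ Cf [M fM] H; have M0 : 0 <= M by apply: le_trans (fM 0%N 0).
split => //; first by exists M => n; apply: supnorm_le.
move=> A /compact_sub_eball[r r0 Ar]; apply/cvgrPdist_le => eta eta0.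
have [N HN] := H r eta r0 eta0.
exists N => // n /= Nn; rewrite sub0r normrN ger0_norm ?supnorm_ge0//.
apply: supnorm_le; first exact: ltW.
by move=> x Ax; rewrite distrC; apply: HN => //; exact: Ar.
Qed.

(** Dini's theorem on balls; monotonicity lets a single index serve a whole
    neighbourhood. *)
Lemma dini (f_ : nat -> 'rV[R]_d -> R) (r eta : R) : (forall n, continuous (f_ n)) ->
  decr_to0 f_ -> 0 < eta ->
  exists N, forall n x, (N <= n)%N -> enorm x <= r -> f_ n x <= eta.
Proof.
move=> cf df eta0.
have /compact_near_coveringP/near_covering_withinP cov := @compact_eball R d r.
have mono n m x : (n <= m)%N -> f_ m x <= f_ n x.
  move=> /subnK <-; elim: (m - n)%N => //= k; apply: le_trans.
  by rewrite addSn; have [] := df x.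
have : \forall n \near \oo,
    [set x : 'rV[R]_d | enorm x <= r] `<=` (fun x => f_ n x <= eta).
  apply: cov => x _.
  have [_ /cvgrPdist_le/(_ (eta / 2))[|N _ HN]] := df x; first by rewrite divr_gt0.
  have := HN N (leqnn N); rewrite /= sub0r normrN => fN.
  have eta2 : 0 < eta / 2 by rewrite divr_gt0.
  exists ([set y | `|f_ N x - f_ N y| <= eta / 2], [set n | (N <= n)%N]).
    by split; [exact: continuous_near_dist|exists N].
  move=> [y n] /= [Hy Nn] _; apply: le_trans (mono N n y Nn) _.
  by move: fN Hy; rewrite !ler_norml; lra.
by move=> [N _ HN]; exists N => n x Nn xr; exact: HN.
Qed.

End CbConvergence.

(** * The limit semigroup *)

Section LimitSemigroup.
Context {R : realType} {d : nat}.
Variables (J : nat -> ('rV[R]_d -> R) -> 'rV[R]_d -> R) (h : nat -> R) (L K : R).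
Variable (G : 'rV[R]_d -> 'rV[R]_d -> 'M[R]_d -> R).
Hypothesis S : approx_scheme J h L K G.
Implicit Types (f g u v w : 'rV[R]_d -> R) (x y z : 'rV[R]_d).
Implicit Types (a b c r s t C eps eta sigma tau rho kappa : R) (n m k j i N : nat).

Let h0 n : 0 < h n. Proof. exact: as_h_gt0 S n. Qed.
Let h0' n : 0 <= h n. Proof. exact/ltW/h0. Qed.
Let L0 : 0 <= L. Proof. exact: as_L_ge0 S. Qed.
Let K0 : 0 <= K. Proof. exact: as_K_ge0 S. Qed.

Definition steps t n := Num.truncn (t / h n).

Definition limit_op t f : 'rV[R]_d -> R :=
  fun x => lim (iter (steps t n) (J n) f x @[n --> \oo]).

Local Notation T := limit_op.

Lemma steps_itv t n : 0 <= t -> (steps t n)%:R * h n <= t <= (steps t n)%:R * h n + h n.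
Proof.
move=> t0; have th : 0 <= t / h n by rewrite divr_ge0.
have /andP[] := truncn_itv th; rewrite -/(steps t n) ler_pdivlMr// => -> /=.
by rewrite ltr_pdivrMr// -natr1 mulrDl mul1r => /ltW.
Qed.

Lemma steps_close t rho : 0 <= t -> 0 < rho -> exists N, forall n, (N <= n)%N ->
  `|(steps t n)%:R * h n - t| <= rho.
Proof.
move=> t0 rho0; have [N HN] := h_small S rho0; exists N => n /HN hn.
by have := steps_itv n t0; rewrite ler_norml; lra.
Qed.

Lemma limit_cvg t f x : 0 <= t -> Cb f ->
  iter (steps t n) (J n) f x @[n --> \oo] --> T t f x.
Proof.
move=> t0 Cf; suff : cvg (iter (steps t n) (J n) f x @[n --> \oo]) by [].
apply/cauchy_cvgP/cauchy_exP => e e0; have e2 : 0 < e / 2 by rewrite divr_gt0.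
have [rho rho0 [N H]] := Cb_convergence S Cf t0 (enorm_ge0 x) e2.
have [N' HN'] := steps_close t0 rho0.
pose M := maxn N N'.
exists (iter (steps t M) (J M) f x); exists M => // n /= Mn.
have nN : (N <= n)%N by apply: leq_trans Mn; exact: leq_maxl.
have nN' : (N' <= n)%N by apply: leq_trans Mn; exact: leq_maxr.
rewrite /ball /= (@le_lt_trans _ _ (e / 2))//; last by lra.
by apply: (H n M) => //; [exact: leq_maxl|exact: HN'|apply: HN'; exact: leq_maxr].
Qed.

Lemma limit_steps t f x eta : 0 <= t -> Cb f -> 0 < eta -> exists N, forall n,
  (N <= n)%N -> `|iter (steps t n) (J n) f x - T t f x| <= eta.
Proof.
move=> t0 Cf eta0; have /cvgrPdist_le/(_ eta eta0)[N _ HN] := limit_cvg (x := x) t0 Cf.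
by exists N => n Nn; rewrite distrC; exact: HN.
Qed.

(** The Cauchy estimate compares arbitrary numbers of steps with [k * h n] close
    to [t], so the particular choice made by [steps] is immaterial. *)
Lemma limit_approx t f r eta : 0 <= t -> Cb f -> 0 <= r -> 0 < eta ->
  exists2 rho, 0 < rho & exists N, forall n k, (N <= n)%N ->
  `|k%:R * h n - t| <= rho -> forall x, enorm x <= r ->
  `|iter k (J n) f x - T t f x| <= eta.
Proof.
move=> t0 Cf r0 eta0.
have eta2 : 0 < eta / 2 by rewrite divr_gt0.
have [rho rho0 [N H]] := Cb_convergence S Cf t0 r0 eta2.
exists rho => //; exists N => n k Nn kt x xr.
have [N1 H1] := steps_close t0 rho0.
have [N2 H2] := limit_steps x t0 Cf eta2.
pose m := maxn N (maxn N1 N2).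
have /and3P[m0 m1 m2] : [&& (N <= m)%N, (N1 <= m)%N & (N2 <= m)%N].
  by rewrite -!geq_max.
have B1 := H m n (steps t m) k m0 Nn (H1 m m1) kt x xr.
have B2 := H2 m m2.
by move: B1 B2; rewrite !ler_norml; lra.
Qed.

Lemma limit_le2 t f g x y a b c : 0 <= t -> Cb f -> Cb g -> 
  (exists N, forall n, (N <= n)%N ->
    a * iter (steps t n) (J n) f x + b * iter (steps t n) (J n) g y <= c) ->
  a * T t f x + b * T t g y <= c.
Proof.
move=> t0 Cf Cg [N HN].
apply: (@seq_lim_le _ (fun n => a * iter (steps t n) (J n) f x
    + b * iter (steps t n) (J n) g y)); last by exists N.
apply: cvgD; apply: cvgM; [exact: cvg_cst|exact: limit_cvg|exact: cvg_cst|exact: limit_cvg].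
Qed.

Lemma limit_dist t f g x y a b c : 0 <= t -> Cb f -> Cb g ->
  (exists N, forall n, (N <= n)%N ->
    `|iter (steps t n) (J n) f x - iter (steps t n) (J n) g y - a| <= c) ->
  `|T t f x - T t g y - a| <= c.
Proof.
move=> t0 Cf Cg [N HN].
have B1 : (-1) * T t f x + 1 * T t g y <= c - a.
  by apply: limit_le2 => //; exists N => n /HN; rewrite ler_norml; lra.
have B2 : 1 * T t f x + (-1) * T t g y <= c + a.
  by apply: limit_le2 => //; exists N => n /HN; rewrite ler_norml; lra.
by rewrite ler_norml; lra.
Qed.

Lemma limit_mono t f g x : 0 <= t -> Cb f -> Cb g -> (forall y, f y <= g y) ->
  T t f x <= T t g x.
Proof.
move=> t0 Cf Cg fg; have : 1 * T t f x + (-1) * T t g x <= 0; last by lra.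
apply: limit_le2 => //; exists 0%N => n _.
by have := iter_mono S n (steps t n) x Cf Cg fg; lra.
Qed.

Lemma limit_cst t c : 0 <= t -> T t (cst c) = cst c.
Proof.
move=> t0; apply/funext => x; rewrite /limit_op.
under eq_fun do rewrite (iter_cst S).
exact: lim_cst.
Qed.

Lemma limit_contraction t f g a x : 0 <= t -> Cb f -> Cb g ->
  (forall y, `|f y - g y| <= a) -> `|T t f x - T t g x| <= a.
Proof.
move=> t0 Cf Cg fg; rewrite -[_ - _]subr0; apply: limit_dist => //.
by exists 0%N => n _; rewrite subr0; exact: (iter_contraction S).
Qed.

Lemma limit_norm_le t f (M : R) x : 0 <= t -> Cb f -> (forall y, `|f y| <= M) ->
  `|T t f x| <= M.
Proof.
move=> t0 Cf fM; have := @limit_contraction t f (cst 0) M x t0 Cf (Cb_cst 0).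
by rewrite limit_cst// /cst subr0; apply => y; rewrite subr0.
Qed.

Lemma limit_Cb t f : 0 <= t -> Cb f -> Cb (T t f).
Proof.
move=> t0 Cf; apply: CbP; last first.
  by have [M fM] := Cb_bnd Cf; exists M => x; exact: limit_norm_le.
apply: continuous_eballP => x e e0; have e3 : 0 < e / 3 by rewrite divr_gt0.
have r0 : 0 <= enorm x + 1 by rewrite addr_ge0 ?enorm_ge0.
have [rho rho0 [N HN]] := limit_approx t0 Cf r0 e3.
have [N' HN'] := steps_close t0 rho0.
pose n := maxn N N'; pose g := iter (steps t n) (J n) f.
have {}HN y : enorm y <= enorm x + 1 -> `|g y - T t f y| <= e / 3.
  by apply: HN; [exact: leq_maxl|apply: HN'; exact: leq_maxr].
have cg : continuous g by exact: (iter_Cb S n (steps t n) Cf).1.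
have [r1 r10 H1] := unif_continuous_eball (enorm x) cg e3.
exists (Num.min r1 1); first by rewrite lt_min r10 ltr01.
move=> y; rewrite le_min => /andP[y1 y2].
have A1 := H1 x y (lexx _) y1.
have A2 : `|g x - T t f x| <= e / 3 by apply: HN; rewrite lerDl.
have A3 : `|g y - T t f y| <= e / 3.
  by apply: HN; have := enormD x (y - x); rewrite subrKC; lra.
by move: A1 A2 A3; rewrite !ler_norml; lra.
Qed.

Lemma limit_convex t f g (l : R) x : 0 <= t -> Cb f -> Cb g -> 0 <= l <= 1 ->
  T t (fun y => l * f y + (1 - l) * g y) x <= l * T t f x + (1 - l) * T t g x.
Proof.
move=> t0 Cf Cg l01; have Cfg : Cb (fun y => l * f y + (1 - l) * g y).
  by apply: CbD; exact: CbZ.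
rewrite -subr_le0; apply: (@seq_lim_le _ (fun n =>
  iter (steps t n) (J n) (fun y => l * f y + (1 - l) * g y) x -
  (l * iter (steps t n) (J n) f x + (1 - l) * iter (steps t n) (J n) g x))).
  apply: cvgB; first exact: limit_cvg.
  apply: cvgD; apply: cvgM; [exact: cvg_cst|exact: limit_cvg|exact: cvg_cst|exact: limit_cvg].
by exists 0%N => n _ /=; rewrite subr_le0; exact: (iter_convex S).
Qed.

Lemma limit_0 f : Cb f -> T 0 f = f.
Proof.
move=> Cf; apply/funext => x; rewrite /limit_op /steps.
under eq_fun do rewrite mul0r truncn0.
exact: lim_cst.
Qed.

Lemma limit_local T0 r r0 eps : 0 <= T0 -> 0 <= r -> 0 <= r0 -> 0 < eps ->
  exists2 r1, 0 <= r1 & forall t f g a x, 0 <= t <= T0 -> Cb f -> Cb g ->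
  (forall y, `|f y| <= r) -> (forall y, `|g y| <= r) -> 0 <= a ->
  (forall y, enorm y <= r1 -> `|f y - g y| <= a) -> enorm x <= r0 ->
  `|T t f x - T t g x| <= a + eps.
Proof.
move=> T00 r_ge0 r00 eps0.
have [r1 r10 [N HN]] := local_dependence S T00 r_ge0 r00 eps0.
exists r1 => // t f g a x /andP[t0 tT] Cf Cg fr gr a0 fga xr.
rewrite -[_ - _]subr0; apply: limit_dist => //.
exists N => n Nn; rewrite subr0; apply: HN => //; apply: le_trans tT.
by have /andP[] := steps_itv n t0.
Qed.

(** Composing approximations: the inner one converges on balls only, so the
    outer one has to depend locally on its argument, uniformly in [n]. *)
Lemma limit_add s t f : 0 <= s -> 0 <= t -> Cb f -> T (s + t) f = T s (T t f).
Proof.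
move=> s0 t0 Cf; apply/funext => x; apply/eqP; rewrite -subr_eq0 -normr_le0.
apply/ler_addgt0Pr => e e0; rewrite add0r.
have e4 : 0 < e / 4 by rewrite divr_gt0.
have CT := limit_Cb t0 Cf.
have [M fM] := Cb_bnd Cf; have M0 : 0 <= M by apply: le_trans (fM 0).
have TM y : `|T t f y| <= M by exact: limit_norm_le.
have s1 : 0 <= s + 1 by rewrite addr_ge0.
have [r1 r10 [N1 H1]] := local_dependence S s1 M0 (enorm_ge0 x) e4.
have [rho2 rho20 [N2 H2]] := limit_approx t0 Cf r10 e4.
have [rho3 rho30 [N3 H3]] := limit_approx (addr_ge0 s0 t0) Cf (enorm_ge0 x) e4.
have [N4 H4] := limit_steps x s0 CT e4.
have rho0 : 0 < Num.min rho2 (Num.min (rho3 / 2) 1).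
  by rewrite !lt_min rho20 ltr01 andbT; apply: divr_gt0.
have [N5 H5] := steps_close s0 rho0.
have [N6 H6] := steps_close t0 rho0.
pose n := (N1 + N2 + N3 + N4 + N5 + N6)%N.
have n1 : (N1 <= n)%N by rewrite /n -!addnA leq_addr.
have n2 : (N2 <= n)%N by rewrite /n -!addnA addnCA leq_addr.
have n3 : (N3 <= n)%N by rewrite /n [(N1 + N2 + N3)%N]addnC -!addnA leq_addr.
have n4 : (N4 <= n)%N by rewrite /n [(N1 + N2 + N3 + N4)%N]addnC -!addnA leq_addr.
have n5 : (N5 <= n)%N by rewrite /n [(_ + N5)%N]addnC -!addnA leq_addr.
have n6 : (N6 <= n)%N by rewrite /n leq_addl.
have := H5 n n5; rewrite !le_min => /and3P[_ p2 p3].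
have := H6 n n6; rewrite !le_min => /and3P[q1 q2 _].
have B1 : `|iter (steps s n + steps t n) (J n) f x - T (s + t) f x| <= e / 4.
  apply: H3 => //; rewrite natrD mulrDl.
  by move: p2 q2; rewrite !ler_norml; lra.
have B2 : `|iter (steps s n) (J n) (iter (steps t n) (J n) f) x -
    iter (steps s n) (J n) (T t f) x| <= e / 4 + e / 4.
  apply: H1 => //.
  - by move: p3; rewrite ler_norml; lra.
  - exact: (iter_Cb S).
  - by move=> y; exact: (iter_norm_le S).
  - exact: ltW.
  - by move=> y yr; exact: H2.
have B3 := H4 n n4; rewrite iterD in B1.
by move: B1 B2 B3; rewrite !ler_norml; lra.
Qed.

Lemma limit_lip_time r sigma : 0 <= r -> 0 < sigma -> exists2 tau, 0 < tau &
  forall t f, 0 <= t <= tau -> lip r f -> bnd f ->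
  forall x, `|T t f x - f x| <= sigma.
Proof.
move=> r0 sigma0; have [tau tau0 [N HN]] := time_regularity_short S r0 sigma0.
exists tau => // t f /andP[t0 tt] fr bf x; have Cf := lip_Cb fr bf.
have -> : T t f x - f x = T t f x - T 0 (cst 0) x - f x.
  by rewrite limit_cst// /cst subr0.
rewrite limit_cst// -(limit_cst 0 t0); apply: limit_dist => //; first exact: Cb_cst.
exists N => n Nn; rewrite (iter_cst S) /cst subr0; apply: HN => //.
by apply: le_trans tt; have /andP[] := steps_itv n t0.
Qed.

Lemma limit_strongly_continuous f : Cb f -> Cb_cvg_at0 (T ^~ f) f.
Proof.
move=> Cf q q0 q_cvg; have [M fM] := Cb_bnd Cf.
have M0 : 0 <= M by apply: le_trans (fM 0).
apply: Cb_cvg_eball => //.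
- by move=> n; apply: limit_Cb => //; exact/ltW/q0.
- by exists M => n x; apply: limit_norm_le => //; exact/ltW/q0.
- move=> r eta r0 eta0; have eta4 : 0 < eta / 4 by rewrite divr_gt0.
  have [r1 r10 H1] := limit_local ler01 M0 r0 eta4.
  have [g [c [c0 gc gM fg]]] := lip_approx (Num.max r r1) Cf.1 fM eta4.
  have bg : bnd g by exists M.
  have [tau tau0 H2] := limit_lip_time c0 eta4.
  have mt : 0 < Num.min tau 1 by rewrite lt_min tau0 ltr01.
  have /cvgrPdist_le/(_ _ mt)[N _ HN] := q_cvg.
  exists N => n Nn x xr; have := HN n Nn.
  rewrite /= sub0r normrN gtr0_norm// le_min => /andP[t1 t2].
  have qn0 := ltW (q0 n).
  have B1 : `|T (q n) f x - T (q n) g x| <= eta / 4 + eta / 4.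
    apply: H1 => //; [by rewrite qn0|exact: lip_Cb gc bg|exact: ltW|].
    by move=> y yr; apply: fg; rewrite le_max yr orbT.
  have B2 : `|T (q n) g x - g x| <= eta / 4 by apply: H2 => //; rewrite qn0.
  have B3 : `|f x - g x| <= eta / 4 by apply: fg; rewrite le_max xr.
  by move: B1 B2 B3; rewrite !ler_norml; lra.
Qed.

Lemma limit_continuous_above t (f_ : nat -> 'rV[R]_d -> R) : 0 <= t ->
  (forall n, Cb (f_ n)) -> decr_to0 f_ -> decr_to0 (fun n => T t (f_ n)).
Proof.
move=> t0 Cf df x; split.
  by move=> n; apply: limit_mono => // y; have [] := df y.
have mono n y : f_ n y <= f_ 0%N y.
  by elim: n => // n; apply: le_trans; have [] := df y.
have pos n y : 0 <= f_ n y.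
  have [dfy fy0] := df y.
  apply: (seq_lim_le fy0); exists n => m /subnK <-.
  by elim: (m - n)%N => //= k; apply: le_trans; rewrite addSn.
have [M fM] := Cb_bnd (Cf 0%N); have M0 : 0 <= M by apply: le_trans (fM 0).
have fnM n y : `|f_ n y| <= M.
  by rewrite ger0_norm//; apply: le_trans (mono n y) _; apply: le_trans (fM y); exact: ler_norm.
apply/cvgrPdist_le => e e0; have e2 : 0 < e / 2 by rewrite divr_gt0.
have [r1 r10 H1] := limit_local t0 M0 (enorm_ge0 x) e2.
have [N HN] := dini r1 (fun n => (Cf n).1) df e2.
exists N => // n /= Nn; rewrite sub0r normrN.
have := H1 t (f_ n) (cst 0) (e / 2) x; rewrite limit_cst// /cst subr0.
rewrite t0 lexx -splitr; apply => //.
- exact: Cb_cst.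
- by move=> y; rewrite normr0.
- exact: ltW.
- by move=> y yr; rewrite subr0 ger0_norm//; exact: HN.
Qed.

Theorem limit_semigroup : convex_monotone_semigroup T.
Proof.
split.
- exact: limit_Cb.
- by move=> t f g t0 Cf Cg fg x; exact: limit_mono.
- by move=> t f g l t0 Cf Cg l01 x; exact: limit_convex.
- exact: limit_continuous_above.
- exact: limit_0.
- exact: limit_add.
- move=> r T0 r0 T00; exists r => t /andP[t0 _].
  by apply: supnorm_le => // x _; rewrite limit_cst// ger0_norm.
- exact: limit_strongly_continuous.
Qed.

Lemma limit_Cb_cvg t f (k : nat -> nat) : 0 <= t -> Cb f ->
  (fun n => (k n)%:R * h n) @ \oo --> t ->
  Cb_cvg (fun n => iter (k n) (J n) f) (T t f).
Proof.
move=> t0 Cf kt; have [M fM] := Cb_bnd Cf; apply: Cb_cvg_eball.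
- by move=> n; exact: (iter_Cb S).
- exact: limit_Cb.
- by exists M => n x; exact: (iter_norm_le S).
- move=> r eta r0 eta0.
  have [rho rho0 [N HN]] := limit_approx t0 Cf r0 eta0.
  have /cvgrPdist_le/(_ _ rho0)[N' _ HN'] := kt.
  exists (maxn N N') => n; rewrite geq_max => /andP[n1 n2] x xr.
  by apply: HN => //; rewrite distrC; exact: HN'.
Qed.

Lemma limit_lip t f r : 0 <= r -> 0 <= t -> lip r f -> bnd f ->
  lip (r * expR (L * t)) (T t f).
Proof.
move=> r0 t0 fr bf x y; have Cf := lip_Cb fr bf.
rewrite -[_ - T t f y]subr0; apply: limit_dist => //; exists 0%N => n _.
rewrite subr0; apply: (iter_lip S) => //.
by have /andP[] := steps_itv n t0.
Qed.

Lemma limit_translate t f r x z : 0 <= r -> 0 <= t -> lip r f -> bnd f ->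
  `|T t (translate z f) x - T t f (z + x)| <= L * expR (L * t) * r * t * enorm z.
Proof.
move=> r0 t0 fr bf; have Cf := lip_Cb fr bf.
rewrite -[_ - _]subr0; apply: limit_dist => //; first exact: Cb_translate.
exists 0%N => n _; rewrite subr0.
have /andP[kt _] := steps_itv n t0.
apply: le_trans (iter_translate S x z r0 fr bf kt) _.
by rewrite ler_wpM2r ?enorm_ge0// ler_wpM2l// !mulr_ge0// expR_ge0.
Qed.

(** * The generator on functions with a second-order jet *)

Section Generator.
Variables (C : R) (f : 'rV[R]_d -> R) (p : 'rV[R]_d -> 'rV[R]_d) (A : 'rV[R]_d -> 'M[R]_d).
Hypotheses (C0 : 0 <= C) (fC : lip C f) (bf : bnd f) (jf : jet C f p A).
Hypothesis pC : forall x y, enorm (p x - p y) <= C * enorm (x - y).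
Hypothesis AC : forall x y, bform_le (C * enorm (x - y)) (A x - A y).

Let B x := G x (p x) (A x).
Let Cf := lip_Cb fC bf.

Lemma jet_generator_lip : exists2 c, 0 <= c & lip c B.
Proof.
exists (K * C + K * (1 + C) * C).
  by apply: addr_ge0; apply: mulr_ge0 => //; apply: mulr_ge0 => //; apply: addr_ge0.
move=> x y; rewrite -[_ - _](subrKA (G y (p x) (A x))).
apply: le_trans (ler_normD _ _) _; rewrite mulrDl; apply: lerD.
  apply: le_trans (as_G_lip S _ _ _ _) _; rewrite ler_wpM2r ?enorm_ge0//.
  by rewrite ler_wpM2l//; exact: jet_grad jf x.
rewrite -mulrA; apply: (as_G_close S) => //; first by rewrite mulr_ge0 ?enorm_ge0.
- exact: jet_grad jf x.
- exact: jet_grad jf y.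
Qed.

Lemma jet_generator_bound x : `|B x| <= K * (1 + C) * C.
Proof. by apply: (G_bound S) => //; [exact: jet_grad jf x|exact: jet_hess jf x]. Qed.

Lemma jet_generator_bnd : bnd B.
Proof. by exists (K * (1 + C) * C) => x; exact: jet_generator_bound. Qed.

(** A step of the scheme adds about [h B] to its argument. By convexity the
    difference quotients at [0] of [h |-> J^i (f + h B)] increase in [h], so the
    one for the step size lies between those for [-1] and [1], which are close
    to [B] for short times. *)
Lemma iter_generator_estimate eta : 0 < eta -> exists2 tau, 0 < tau & exists N,
  forall n k x, (N <= n)%N -> k%:R * h n <= tau ->
  `|iter k (J n) f x - f x - k%:R * h n * B x| <= k%:R * h n * eta.
Proof.
move=> eta0; have [c c0 Bc] := jet_generator_lip; have bB := jet_generator_bnd.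
have eta3 : 0 < eta / 3 by rewrite divr_gt0.
have r0 : 0 <= C + c by rewrite addr_ge0.
have [tau tau0 [N1 H1]] := time_regularity_short S r0 eta3.
have [N2 H2] := as_consistent S C0 eta3.
have [N3 H3] := h_small S ltr01.
exists tau => //; exists (maxn N1 (maxn N2 N3)) => n k x.
rewrite !geq_max => /and3P[n1 n2 n3].
have h1 := H3 n n3; have hn := h0 n; have hn' := ltW hn.
have CB := lip_Cb Bc bB.
have f1 : lip (C + c) f by apply: lip_le fC; rewrite lerDl.
have fp : lip (C + c) (fun y => f y + B y) by exact: lipD.
have fm : lip (C + c) (fun y => f y - B y) by exact: lipB.
have Cp : Cb (fun y => f y + B y) by exact: CbD.
have Cm : Cb (fun y => f y - B y) by exact: CbB.
have ChB : Cb (fun y => f y + h n * B y) by apply: CbD => //; exact: CbZ.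
have cons y := H2 n n2 f p A Cf jf y.
elim: k => [|k ih] kt; first by rewrite !mul0r subr0 subrr normr0.
have kt' : k%:R * h n <= tau.
  by apply: le_trans kt; rewrite ler_wpM2r// ler_nat.
have {}ih := ih kt'.
have A1 := H1 n n1 k f f1 bf kt' x.
have A2 := H1 n n1 k _ fp (Cb_bnd Cp) kt' x.
have A3 := H1 n n1 k _ fm (Cb_bnd Cm) kt' x.
have U : `|iter k.+1 (J n) f x - iter k (J n) (fun y => f y + h n * B y) x| <= eta / 3 * h n.
  rewrite iterSr; apply: (iter_contraction S) => //; first exact: (as_Cb S).
  by move=> y; have := cons y; rewrite -/(B y) opprD addrA.
have l1 : 0 <= h n <= 1 by rewrite hn'.
have V1 := iter_convex S n k x Cp Cf l1.
rewrite (_ : (fun y => h n * (f y + B y) + (1 - h n) * f y) =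
  fun y => f y + h n * B y) in V1; last by apply/funext => y; ring.
(* The weight for which [f] is a convex combination of [f + h B] and [f - B]. *)
pose l := (1 + h n)^-1.
have l0 : 0 < 1 + h n by rewrite ltr_pwDl.
have l2 : 0 <= l <= 1 by rewrite invr_ge0 (ltW l0) invf_le1// lerDl.
have V2 := iter_convex S n k x ChB Cm l2.
rewrite (_ : (fun y => l * (f y + h n * B y) + (1 - l) * (f y - B y)) = f) in V2; last first.
  by apply/funext => y; rewrite /l; field; rewrite gt_eqF.
have V3 : (1 + h n) * iter k (J n) f x <= iter k (J n) (fun y => f y + h n * B y) x
    + h n * iter k (J n) (fun y => f y - B y) x.
  rewrite -(ler_pM2l l0) in V2; apply: le_trans V2 _.
  rewrite le_eqVlt; apply/orP; left; apply/eqP; rewrite /l; field.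
  by rewrite gt_eqF.
move: A1 A2 A3 U ih; rewrite !ler_norml => /andP[a1 a1'] /andP[a2 a2'] /andP[a3 a3']
  /andP[u u'] /andP[i1 i2].
have W1 : h n * (iter k (J n) (fun y => f y + B y) x - iter k (J n) f x) <=
    h n * (B x + (eta / 3 + eta / 3)) by rewrite ler_wpM2l//; lra.
have W2 : h n * (B x - (eta / 3 + eta / 3)) <=
    h n * (iter k (J n) f x - iter k (J n) (fun y => f y - B y) x).
  by rewrite ler_wpM2l//; lra.
rewrite -[k.+1%:R]natr1; apply/andP; split; lra.
Qed.

Lemma limit_generator_estimate eta : 0 < eta -> exists2 tau, 0 < tau &
  forall t x, 0 <= t <= tau -> `|T t f x - f x - t * B x| <= t * eta.
Proof.
move=> eta0; have [tau tau0 [N H]] := iter_generator_estimate eta0.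
exists tau => // t x /andP[t0 tt].
apply/ler_addgt0Pr => e e0.
have [s0 s_gt0 Hs] := exists_small (normr_ge0 (B x)) e0.
have [N' HN'] := h_small S s_gt0.
rewrite -[T t f x]subr0 -[X in T t f x - X - _ - _](_ : T t (cst 0) x = 0); last first.
  by rewrite limit_cst.
rewrite -addrA -opprD; apply: limit_dist => //; first exact: Cb_cst.
exists (maxn N N') => n; rewrite geq_max => /andP[Nn Nn'].
have /andP[st1 st2] := steps_itv n t0.
have := H n (steps t n) x Nn (le_trans st1 tt).
rewrite (iter_cst S) /cst subr0; set q := _ * h n => H1.
have -> : iter (steps t n) (J n) f x - (f x + t * B x) =
  (iter (steps t n) (J n) f x - f x - q * B x) - (t - q) * B x by ring.
apply: le_trans (ler_normB _ _) _; apply: lerD.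
  by apply: le_trans H1 _; rewrite ler_wpM2r// ltW.
rewrite normrM ger0_norm ?subr_ge0// mulrC; apply: le_trans Hs.
by rewrite ler_wpM2l//; have := HN' n Nn'; rewrite /q; lra.
Qed.

Lemma limit_jet_drift t x : 0 <= t ->
  `|T t f x - f x| <= t * (K * (1 + C) * C + 1).
Proof.
move=> t0; have [N HN] := jet_drift S C0 (@ltr01 R).
have b0 : 0 <= K * (1 + C) * C + 1.
  by apply: addr_ge0 => //; apply: mulr_ge0 => //; apply: mulr_ge0 => //; apply: addr_ge0.
have -> : T t f x - f x = T t f x - T t (cst 0) x - f x.
  by rewrite limit_cst// /cst subr0.
apply: limit_dist => //; first exact: Cb_cst.
exists N => n Nn; rewrite (iter_cst S) /cst subr0.
apply: le_trans (iter_drift S (steps t n) x Cf (HN n Nn f p A Cf jf)) _.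
by rewrite mulrA ler_wpM2r//; have /andP[] := steps_itv n t0.
Qed.

Theorem limit_generator : generator T f B.
Proof.
split=> // q q0 q_cvg.
have [c c0 Bc] := jet_generator_lip.
apply: Cb_cvg_eball.
- move=> n; under eq_fun do rewrite mulrC.
  by apply: CbZ; apply: CbB => //; apply: limit_Cb => //; exact/ltW/q0.
- exact: lip_Cb Bc jet_generator_bnd.
- exists (K * (1 + C) * C + 1) => n x; have qn := q0 n.
  rewrite normrM normfV (gtr0_norm qn) ler_pdivrMr// mulrC.
  exact/limit_jet_drift/ltW.
- move=> r eta r0 eta0; have [tau tau0 H] := limit_generator_estimate eta0.
  have /cvgrPdist_le/(_ _ tau0)[N _ HN] := q_cvg.
  exists N => n Nn x _; have := HN n Nn; have qn := q0 n.
  rewrite /= sub0r normrN gtr0_norm// => qt.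
  rewrite (_ : _ / q n - B x = (q n)^-1 * (T (q n) f x - f x - q n * B x)); last first.
    by field; rewrite gt_eqF.
  rewrite normrM normfV (gtr0_norm qn) ler_pdivrMl//.
  by apply: H; rewrite ltW.
Qed.

End Generator.

End LimitSemigroup.


(** * Continuous functions of the increment *)

Section ContinuityFacts.
Context {R : realType} {d : nat}.
Implicit Types (f g : 'rV[R]_d -> R) (x y z a : 'rV[R]_d).

Lemma eball_continuous f x (e : R) : continuous f -> 0 < e ->
  exists2 r, 0 < r & forall y, enorm (y - x) <= r -> `|f y - f x| <= e.
Proof.
move=> cf e0; have [r r0 H] := unif_continuous_eball (enorm x) cf e0.
by exists r => // y; exact: H.
Qed.

Lemma continuous_bounded_eball f (r : R) : continuous f ->
  exists2 B, 0 <= B & forall x, enorm x <= r -> `|f x| <= B.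
Proof.
move=> cf; have cK : compact (f @` [set x : 'rV[R]_d | enorm x <= r]).
  by apply: continuous_compact; [exact: continuous_subspaceT|exact: compact_eball].
have [B0 [_ /(_ (B0 + 1))]] := compact_bounded cK.
rewrite ltrDl ltr01 => /(_ isT) HB; exists (Num.max (B0 + 1) 0).
  by rewrite le_max lexx orbT.
by move=> x xr; rewrite le_max HB//; exists x.
Qed.

Lemma dot_lip a : lip (enorm a) (dot a).
Proof.
by move=> x y; rewrite -dotNr -dotDr; exact: cauchy_schwarz.
Qed.

Lemma dot_continuous a : continuous (dot a).
Proof. exact: lip_continuous (dot_lip a). Qed.

Lemma continuous_mul f g : continuous f -> continuous g ->
  continuous (fun x => f x * g x).
Proof. by move=> cf cg x; apply: continuousM; [exact: cf|exact: cg]. Qed.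

Lemma continuous_add f g : continuous f -> continuous g ->
  continuous (fun x => f x + g x).
Proof. by move=> cf cg x; apply: continuousD; [exact: cf|exact: cg]. Qed.

Lemma continuous_scale (c : R) f : continuous f -> continuous (fun x => c * f x).
Proof. by move=> cf; apply: continuous_mul => // x; exact: cst_continuous. Qed.

Lemma bform_continuous (A : 'M[R]_d) : continuous (fun y => bform A y y).
Proof.
pose q (s : seq 'I_d) (y : 'rV[R]_d) : R :=
  \sum_(i <- s) y 0 i * dot (\row_j A i j) y.
have cq s : continuous (q s).
  elim: s => [|i s ih].
    rewrite /q (_ : (fun y => _) = cst 0); first by move=> x; exact: cst_continuous.
    by apply/funext => y; rewrite big_nil.
  rewrite (_ : q (i :: s) = fun y => y 0 i * dot (\row_j A i j) y + q s y); last first.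
    by apply/funext => y; rewrite /q big_cons.
  apply: continuous_add => //; apply: continuous_mul; last exact: dot_continuous.
  exact: coord_continuous.
rewrite (_ : (fun y => _) = q (enum 'I_d)); first exact: cq.
apply/funext => y; rewrite /q bformE big_enum/=; apply: eq_bigr => i _.
by rewrite /dot mulr_sumr; apply: eq_bigr => j _; rewrite !mxE mulrA.
Qed.

Lemma continuous_affine f x (b : R) : continuous f ->
  continuous (fun y => f (x + b *: y)).
Proof.
move=> cf; apply: continuous_eballP => y e e0.
have [r r0 H] := eball_continuous (x + b *: y) cf e0.
have b1 : 0 < `|b| + 1 by rewrite ltr_wpDl.
exists (r / (`|b| + 1)); first by rewrite divr_gt0.
move=> z; rewrite ler_pdivlMr// => zr; apply: H.
rewrite opprD addrACA subrr add0r -scalerBr enormZ mulrC.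
by apply: le_trans zr; rewrite ler_wpM2l ?enorm_ge0// lerDl.
Qed.

Lemma continuous_expR_comp f (c : R) : continuous f ->
  continuous (fun x => expR (c * f x)).
Proof.
move=> cf x; apply: (continuous_comp (f := fun x => c * f x)).
  exact: continuous_scale.
exact: continuous_expR.
Qed.

End ContinuityFacts.

(** * The sublinear expectation of the first increment *)

Section Expectation.
Context {R : realType} {d : nat} {Omega : Type} {H : set (Omega -> R)}
  {E : (Omega -> R) -> R} {xi : nat -> Omega -> 'rV[R]_d} {M : R}.
Hypothesis HE : sublinear_expectation H E.
Hypothesis xi_iid : iid H E xi.
Hypothesis xi_centered : forall a : 'rV[R]_d,
  H (fun w => dot a (xi 0%N w)) /\ E (fun w => dot a (xi 0%N w)) = 0.
Hypothesis xi_le : forall w, enorm (xi 0%N w) <= M.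
Implicit Types (f g : 'rV[R]_d -> R) (x y z a : 'rV[R]_d) (c : R).

Definition expect g := E (fun w => g (xi 0%N w)).

(** As [xi 0] is bounded, a continuous function of it agrees with its own
    truncation, which is a bounded continuous test function. *)
Lemma expect_dom g : continuous g -> H (fun w => g (xi 0%N w)).
Proof.
move=> cg; have [B B0 gB] := continuous_bounded_eball M cg.
pose t y := Num.max (- B) (Num.min B (g y)).
have tE w : t (xi 0%N w) = g (xi 0%N w).
  have := gB _ (xi_le w); rewrite ler_norml => /andP[h1 h2].
  by rewrite /t (min_idPr h2) (max_idPr h1).
have Ct : Cb t.
  apply: CbP.
    move=> x; apply: (@continuous_max _ _ (cst (- B)) (fun y => Num.min B (g y))).
      exact: cst_continuous.
    apply: (@continuous_min _ _ (cst B) g); [exact: cst_continuous|exact: cg].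
  exists B => y; rewrite /t ler_norml le_max lexx ge_max ge_min lexx /=.
  by rewrite andbT; lra.
have rE w : rvs xi 1 w = xi 0%N w.
  by apply/rowP => i; rewrite !mxE.
have := iid_test xi_iid Ct.
by under eq_fun do rewrite rE tE.
Qed.

Lemma expect_le f g : continuous f -> continuous g ->
  (forall y, enorm y <= M -> f y <= g y) -> expect f <= expect g.
Proof. by move=> cf cg fg; apply: (se_monotone HE); [exact: expect_dom|exact: expect_dom|move=> w; exact: fg]. Qed.

Lemma expect_cst c : expect (cst c) = c.
Proof. exact: (se_constant HE c). Qed.

Lemma expectD f g : continuous f -> continuous g ->
  expect (fun y => f y + g y) <= expect f + expect g.
Proof. by move=> cf cg; apply: (se_subadditive HE); exact: expect_dom. Qed.

Lemma expectZ c f : 0 <= c -> continuous f ->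
  expect (fun y => c * f y) = c * expect f.
Proof. by move=> c0 cf; apply: (se_homogeneous HE c0); exact: expect_dom. Qed.

Lemma expect_addc f c : continuous f -> expect (fun y => f y + c) = expect f + c.
Proof.
move=> cf; have cc b : continuous (cst b : 'rV[R]_d -> R) by move=> x; exact: cst_continuous.
apply/eqP; rewrite eq_le; apply/andP; split.
  by have := expectD cf (cc c); rewrite expect_cst.
have := expectD (continuous_add cf (cc c)) (cc (- c)).
rewrite expect_cst (_ : (fun y => _) = f) 1?lerBrDr//.
by apply/funext => y; rewrite /cst addrK.
Qed.

(** A centred linear form has expectation zero for both signs, so subadditivity
    bounds its effect from both sides. *)
Lemma expect_dot f a : continuous f -> expect (fun y => f y + dot a y) = expect f.
Proof.
move=> cf; have E0 b : expect (dot b) = 0 by exact: (xi_centered b).2.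
have cd := @dot_continuous R d; apply/eqP; rewrite eq_le; apply/andP; split.
  by have := expectD cf (cd a); rewrite E0 addr0.
have := expectD (continuous_add cf (cd a)) (cd (- a)); rewrite E0 addr0.
rewrite (_ : (fun y => _ + dot (- a) y) = f)//.
by apply/funext => y; rewrite dotNl addrK.
Qed.

Lemma expect_dist f g c : continuous f -> continuous g ->
  (forall y, enorm y <= M -> `|f y - g y| <= c) -> `|expect f - expect g| <= c.
Proof.
have half u v : continuous u -> continuous v ->
    (forall y, enorm y <= M -> `|u y - v y| <= c) -> expect u <= expect v + c.
  move=> cu cv uv; rewrite -expect_addc//; apply: expect_le => //.
    by apply: continuous_add => // x; exact: cst_continuous.
  by move=> y /uv; rewrite ler_norml; lra.
move=> cf cg fg; have h1 := half f g cf cg fg.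
have h2 : expect g <= expect f + c.
  by apply: half => // y /fg; rewrite distrC.
by rewrite ler_norml; lra.
Qed.

End Expectation.


(** * The entropic one-step operator *)

Section EntropicOperator.
Context {R : realType} {d : nat} {Omega : Type} {H : set (Omega -> R)}
  {E : (Omega -> R) -> R} {xi : nat -> Omega -> 'rV[R]_d} {M : R}.
Hypothesis HE : sublinear_expectation H E.
Hypothesis xi_iid : iid H E xi.
Hypothesis xi_centered : forall a : 'rV[R]_d,
  H (fun w => dot a (xi 0%N w)) /\ E (fun w => dot a (xi 0%N w)) = 0.
Hypothesis xi_le : forall w, enorm (xi 0%N w) <= M.
Variables (psi : 'rV[R]_d -> 'rV[R]_d) (L Mp : R).
Hypothesis L0 : 0 <= L.
Hypothesis psi_le : forall x, enorm (psi x) <= Mp.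
Hypothesis psi_lip : forall x y, enorm (psi x - psi y) <= L * enorm (x - y).
Implicit Types (f g u v : 'rV[R]_d -> R) (x y z a : 'rV[R]_d) (c : R).
Local Notation expect := (@expect R d Omega E xi).

Section OneStep.
Variables (al h de : R).
Hypotheses (al0 : 0 < al) (h0 : 0 < h) (de0 : 0 < de).

Definition euler_step x y := x + h *: psi x + (de * Num.sqrt h) *: y.

Local Notation step := euler_step.
Local Notation I := (euler_op E xi psi h de).
Local Notation J := (entropic_op E xi psi al h de).

Lemma step_close x x' y : enorm (step x y - step x' y) <= (1 + L * h) * enorm (x - x').
Proof.
have -> : step x y - step x' y = (x - x') + h *: (psi x - psi x').
  by rewrite /step opprD addrACA subrr addr0 scalerBr opprD addrACA.
apply: le_trans (enormD _ _) _; rewrite enormZ gtr0_norm// mulrDl mul1r lerD2l.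
by rewrite [L * h]mulrC -mulrA ler_wpM2l// ltW.
Qed.

Lemma step_continuous u x : continuous u -> continuous (fun y => u (step x y)).
Proof. exact: continuous_affine. Qed.

Lemma exp_step_continuous u x : continuous u ->
  continuous (fun y => expR (al * u (step x y))).
Proof. by move=> cu; apply: continuous_expR_comp; exact: step_continuous. Qed.

Lemma expect_exp_gt0 u x : Cb u -> 0 < expect (fun y => expR (al * u (step x y))).
Proof.
move=> Cu; have [B uB] := Cb_bnd Cu; apply: lt_le_trans (expR_gt0 (al * - B)) _.
rewrite -(expect_cst (xi := xi) HE (expR (al * - B))).
apply: (expect_le HE xi_iid xi_le).
- by move=> y; exact: cst_continuous.
- by apply: exp_step_continuous; exact: Cu.1.
- move=> y _; rewrite /cst ler_expR ler_pM2l//.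
  by have := uB (step x y); rewrite ler_norml => /andP[].
Qed.

Lemma exp_entropic u x : Cb u -> 
  expR (al * J u x) = expect (fun y => expR (al * u (step x y))).
Proof.
move=> Cu; rewrite /entropic_op /euler_op mulrA mulfV ?gt_eqF// mul1r lnK//.
by rewrite posrE; exact: expect_exp_gt0.
Qed.

(** Every order and Lipschitz property of the operator is an instance of this
    comparison along the increments that actually occur. *)
Lemma entropic_le u v x x' c : Cb u -> Cb v ->
  (forall y, enorm y <= M -> u (step x y) <= v (step x' y) + c) ->
  J u x <= J v x' + c.
Proof.
move=> Cu Cv uv; rewrite -(ler_pM2l al0) mulrDr -ler_expR expRD !exp_entropic//.
rewrite mulrC -(expectZ HE xi_iid xi_le (expR_ge0 _) (exp_step_continuous (x := x') Cv.1)).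
apply: (expect_le HE xi_iid xi_le).
- exact: exp_step_continuous Cu.1.
- by apply: continuous_scale; exact: exp_step_continuous Cv.1.
- by move=> y yM; rewrite -expRD ler_expR -mulrDr ler_pM2l// addrC uv.
Qed.

Lemma entropic_cst c : J (cst c) = cst c.
Proof.
apply/funext => x; rewrite /entropic_op /euler_op /cst.
have -> : E (fun=> expR (al * c)) = expR (al * c) := se_constant HE _.
by rewrite expRK mulrA mulVf ?gt_eqF// mul1r.
Qed.

Lemma entropic_dist u v x x' c : Cb u -> Cb v ->
  (forall y, enorm y <= M -> `|u (step x y) - v (step x' y)| <= c) ->
  `|J u x - J v x'| <= c.
Proof.
move=> Cu Cv uv.
have h1 : J u x <= J v x' + c.
  by apply: entropic_le => // y /uv; rewrite ler_norml; lra.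
have h2 : J v x' <= J u x + c.
  by apply: entropic_le => // y /uv; rewrite ler_norml; lra.
by rewrite ler_norml; lra.
Qed.

Lemma entropic_Cb u : Cb u -> Cb (J u).
Proof.
move=> Cu; have [B uB] := Cb_bnd Cu.
apply: CbP; last first.
  exists B => x; have := @entropic_dist u (cst 0) x x B Cu (Cb_cst 0).
  by rewrite entropic_cst /cst subr0; apply => y _; rewrite subr0.
have Lh : 0 < 1 + L * h by rewrite ltr_pwDl// mulr_ge0// ltW.
apply: continuous_eballP => x e e0.
pose r := enorm x + h * Mp + de * Num.sqrt h * M.
have [q q0 Hq] := unif_continuous_eball r Cu.1 e0.
exists (q / (1 + L * h)); first by rewrite divr_gt0.
move=> y; rewrite ler_pdivlMr// mulrC => yx; apply: entropic_dist => // z zM.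
apply: Hq; last by apply: le_trans (step_close _ _ _) _.
apply: le_trans (enormD _ _) _; apply: lerD.
  apply: le_trans (enormD _ _) _; rewrite lerD2l enormZ gtr0_norm//.
  by rewrite ler_wpM2l// ltW.
have b0 : 0 <= de * Num.sqrt h by rewrite mulr_ge0 ?sqrtr_ge0// ltW.
by rewrite enormZ ger0_norm// ler_wpM2l.
Qed.

Lemma entropic_mono u v x : Cb u -> Cb v -> (forall y, u y <= v y) -> J u x <= J v x.
Proof.
move=> Cu Cv uv; rewrite -[J v x]addr0; apply: entropic_le => // y _.
by rewrite addr0.
Qed.

Lemma entropic_add u c : Cb u -> J (fun x => u x + c) = fun x => J u x + c.
Proof.
move=> Cu; have Cuc : Cb (fun x => u x + c) by apply: CbD => //; exact: Cb_cst.
apply/funext => x; apply/eqP; rewrite eq_le; apply/andP; split.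
  by apply: entropic_le.
rewrite -lerBrDr; apply: entropic_le => // y _.
by rewrite addrK.
Qed.

(** As in the proof of Hoelder's inequality: normalised by [J u] and [J v], the
    exponentials have expectation one, and convexity of the exponential gives
    the claim pointwise. *)
Lemma entropic_convex u v (l : R) x : Cb u -> Cb v -> 0 <= l <= 1 ->
  J (fun y => l * u y + (1 - l) * v y) x <= l * J u x + (1 - l) * J v x.
Proof.
move=> Cu Cv /andP[l0 l1]; have l1' : 0 <= 1 - l by rewrite subr_ge0.
have [a aE] : exists a : R, J u x = a by exists (J u x).
have [b bE] : exists b : R, J v x = b by exists (J v x).
rewrite aE bE.
have Cw : Cb (fun y => l * u y + (1 - l) * v y) by apply: CbD; exact: CbZ.
set m := l * a + (1 - l) * b.
have cu : continuous (fun y => expR (al * u (step x y))) by exact: exp_step_continuous Cu.1.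
have cv : continuous (fun y => expR (al * v (step x y))) by exact: exp_step_continuous Cv.1.
pose wa := l * expR (al * (m - a)); pose wb := (1 - l) * expR (al * (m - b)).
have wa0 : 0 <= wa by rewrite mulr_ge0 ?expR_ge0.
have wb0 : 0 <= wb by rewrite mulr_ge0 ?expR_ge0.
rewrite -(ler_pM2l al0) -ler_expR exp_entropic//.
apply: (@le_trans _ _ (expect (fun y => wa * expR (al * u (step x y)) +
    wb * expR (al * v (step x y))))).
  apply: (expect_le HE xi_iid xi_le).
  - exact: exp_step_continuous Cw.1.
  - by apply: continuous_add; exact: continuous_scale.
  - move=> y _; set s := u _; set t := v _.
    pose p := al * (m - a) + al * s; pose q := al * (m - b) + al * t.
    rewrite [leRHS](_ : _ = l * expR p + (1 - l) * expR q); last first.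
      by rewrite /wa /wb /p /q !expRD !mulrA.
    set z := al * _.
    have -> : z = l * p + (1 - l) * q by rewrite /z /p /q /m; ring.
    set n := l * p + _.
    have hp : expR n * (1 + (p - n)) <= expR p.
      have -> : expR p = expR n * expR (p - n) by rewrite -expRD subrKC.
      by rewrite ler_pM2l ?expR_gt0// expR_ge1Dx.
    have hq : expR n * (1 + (q - n)) <= expR q.
      have -> : expR q = expR n * expR (q - n) by rewrite -expRD subrKC.
      by rewrite ler_pM2l ?expR_gt0// expR_ge1Dx.
    have -> : expR n = l * (expR n * (1 + (p - n))) +
        (1 - l) * (expR n * (1 + (q - n))) by rewrite /n; ring.
    by apply: lerD; rewrite ler_wpM2l.
apply: le_trans (expectD HE xi_iid xi_le _ _) _; try exact: continuous_scale.
rewrite !(expectZ HE xi_iid xi_le)//.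
have -> : expect (fun y => expR (al * u (step x y))) = expR (al * a) by rewrite -aE exp_entropic.
have -> : expect (fun y => expR (al * v (step x y))) = expR (al * b) by rewrite -bE exp_entropic.
rewrite [leLHS](_ : _ = l * expR (al * m) + (1 - l) * expR (al * m)).
  by rewrite -mulrDl addrC subrK mul1r.
have e1 : expR (al * (m - a)) * expR (al * a) = expR (al * m).
  by rewrite -expRD -mulrDr subrK.
have e2 : expR (al * (m - b)) * expR (al * b) = expR (al * m).
  by rewrite -expRD -mulrDr subrK.
by rewrite /wa /wb -[l * _ * _]mulrA e1 -[(1 - l) * _ * _]mulrA e2.
Qed.

Lemma entropic_lip u r : 0 <= r -> lip r u -> bnd u -> lip (r * (1 + L * h)) (J u).
Proof.
move=> r0 ur bu x x'; have Cu := lip_Cb ur bu; apply: entropic_dist => // y _.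
apply: le_trans (ur _ _) _; rewrite -mulrA ler_wpM2l//.
exact: step_close.
Qed.

Lemma entropic_translate u r x z : 0 <= r -> lip r u -> bnd u ->
  `|J (translate z u) x - J u (z + x)| <= L * h * r * enorm z.
Proof.
move=> r0 ur bu; have Cu := lip_Cb ur bu.
apply: entropic_dist => //; first exact: Cb_translate.
move=> y _; apply: le_trans (ur _ _) _.
have -> : z + step x y - step (z + x) y = h *: (psi x - psi (z + x)).
  rewrite /step !addrA; set b := _ *: y; rewrite opprD addrACA subrr addr0.
  by rewrite opprD addrACA subrr add0r scalerBr.
rewrite enormZ gtr0_norm//.
apply: (@le_trans _ _ (r * (h * (L * enorm (x - (z + x)))))).
  by rewrite ler_wpM2l// ler_pM2l.
rewrite [z + x]addrC opprD addrA subrr add0r enormN.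
by rewrite le_eqVlt; apply/orP; left; apply/eqP; ring.
Qed.

End OneStep.
End EntropicOperator.


(** * Exponential and logarithm to second order *)

Section ExpLn.
Context {R : realType}.
Implicit Types (x z s c : R).

Lemma primitive_bound (F f : R -> R) c (k : nat) z :
  (forall s, is_derive s 1 F (f s)) -> F 0 = 0 -> `|z| <= 1 -> 0 <= c ->
  (forall s, `|s| <= 1 -> `|f s| <= c * `|s| ^+ k) -> `|F z| <= c * `|z| ^+ k.+1.
Proof.
move=> dF F0 z1 c0 fc; rewrite exprSr mulrA.
have bnd_f s : `|s| <= `|z| -> `|f s| <= c * `|z| ^+ k.
  move=> sz; apply: le_trans (fc s (le_trans sz z1)) _.
  by rewrite ler_wpM2l// lerXn2r// nnegrE.
have [z0|z0] := leP 0 z.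
  rewrite {2}(ger0_norm z0); have := @mean_value_le _ F f 0 z (c * `|z| ^+ k) z0.
  rewrite F0 !subr0; apply => // s /andP[s0 sz].
  by apply: bnd_f; rewrite !ger0_norm.
rewrite {2}(ltr0_norm z0).
have := @mean_value_le _ F f z 0 (c * `|z| ^+ k) (ltW z0).
rewrite F0 !sub0r normrN; apply => // s /andP[sz s0].
by apply: bnd_f; rewrite (ler0_norm s0) (ltr0_norm z0) lerN2.
Qed.

Lemma expR_le4 z : `|z| <= 1 -> expR z <= 4.
Proof.
rewrite ler_norml => /andP[_ z1].
have h : 2^-1 <= expR (- 2^-1) :> R.
  by apply: le_trans (expR_ge1Dx _); lra.
apply: (@le_trans _ _ (expR 1)); first by rewrite ler_expR.
have -> : expR 1 = (expR (- 2^-1) ^- 2 : R).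
  by rewrite -exprVn -expRN opprK -expRM_natl; congr expR; field.
rewrite invf_ple ?posrE ?exprn_gt0 ?expR_gt0//; apply: (@le_trans _ _ (2^-1 ^+ 2)).
  by rewrite expr2; lra.
by apply: lerXn2r => //; rewrite ?nnegrE ?expR_ge0.
Qed.

Lemma expR_taylor2 z : `|z| <= 1 ->
  `|expR z - 1 - z - 2^-1 * z ^+ 2| <= 4 * `|z| ^+ 3.
Proof.
move=> z1.
have d0 s : is_derive s 1 (@expR R) (expR s) by exact: is_derive_expR.
have d1 s : is_derive s 1 (fun s => expR s - 1) (expR s).
  by have := is_deriveB (d0 s) (is_derive_cst (1 : R) s 1); rewrite subr0.
have d2 s : is_derive s 1 (fun s => expR s - 1 - s) (expR s - 1).
  exact: is_deriveB.
have d3 s : is_derive s 1 (fun s => expR s - 1 - s - 2^-1 * s ^+ 2) (expR s - 1 - s).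
  have : is_derive s 1 (fun s => expR s - 1 - s - 2^-1 * (s * s))
      (expR s - 1 - (2^-1 * (s * 1 + s * 1) + s * s * 0)).
    by apply: is_deriveB; apply: is_deriveM.
  by rewrite (_ : 2^-1 * (s * 1 + s * 1) + s * s * 0 = s)//; field.
have b1 s : `|s| <= 1 -> `|expR s - 1| <= 4 * `|s| ^+ 1.
  move=> s1; apply: (primitive_bound d1) => //; first by rewrite expR0 subrr.
  by move=> u u1; rewrite expr0 mulr1 ger0_norm ?expR_ge0// expR_le4.
have b2 s : `|s| <= 1 -> `|expR s - 1 - s| <= 4 * `|s| ^+ 2.
  by move=> s1; apply: (primitive_bound d2) => //; rewrite expR0 !subrr.
by apply: (primitive_bound d3) => //; rewrite expR0 expr0n/= mulr0 !subr0 subrr.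
Qed.

Lemma ln1D_bound s : `|s| <= 2^-1 -> `|ln (1 + s) - s| <= 2 * s ^+ 2.
Proof.
rewrite ler_norml => /andP[s1 s2]; have p1 : 0 < 1 + s by lra.
have h1 : ln (1 + s) <= s by apply: le_ln1Dx; lra.
have h2 : s - 2 * s ^+ 2 <= ln (1 + s).
  rewrite -ler_expR lnK ?posrE// -[leRHS]invrK -[X in X <= _]invrK.
  rewrite lef_pV2 ?posrE ?invr_gt0 ?expR_gt0// -expRN.
  apply: le_trans (expR_ge1Dx _); rewrite -(ler_pM2l p1) mulfV ?gt_eqF//.
  have -> : (1 + s) * (1 + - (s - 2 * s ^+ 2)) = 1 + s ^+ 2 * (1 + 2 * s) by ring.
  by rewrite lerDl mulr_ge0 ?sqr_ge0//; lra.
have := sqr_ge0 s; rewrite ler_norml; lra.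
Qed.

End ExpLn.


(** * The Hamiltonian *)

Section Consistency.
Context {R : realType} {d : nat} {Omega : Type} {H : set (Omega -> R)}
  {E : (Omega -> R) -> R} {xi : nat -> Omega -> 'rV[R]_d} {M : R}.
Hypothesis HE : sublinear_expectation H E.
Hypothesis xi_iid : iid H E xi.
Hypothesis xi_centered : forall a : 'rV[R]_d,
  H (fun w => dot a (xi 0%N w)) /\ E (fun w => dot a (xi 0%N w)) = 0.
Hypothesis xi_le : forall w, enorm (xi 0%N w) <= M.
Hypothesis M0 : 0 <= M.
Variables (psi : 'rV[R]_d -> 'rV[R]_d) (L Mp : R).
Hypothesis L0 : 0 <= L.
Hypothesis psi_le : forall x, enorm (psi x) <= Mp.
Hypothesis psi_lip : forall x y, enorm (psi x - psi y) <= L * enorm (x - y).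
Variables (ga dl : R).
Hypotheses (ga0 : 0 <= ga) (dl0 : 0 <= dl).
Implicit Types (f g u v : 'rV[R]_d -> R) (x y z a : 'rV[R]_d) (c : R).
Local Notation expect := (@expect R d Omega E xi).

Let Mp0 : 0 <= Mp. Proof. exact: le_trans (enorm_ge0 _) (psi_le 0). Qed.

Definition quadratic_part p (A : 'M[R]_d) y :=
  dl ^+ 2 * bform A y y + ga * `|dot p y| ^+ 2.

Definition entropic_hamiltonian x p (A : 'M[R]_d) :=
  2^-1 * expect (quadratic_part p A) + dot p (psi x).

Local Notation G := entropic_hamiltonian.

Lemma quadratic_part_continuous p A : continuous (quadratic_part p A).
Proof.
apply: continuous_add; apply: continuous_scale; first exact: bform_continuous.
rewrite (_ : (fun y => _) = fun y => dot p y * dot p y).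
  by apply: continuous_mul; exact: dot_continuous.
by apply/funext => y; rewrite real_normK ?num_real// expr2.
Qed.

Lemma hamiltonian0 x : G x 0 0 = 0.
Proof.
rewrite /entropic_hamiltonian dot0l addr0 (_ : quadratic_part 0 0 = cst 0).
  by rewrite (expect_cst HE) mulr0.
apply/funext => y; rewrite /quadratic_part /bform mulmx0 !dot0l normr0 expr0n/=.
by rewrite !mulr0 addr0.
Qed.

Definition hamiltonian_cst := dl ^+ 2 * M ^+ 2 + ga * M ^+ 2 + Mp + L.

Lemma hamiltonian_cst_ge0 : 0 <= hamiltonian_cst.
Proof. by rewrite !addr_ge0// mulr_ge0 ?exprn_ge0. Qed.

Lemma hamiltonian_lip x y p A :
  `|G x p A - G y p A| <= hamiltonian_cst * enorm p * enorm (x - y).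
Proof.
rewrite /entropic_hamiltonian opprD addrACA subrr add0r -dotNr -dotDr.
apply: le_trans (cauchy_schwarz _ _) _.
rewrite [hamiltonian_cst * _]mulrC -mulrA ler_wpM2l ?enorm_ge0//.
apply: le_trans (psi_lip x y) _; rewrite ler_wpM2r ?enorm_ge0// lerDr.
by rewrite !addr_ge0// mulr_ge0 ?exprn_ge0.
Qed.

Lemma bform_bound C (A : 'M[R]_d) x y (s t : R) : 0 <= C -> bform_le C A ->
  enorm x <= s -> enorm y <= t -> `|bform A x y| <= C * s * t.
Proof.
move=> C0 AC xs yt; apply: le_trans (AC x y) _.
by apply: ler_pM => //; rewrite ?mulr_ge0 ?enorm_ge0// ler_wpM2l.
Qed.

Lemma dot_bound x y (s t : R) : enorm x <= s -> enorm y <= t ->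
  `|dot x y| <= s * t.
Proof.
move=> xs yt; apply: le_trans (cauchy_schwarz _ _) _.
by apply: ler_pM => //; exact: enorm_ge0.
Qed.

Lemma hamiltonian_close C c x p q A B : 0 <= C -> 0 <= c ->
  enorm p <= C -> enorm q <= C -> enorm (p - q) <= c -> bform_le c (A - B) ->
  `|G x p A - G x q B| <= hamiltonian_cst * (1 + C) * c.
Proof.
move=> C0 c0 pC qC pq AB; have c2 : 0 <= c * M ^+ 2 by rewrite mulr_ge0 ?exprn_ge0.
have H1 : `|expect (quadratic_part p A) - expect (quadratic_part q B)| <=
    dl ^+ 2 * (c * M ^+ 2) + ga * (c * M * (2 * C * M)).
  apply: (expect_dist HE xi_iid xi_le); [exact: quadratic_part_continuous..|].
  move=> y yM; rewrite /quadratic_part !real_normK ?num_real//.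
  have -> : dl ^+ 2 * bform A y y + ga * dot p y ^+ 2 -
      (dl ^+ 2 * bform B y y + ga * dot q y ^+ 2) =
    dl ^+ 2 * bform (A - B) y y + ga * (dot (p - q) y * dot (p + q) y).
    rewrite /bform mulmxBr !dotDl !dotNl; ring.
  apply: le_trans (ler_normD _ _) _.
  rewrite normrM (@ger0_norm _ (dl ^+ 2)) ?exprn_ge0// normrM (ger0_norm ga0) normrM.
  apply: lerD; rewrite ler_wpM2l ?exprn_ge0//.
    by rewrite expr2 mulrA; exact: bform_bound.
  apply: ler_pM => //; apply: dot_bound => //.
  by apply: le_trans (enormD _ _) _; lra.
have H2 : `|dot p (psi x) - dot q (psi x)| <= c * Mp.
  by rewrite -dotNl -dotDl; exact: dot_bound.
rewrite (_ : G x p A - G x q B = 2^-1 * (expect (quadratic_part p A) -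
  expect (quadratic_part q B)) + (dot p (psi x) - dot q (psi x))); last first.
  by rewrite /entropic_hamiltonian; ring.
apply: le_trans (ler_normD _ _) _; rewrite normrM (@ger0_norm _ 2^-1)//.
apply: (@le_trans _ _ (2^-1 * (dl ^+ 2 * (c * M ^+ 2) + ga * (c * M * (2 * C * M)))
  + c * Mp)); first by apply: lerD => //; rewrite ler_wpM2l.
have t1 : 0 <= dl ^+ 2 * M ^+ 2 * c by rewrite !mulr_ge0 ?exprn_ge0.
have t2 : 0 <= ga * M ^+ 2 * c by rewrite !mulr_ge0 ?exprn_ge0.
have t3 : 0 <= dl ^+ 2 * M ^+ 2 * c * C by rewrite mulr_ge0.
have t4 : 0 <= Mp * c * C by rewrite !mulr_ge0.
have t5 : 0 <= L * c by rewrite mulr_ge0.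
have t6 : 0 <= L * c * C by rewrite !mulr_ge0.
rewrite [leRHS](_ : _ = dl ^+ 2 * M ^+ 2 * c + ga * M ^+ 2 * c + Mp * c + L * c +
  (dl ^+ 2 * M ^+ 2 * c * C + ga * M ^+ 2 * c * C + Mp * c * C + L * c * C)); last first.
  by rewrite /hamiltonian_cst; ring.
rewrite [leLHS](_ : _ = 2^-1 * (dl ^+ 2 * M ^+ 2 * c) + ga * M ^+ 2 * c * C + Mp * c).
  by lra.
by field.
Qed.

Lemma hamiltonian_bound C x p A : 0 <= C -> enorm p <= C -> bform_le C A ->
  `|G x p A| <= hamiltonian_cst * (1 + C) * C.
Proof.
move=> C0 pC AC; rewrite -[G x p A]subr0 -(hamiltonian0 x).
by apply: hamiltonian_close => //; rewrite ?enorm0 ?subr0.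
Qed.

(** * One entropic step on a function with a jet *)

Section OneStep.
Variables (C al h de : R).
Hypotheses (C0 : 0 <= C) (al0 : 0 < al) (h0 : 0 < h) (de0 : 0 < de).

Local Notation step := (euler_step psi h de).
Local Notation J := (entropic_op E xi psi al h de).

Let sq := Num.sqrt h.
Let b := de * sq.
Let D := sq * Mp + de * M.
Let b0 := al * b * C * M.
Let sq0 : 0 <= sq. Proof. exact: sqrtr_ge0. Qed.
Let sqE : h = sq * sq. Proof. by rewrite -expr2 sqr_sqrtr// ltW. Qed.
Let bge0 : 0 <= b. Proof. by rewrite mulr_ge0// ltW. Qed.
Let b0ge0 : 0 <= b0. Proof. by rewrite !mulr_ge0// ltW. Qed.
Let D0 : 0 <= D. Proof. by rewrite addr_ge0// mulr_ge0// ltW. Qed.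
Let ah0 : 0 < al * h. Proof. exact: mulr_gt0. Qed.

(** Bounds for the remainders, relative to the step size, of the expansion of
    [v], of the exponential, and of the replacement of the parameters by their
    limits; [size_order1] bounds the part of the increment of [v] of order [h]. *)
Definition err_taylor := C * (2^-1 * (h * Mp ^+ 2) + b * Mp * M + sq * D ^+ 3).
Definition size_order1 := C * Mp + 2^-1 * (de ^+ 2 * (C * M ^+ 2)) + err_taylor.
Definition err_exp := err_taylor +
  16 * ((al * de ^+ 2) * (al * b) * (C * M) ^+ 3 + (al * h) ^+ 2 * size_order1 ^+ 3) +
  size_order1 * b0 + 2^-1 * (al * h * size_order1 ^+ 2).
Definition err_par := 2^-1 * (`|de ^+ 2 - dl ^+ 2| * (C * M ^+ 2)) +
  2^-1 * (`|al * de ^+ 2 - ga| * (C * M) ^+ 2).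
Definition err_step := err_exp + err_par.

Let hge0 : 0 <= h. Proof. exact: ltW. Qed.
Let alge0 : 0 <= al. Proof. exact: ltW. Qed.
Let dege0 : 0 <= de. Proof. exact: ltW. Qed.
Let e1_ge0 : 0 <= err_taylor.
Proof.
by rewrite mulr_ge0// !addr_ge0// ?mulr_ge0 ?exprn_ge0// mulr_ge0.
Qed.
Let Z0 : 0 <= size_order1.
Proof. by rewrite !addr_ge0// ?mulr_ge0 ?exprn_ge0. Qed.

Lemma step_taylor v p A x y : jet C v p A -> enorm y <= M ->
  `|v (step x y) - v x - b * dot (p x) y -
    h * (dot (p x) (psi x) + 2^-1 * (de ^+ 2 * bform (A x) y y))| <= h * err_taylor.
Proof.
move=> jv yM; pose s := h *: psi x + b *: y.
have := jet_taylor jv x s; have Ax := jet_hess jv x.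
have -> : x + s = step x y by rewrite /s addrA.
have sD : enorm s <= sq * D.
  apply: le_trans (enormD _ _) _; rewrite !enormZ !ger0_norm//.
  rewrite /D mulrDr; apply: lerD; first by rewrite {1}sqE -mulrA !ler_wpM2l.
  by rewrite /b [de * sq]mulrC -mulrA !ler_wpM2l.
have E1 : dot (p x) s = h * dot (p x) (psi x) + b * dot (p x) y.
  by rewrite dotDr !dotZr.
have E2 : bform (A x) s s = h ^+ 2 * bform (A x) (psi x) (psi x) +
    h * b * (bform (A x) (psi x) y + bform (A x) y (psi x)) +
    h * de ^+ 2 * bform (A x) y y.
  rewrite /bform mulmxDl -!scalemxAl !dotDl !dotDr !dotZl !dotZr {1 2 3 5 6}sqE /b.
  have -> : h = sq ^+ 2 by rewrite expr2.
  ring.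
rewrite E1 E2; set V := v _ - v x; set P := dot (p x) (psi x); set Y := dot (p x) y.
set Q1 := bform _ (psi x) (psi x); set Q2 := bform _ (psi x) y; set Q3 := bform _ y (psi x).
set Q4 := bform _ y y => H1.
have q1 : `|Q1| <= C * Mp * Mp by exact: bform_bound.
have q2 : `|Q2| <= C * Mp * M by exact: bform_bound.
have q3 : `|Q3| <= C * M * Mp by exact: bform_bound.
have -> : V - b * Y - h * (P + 2^-1 * (de ^+ 2 * Q4)) =
  (V - (h * P + b * Y) - 2^-1 * (h ^+ 2 * Q1 + h * b * (Q2 + Q3) + h * de ^+ 2 * Q4))
  + 2^-1 * (h ^+ 2 * Q1 + h * b * (Q2 + Q3)) by field.
apply: le_trans (ler_normD _ _) _.
have H2 : `|V - (h * P + b * Y) - 2^-1 * (h ^+ 2 * Q1 + h * b * (Q2 + Q3)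
    + h * de ^+ 2 * Q4)| <= h * (C * (sq * D ^+ 3)).
  apply: le_trans H1 _; rewrite [leRHS]mulrCA ler_wpM2l//.
  apply: (@le_trans _ _ ((sq * D) ^+ 3)); first by rewrite lerXn2r// nnegrE ?enorm_ge0// mulr_ge0.
  by rewrite {1}sqE le_eqVlt; apply/orP; left; apply/eqP; ring.
have H3 : `|2^-1 * (h ^+ 2 * Q1 + h * b * (Q2 + Q3))| <=
    h * (C * (2^-1 * (h * Mp ^+ 2) + b * Mp * M)).
  rewrite normrM (@ger0_norm _ 2^-1)//.
  apply: (@le_trans _ _ (2^-1 * (h ^+ 2 * (C * Mp * Mp) +
      h * b * (C * Mp * M + C * M * Mp)))).
    rewrite ler_wpM2l//; apply: le_trans (ler_normD _ _) _.
    rewrite normrM (@ger0_norm _ (h ^+ 2)) ?exprn_ge0//.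
    rewrite normrM (@ger0_norm _ (h * b)) ?mulr_ge0//.
    apply: lerD; first by rewrite ler_wpM2l// exprn_ge0.
    rewrite ler_wpM2l ?mulr_ge0//; apply: le_trans (ler_normD _ _) _.
    exact: lerD.
  by rewrite le_eqVlt; apply/orP; left; apply/eqP; field.
apply: le_trans (lerD H2 H3) _.
by rewrite le_eqVlt; apply/orP; left; apply/eqP; rewrite /err_taylor; ring.
Qed.

(** The exponent is [B + U] with [B] linear in the increment and of order
    [alpha * b], and [U] of order [alpha * h]. Of the second-order term of the
    exponential only [B ^ 2 / 2] is of order [alpha * h]: it is the source of the
    squared gradient in the Hamiltonian. *)
Lemma step_exp v p A x y : jet C v p A -> enorm y <= M ->
  b0 + al * h * size_order1 <= 1 ->
  `|expR (al * (v (step x y) - v x)) -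
    (1 + (al * b * dot (p x) y + al * h * (2^-1 * quadratic_part (p x) (A x) y
      + dot (p x) (psi x))))| <= al * h * err_step.
Proof.
move=> jv yM small; have Ax := jet_hess jv x; have px := jet_grad jv x.
have T := step_taylor x jv yM.
set V := v _ - v x in T *; set Y := dot (p x) y in T *; set P := dot (p x) (psi x) in T *.
set Q := bform (A x) y y in T.
pose rho := V - b * Y - h * (P + 2^-1 * (de ^+ 2 * Q)).
have rhoE : `|rho| <= h * err_taylor by exact: T.
have Yb : `|Y| <= C * M by exact: dot_bound.
have Pb : `|P| <= C * Mp by exact: dot_bound.
have Qb : `|Q| <= C * M ^+ 2 by rewrite expr2 mulrA; exact: bform_bound.
pose B := al * b * Y; pose U := al * (h * (P + 2^-1 * (de ^+ 2 * Q)) + rho).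
have zE : al * V = B + U by rewrite /B /U /rho; ring.
have Bb : `|B| <= b0.
  rewrite /B /b0 normrM ger0_norm ?mulr_ge0// -[leRHS]mulrA.
  by rewrite ler_wpM2l// mulr_ge0.
have Ub : `|U| <= al * h * size_order1.
  rewrite /U normrM (ger0_norm alge0) -mulrA ler_wpM2l//.
  apply: le_trans (ler_normD _ _) _.
  rewrite /size_order1 [leRHS]mulrDr; apply: lerD => //.
  rewrite normrM (ger0_norm hge0) ler_wpM2l//; apply: le_trans (ler_normD _ _) _.
  apply: lerD => //; rewrite normrM (@ger0_norm _ 2^-1)// ler_wpM2l//.
  by rewrite normrM ger0_norm ?exprn_ge0// ler_wpM2l ?exprn_ge0.
set u := al * h * size_order1 in small Ub.
have u0 : 0 <= u by rewrite mulr_ge0// mulr_ge0.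
have zb : `|al * V| <= b0 + u.
  by rewrite zE; apply: le_trans (ler_normD _ _) _; exact: lerD.
have X := expR_taylor2 (le_trans zb small).
(* Convexity of the cube, in the form of a perfect square. *)
have z3 : 4 * `|al * V| ^+ 3 <= 16 * (b0 ^+ 3 + u ^+ 3).
  apply: (@le_trans _ _ (4 * (b0 + u) ^+ 3)).
    by rewrite ler_wpM2l// lerXn2r// nnegrE// addr_ge0.
  have : 0 <= 3 * ((b0 + u) * (b0 - u) ^+ 2).
    by apply: mulr_ge0 => //; apply: mulr_ge0; [exact: addr_ge0|exact: sqr_ge0].
  have -> : 3 * ((b0 + u) * (b0 - u) ^+ 2) = 4 * (b0 ^+ 3 + u ^+ 3) - (b0 + u) ^+ 3 by ring.
  lra.
have e3 : b0 ^+ 3 + u ^+ 3 = al * h * ((al * de ^+ 2) * (al * b) * (C * M) ^+ 3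
    + (al * h) ^+ 2 * size_order1 ^+ 3).
  rewrite /b0 /u [in RHS]mulrDr; congr (_ + _); last by ring.
  by rewrite /b {1}sqE; ring.
have c1 : `|B * U| <= al * h * (size_order1 * b0).
  rewrite normrM [leRHS](_ : _ = b0 * u); last by rewrite /u; ring.
  exact: ler_pM.
have c2 : `|2^-1 * U ^+ 2| <= al * h * (2^-1 * (al * h * size_order1 ^+ 2)).
  rewrite normrM (@ger0_norm _ 2^-1)// [leRHS](_ : _ = 2^-1 * u ^+ 2); last by rewrite /u; ring.
  by rewrite ler_wpM2l// normrX lerXn2r// nnegrE.
have c3 : `|al * rho| <= al * h * err_taylor.
  by rewrite normrM (ger0_norm alge0) -mulrA ler_wpM2l.
pose w := 2^-1 * ((de ^+ 2 - dl ^+ 2) * Q) + 2^-1 * ((al * de ^+ 2 - ga) * Y ^+ 2).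
have c4 : `|al * h * w| <= al * h * err_par.
  rewrite normrM ger0_norm ?mulr_ge0// ler_wpM2l ?mulr_ge0//.
  apply: le_trans (ler_normD _ _) _; rewrite /err_par.
  apply: lerD; rewrite normrM (@ger0_norm _ 2^-1)// ler_wpM2l// normrM ler_wpM2l//.
  by rewrite normrX lerXn2r// nnegrE mulr_ge0.
have EV : expR (al * V) - (1 + (al * b * Y + al * h * (2^-1 * quadratic_part (p x) (A x) y + P)))
  = (expR (al * V) - 1 - al * V - 2^-1 * (al * V) ^+ 2) + al * rho + B * U
    + 2^-1 * U ^+ 2 + al * h * w.
  rewrite /quadratic_part -/Q -/Y real_normK ?num_real// zE.
  have -> : 2^-1 * (B + U) ^+ 2 = 2^-1 * B ^+ 2 + B * U + 2^-1 * U ^+ 2 by field.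
  have -> : 2^-1 * B ^+ 2 = al * h * (2^-1 * (al * de ^+ 2 * Y ^+ 2)).
    by rewrite /B /b sqE; ring.
  by rewrite /U /w /B; field.
rewrite EV.
apply: le_trans (ler_normD _ _) _.
apply: le_trans (lerD (ler_normD _ _) (lexx _)) _.
apply: le_trans (lerD (lerD (ler_normD _ _) (lexx _)) (lexx _)) _.
apply: le_trans (lerD (lerD (lerD (ler_normD _ _) (lexx _)) (lexx _)) (lexx _)) _.
rewrite e3 in z3; have c0 := le_trans X z3.
apply: le_trans (lerD (lerD (lerD (lerD c0 c3) c1) c2) c4) _.
by rewrite le_eqVlt; apply/orP; left; apply/eqP; rewrite /err_step /err_exp; ring.
Qed.

Let Gb := hamiltonian_cst * (1 + C) * C.

(** After subtracting [v x] the expectation is close to one, the linear term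
    drops out because the increments are centred, and the logarithm is
    linearised. *)
Lemma one_step_consistent v p A x : Cb v -> jet C v p A ->
  b0 + al * h * size_order1 <= 1 -> al * h * (Gb + err_step) <= 2^-1 ->
  `|J v x - v x - h * G x (p x) (A x)| <=
    h * (err_step + 2 * (al * h) * (Gb + err_step) ^+ 2).
Proof.
move=> Cv jv small1 small2; have Ax := jet_hess jv x; have px := jet_grad jv x.
set e := err_step in small2 *.
have cq := @quadratic_part_continuous (p x) (A x).
pose S := expect (fun y => expR (al * (v (step x y) + - v x))) - 1.
have JS : J v x - v x = al^-1 * ln (1 + S).
  have := entropic_add HE xi_iid xi_le psi h de al0 (- v x) Cv.
  by move=> /(congr1 (@^~ x)) /= <-; rewrite /S subrKC.
have Sb : `|S - al * h * G x (p x) (A x)| <= al * h * e.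
  pose g y := ((al * h * 2^-1) * quadratic_part (p x) (A x) y +
    (1 + al * h * dot (p x) (psi x))) + dot ((al * b) *: p x) y.
  have c1 : continuous (fun y => (al * h * 2^-1) * quadratic_part (p x) (A x) y).
    exact: continuous_scale.
  have c2 : continuous (fun y => (al * h * 2^-1) * quadratic_part (p x) (A x) y +
      (1 + al * h * dot (p x) (psi x))).
    by apply: continuous_add => // y; exact: cst_continuous.
  have Eg : expect g = 1 + al * h * G x (p x) (A x).
    rewrite /g (expect_dot HE xi_iid xi_centered xi_le)//.
    rewrite (expect_addc HE xi_iid xi_le)// (expectZ HE xi_iid xi_le)//.
      by rewrite /entropic_hamiltonian; ring.
    by rewrite !mulr_ge0.
  have -> : S - al * h * G x (p x) (A x) =
    expect (fun y => expR (al * (v (step x y) + - v x))) - expect g.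
    by rewrite Eg /S; ring.
  apply: (expect_dist HE xi_iid xi_le).
  - apply: continuous_expR_comp; apply: continuous_add; last by move=> y; exact: cst_continuous.
    by apply: step_continuous; exact: Cv.1.
  - by apply: continuous_add => //; exact: dot_continuous.
  - move=> y yM; have := step_exp x jv yM small1; rewrite -/e.
    by congr (`|_ - _| <= _); rewrite /g dotZl; ring.
have Gbd : `|G x (p x) (A x)| <= Gb by exact: hamiltonian_bound.
have Sb2 : `|S| <= al * h * (Gb + e).
  rewrite -[S](subrK (al * h * G x (p x) (A x))).
  apply: le_trans (ler_normD _ _) _; rewrite [leRHS]mulrDr [leLHS]addrC; apply: lerD => //.
  by rewrite normrM (ger0_norm (ltW ah0)) ler_wpM2l// ltW.
have lnb := ln1D_bound (le_trans Sb2 small2).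
have S2 : S ^+ 2 <= (al * h * (Gb + e)) ^+ 2.
  by rewrite -(real_normK (num_real S)) lerXn2r// nnegrE//; apply: le_trans Sb2.
rewrite JS -(ler_pM2l al0) -[X in X * `|_|](ger0_norm alge0) -normrM.
have -> : al * (al^-1 * ln (1 + S) - h * G x (p x) (A x)) =
  (ln (1 + S) - S) + (S - al * h * G x (p x) (A x)) by field; rewrite gt_eqF.
apply: le_trans (ler_normD _ _) _; apply: le_trans (lerD lnb Sb) _.
have -> : al * (h * (e + 2 * (al * h) * (Gb + e) ^+ 2)) =
  2 * (al * h * (Gb + e)) ^+ 2 + al * h * e by ring.
by rewrite lerD2r ler_wpM2l.
Qed.

End OneStep.

End Consistency.


(** * Consistency of the entropic operators *)

Section CvgFacts.
Context {R : realType}.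

Lemma cvg_pow (u : nat -> R) (l : R) k : u @ \oo --> l ->
  (fun n => u n ^+ k) @ \oo --> l ^+ k.
Proof.
move=> ul; elim: k => [|k ih]; first exact: cvg_cst.
by under eq_fun do rewrite exprS; rewrite exprS; exact: cvgM.
Qed.

Lemma cvg_sqrt (u : nat -> R) (l : R) : u @ \oo --> l ->
  (fun n => Num.sqrt (u n)) @ \oo --> Num.sqrt l.
Proof. by move=> ul; apply: (continuous_cvg _ _ ul); exact: sqrt_continuous. Qed.

Lemma cvg0_small (u : nat -> R) (e : R) : u @ \oo --> (0 : R) -> 0 < e ->
  exists N, forall n, (N <= n)%N -> u n <= e.
Proof.
move=> /cvgrPdist_le H e0; have [N _ HN] := H e e0; exists N => n /HN /=.
by rewrite sub0r normrN; apply: le_trans; exact: ler_norm.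
Qed.

End CvgFacts.

Section EntropicScheme.
Context {R : realType} {d : nat} {Omega : Type} {H : set (Omega -> R)}
  {E : (Omega -> R) -> R} {xi : nat -> Omega -> 'rV[R]_d} {M : R}.
Hypothesis HE : sublinear_expectation H E.
Hypothesis xi_iid : iid H E xi.
Hypothesis xi_centered : forall a : 'rV[R]_d,
  H (fun w => dot a (xi 0%N w)) /\ E (fun w => dot a (xi 0%N w)) = 0.
Hypothesis xi_le : forall w, enorm (xi 0%N w) <= M.
Hypothesis M0 : 0 <= M.
Variables (psi : 'rV[R]_d -> 'rV[R]_d) (L Mp : R).
Hypothesis L0 : 0 <= L.
Hypothesis psi_le : forall x, enorm (psi x) <= Mp.
Hypothesis psi_lip : forall x y, enorm (psi x - psi y) <= L * enorm (x - y).
Variables (h de al : nat -> R) (ga dl : R).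
Hypotheses (ga0 : 0 <= ga) (dl0 : 0 <= dl).
Hypotheses (h0 : forall n, 0 < h n) (de0 : forall n, 0 < de n) (al0 : forall n, 0 < al n).
Hypothesis de_cvg : de @ \oo --> dl.
Hypothesis ga_cvg : (fun n => al n * de n ^+ 2) @ \oo --> ga.
Hypothesis h_cvg : h @ \oo --> (0 : R).
Hypothesis alh_cvg : (fun n => al n * h n) @ \oo --> (0 : R).

Let sq_cvg : (fun n => Num.sqrt (h n)) @ \oo --> (0 : R).
Proof. by rewrite -sqrtr0; exact: cvg_sqrt. Qed.

Let b_cvg : (fun n => de n * Num.sqrt (h n)) @ \oo --> (0 : R).
Proof. by rewrite -(mulr0 dl); exact: cvgM. Qed.

(** The exponent [alpha_n] times the size [delta_n sqrt h_n] of an increment is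
    the geometric mean of [alpha_n delta_n ^ 2] and [alpha_n h_n], which are
    bounded and infinitesimal, respectively. *)
Let alb_cvg : (fun n => al n * (de n * Num.sqrt (h n))) @ \oo --> (0 : R).
Proof.
have -> : (fun n => al n * (de n * Num.sqrt (h n))) =
    (fun n => Num.sqrt ((al n * de n ^+ 2) * (al n * h n))).
  apply/funext => n; have a0 := ltW (al0 n); have d0 := ltW (de0 n).
  rewrite (_ : _ * _ * _ = (al n * de n) ^+ 2 * h n); last by ring.
  by rewrite sqrtrM ?sqr_ge0// sqrtr_sqr ger0_norm ?mulr_ge0// mulrA.
by rewrite -[X in _ --> X]sqrtr0 -[X in Num.sqrt X](mulr0 ga); apply: cvg_sqrt; exact: cvgM.
Qed.

Section Errors.
Variable C : R.
Let et n := @err_taylor R M Mp C (h n) (de n).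
Let s1 n := @size_order1 R M Mp C (h n) (de n).

Let et_cvg : et @ \oo --> (0 : R).
Proof.
rewrite (_ : (0 : R) = C * (2^-1 * (0 * Mp ^+ 2) + 0 * Mp * M +
  0 * (0 * Mp + dl * M) ^+ 3)); last by ring.
apply: cvgM; first exact: cvg_cst.
apply: cvgD.
  apply: cvgD; first by apply: cvgM; [exact: cvg_cst|apply: cvgM => //; exact: cvg_cst].
  by apply: cvgM; [apply: cvgM => //|]; exact: cvg_cst.
apply: cvgM => //; apply: cvg_pow.
by apply: cvgD; apply: cvgM => //; exact: cvg_cst.
Qed.

Let s1_cvg : s1 @ \oo --> C * Mp + 2^-1 * (dl ^+ 2 * (C * M ^+ 2)) + 0.
Proof.
apply: cvgD => //; apply: cvgD; first exact: cvg_cst.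
apply: cvgM; first exact: cvg_cst.
by apply: cvgM; [exact: cvg_pow|exact: cvg_cst].
Qed.

Lemma err_step_cvg :
  (fun n => @err_step R M Mp ga dl C (al n) (h n) (de n)) @ \oo --> (0 : R).
Proof.
pose sl := C * Mp + 2^-1 * (dl ^+ 2 * (C * M ^+ 2)) + 0.
rewrite (_ : (0 : R) = (0 + 16 * (ga * 0 * (C * M) ^+ 3 + 0 ^+ 2 * sl ^+ 3) +
  sl * (0 * C * M) + 2^-1 * (0 * sl ^+ 2)) +
  (2^-1 * (`|dl ^+ 2 - dl ^+ 2| * (C * M ^+ 2)) +
  2^-1 * (`|ga - ga| * (C * M) ^+ 2))); last by rewrite !subrr normr0; ring.
apply: cvgD.
  apply: cvgD.
    apply: cvgD.
      apply: cvgD => //; apply: cvgM; first exact: cvg_cst.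
      apply: cvgD; first by apply: cvgM; [exact: cvgM|exact: cvg_cst].
      by apply: cvgM; exact: cvg_pow.
    by apply: cvgM => //; apply: cvgM; [apply: cvgM => //|]; exact: cvg_cst.
  apply: cvgM; first exact: cvg_cst.
  by apply: cvgM => //; exact: cvg_pow.
apply: cvgD; (apply: cvgM; first exact: cvg_cst); (apply: cvgM; last exact: cvg_cst).
  apply: (@cvg_norm _ _ _ _ _ (fun n => de n ^+ 2 - dl ^+ 2) (dl ^+ 2 - dl ^+ 2)).
  by apply: cvgB; [exact: cvg_pow|exact: cvg_cst].
apply: (@cvg_norm _ _ _ _ _ (fun n => al n * de n ^+ 2 - ga) (ga - ga)).
by apply: cvgB => //; exact: cvg_cst.
Qed.

Lemma step_size_cvg :
  (fun n => al n * (de n * Num.sqrt (h n)) * C * M + al n * h n * s1 n) @ \oo --> (0 : R).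
Proof.
pose sl := C * Mp + 2^-1 * (dl ^+ 2 * (C * M ^+ 2)) + 0.
rewrite (_ : (0 : R) = 0 * C * M + 0 * sl); last by ring.
apply: cvgD; last exact: cvgM.
by apply: cvgM; [apply: cvgM => //|]; exact: cvg_cst.
Qed.

End Errors.

Let K := @hamiltonian_cst R M L Mp ga dl.
Let G := @entropic_hamiltonian R d Omega E xi psi ga dl.
Let J n := entropic_op E xi psi (al n) (h n) (de n).

Lemma entropic_consistent C eta : 0 <= C -> 0 < eta -> exists N, forall n,
  (N <= n)%N -> forall v p A, Cb v -> jet C v p A ->
  forall x, `|J n v x - v x - h n * G x (p x) (A x)| <= eta * h n.
Proof.
move=> C0 eta0; have ec := err_step_cvg C.
set e := fun n => _ in ec.
pose Gb := K * (1 + C) * C.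
have c1 : (fun n => al n * h n * (Gb + e n)) @ \oo --> (0 : R).
  rewrite (_ : (0 : R) = 0 * (Gb + 0)); last by ring.
  by apply: cvgM => //; apply: cvgD => //; exact: cvg_cst.
have c2 : (fun n => e n + 2 * (al n * h n) * (Gb + e n) ^+ 2) @ \oo --> (0 : R).
  rewrite [X in _ --> X](_ : _ = 0 + 2 * 0 * (Gb + 0) ^+ 2); last by ring.
  apply: cvgD => //; apply: cvgM; first by apply: cvgM => //; exact: cvg_cst.
  by apply: cvg_pow; apply: cvgD => //; exact: cvg_cst.
have [N1 H1] := cvg0_small (step_size_cvg C) (@ltr01 R).
have half0 : (0 : R) < 2^-1 by rewrite invr_gt0.
have [N2 H2] := cvg0_small c1 half0.
have [N3 H3] := cvg0_small c2 eta0.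
exists (maxn N1 (maxn N2 N3)) => n; rewrite !geq_max => /and3P[n1 n2 n3] v p A Cv jv x.
have := one_step_consistent HE xi_iid xi_centered xi_le M0 L0 psi_le ga0 dl0 C0
  (al0 n) (h0 n) (de0 n) x Cv jv (H1 n n1) (H2 n n2).
move=> H4; apply: le_trans H4 _; rewrite [leRHS]mulrC ler_wpM2l ?(ltW (h0 n))//.
exact: H3.
Qed.

Theorem entropic_approx_scheme : approx_scheme J h L K G.
Proof.
split => //.
- exact: hamiltonian_cst_ge0.
- by move=> n f Cf; exact: (entropic_Cb HE xi_iid xi_le L0 psi_le psi_lip (al0 n) (h0 n) (de0 n)).
- by move=> n f g Cf Cg fg x; exact: (entropic_mono HE xi_iid xi_le psi (h n) (de n) (al0 n)).
- by move=> n f c Cf; exact: (entropic_add HE xi_iid xi_le psi (h n) (de n) (al0 n)).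
- by move=> n c; exact: (entropic_cst HE psi (h n) (de n) (al0 n)).
- by move=> n f g l x Cf Cg l01; exact: (entropic_convex HE xi_iid xi_le psi (h n) (de n) (al0 n)).
- by move=> n f r r0 fr bf; exact: (entropic_lip HE xi_iid xi_le psi_lip (de n) (al0 n) (h0 n)).
- by move=> n f r x z r0 fr bf; exact: (entropic_translate HE xi_iid xi_le psi_lip (de n) (al0 n) (h0 n)).
- exact: entropic_consistent.
- by move=> x; apply: hamiltonian0; exact: HE.
- move=> C a x p q A B C0 a0 pC qC pq AB.
  by apply: (hamiltonian_close HE xi_iid xi_le).
- by move=> x y p A; apply: hamiltonian_lip.
Qed.

End EntropicScheme.


(** * The Euler scheme *)

Section EulerScheme.
Context {R : realType} {d : nat} {Omega : Type} {H : set (Omega -> R)}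
  {E : (Omega -> R) -> R} {xi : nat -> Omega -> 'rV[R]_d} {M : R}.
Hypothesis HE : sublinear_expectation H E.
Hypothesis xi_iid : iid H E xi.
Hypothesis xi_le : forall w, enorm (xi 0%N w) <= M.
Variables (psi : 'rV[R]_d -> 'rV[R]_d) (L Mp : R).
Hypothesis L0 : 0 <= L.
Hypothesis psi_le : forall x, enorm (psi x) <= Mp.
Hypothesis psi_lip : forall x y, enorm (psi x - psi y) <= L * enorm (x - y).
Variables (al h de : R).
Hypotheses (al0 : 0 < al) (h0 : 0 < h) (de0 : 0 < de).
Implicit Types (x y : 'rV[R]_d) (n k i : nat).
Local Notation J := (entropic_op E xi psi al h de).

(** The scheme driven by a given sequence of increments. Independence is tested
    on functions of the matrix of increments, so the dependence on them has
    to be made explicit. *)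
Fixpoint euler_path x (ys : nat -> 'rV[R]_d) k : 'rV[R]_d :=
  if k is k'.+1 then euler_step psi h de (euler_path x ys k') (ys k') else x.

Lemma euler_pathE x k w : euler xi psi h de x k w = euler_path x (xi ^~ w) k.
Proof. by elim: k => //= k ->. Qed.

Lemma eq_euler_path x ys zs k : (forall i, (i < k)%N -> ys i = zs i) ->
  euler_path x ys k = euler_path x zs k.
Proof.
elim: k => //= k ih yz; rewrite ih ?yz// => i ik.
by apply: yz; exact: ltnW.
Qed.

(** Continued by zero, so that the type of the path does not depend on the
    number of rows. *)
Definition row_seq n (m : 'M[R]_(n, d)) i : 'rV[R]_d :=
  if insub i is Some j then row (j : 'I_n) m else 0.

Lemma row_seq_rvs n w i : (i < n)%N -> row_seq (rvs xi n w) i = xi i w.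
Proof.
move=> ltin; rewrite /row_seq insubT/=; apply/rowP => j.
by rewrite !mxE.
Qed.

Lemma psi_continuous : continuous psi.
Proof.
move=> x; have F : Filter (nbhs x) by exact: nbhs_filter.
apply/(@cvgrPdist_le _ _ _ (nbhs x) F) => e e0.
have L1 : 0 < L + 1 by rewrite ltr_wpDl.
have er : 0 < e / (L + 1) by rewrite divr_gt0.
apply: (@filterS _ (nbhs x) F _ _ _ (near_eball x er)) => y.
rewrite ler_pdivlMr// mulrC => yx; apply: le_trans (norm_le_enorm _) _.
rewrite enormBC; apply: le_trans (psi_lip _ _) _; apply: le_trans yx.
by rewrite ler_wpM2r ?enorm_ge0// lerDl.
Qed.

Lemma row_continuous n (j : 'I_n) : continuous (fun m : 'M[R]_(n, d) => row j m).
Proof.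
move=> m; have F : Filter (nbhs m) by exact: nbhs_filter.
apply/(@cvgrPdist_le _ _ _ (nbhs m) F) => e e0.
apply/nbhs_ballP; exists e => // m'; rewrite -ball_normE /ball_/= => /ltW.
apply: le_trans; rewrite -linearB/= [leLHS]/Num.norm/= mx_normrE.
apply/bigmax_leP; split => // -[i k] _ /=; rewrite mxE.
rewrite [leRHS]/Num.norm/= mx_normrE.
exact: (le_bigmax _ (fun ij : 'I_n * 'I_d => `|(m - m') ij.1 ij.2|) (j, k)).
Qed.

Lemma euler_step_continuous (T : topologicalType) (p q : T -> 'rV[R]_d) :
  continuous p -> continuous q ->
  continuous (fun z => euler_step psi h de (p z) (q z)).
Proof.
move=> cp cq z; apply: cvgD; last by apply: cvgZr; exact: cq.
apply: cvgD; first exact: cp.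
apply: cvgZr; apply: (continuous_comp (f := p)); first exact: cp.
exact: psi_continuous.
Qed.

Lemma euler_path_continuous n x k :
  continuous (fun m : 'M[R]_(n, d) => euler_path x (row_seq m) k).
Proof.
elim: k => [|k ih] /=; first by move=> m; exact: cst_continuous.
apply: euler_step_continuous => //.
rewrite /row_seq; case: insub => [j|]; first exact: row_continuous.
by move=> m; exact: cst_continuous.
Qed.

(** By independence the last increment can be integrated out first, given the
    others; this replaces [u] by [J u]. *)
Lemma exp_euler u k x : Cb u ->
  E (fun w => expR (al * u (euler xi psi h de x k w))) = expR (al * iter k J u x).
Proof.
elim: k u => [|k ih] u Cu; first exact: (se_constant HE (expR (al * u x))).
have CJ : Cb (J u) by exact: (entropic_Cb HE xi_iid xi_le L0 psi_le psi_lip al0 h0 de0).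
rewrite iterSr -ih//.
have [B uB] := Cb_bnd Cu.
pose g y := expR (al * u y).
have cg : continuous g by apply: continuous_expR_comp; exact: Cu.1.
have gB y : `|g y| <= expR (al * B).
  rewrite ger0_norm ?expR_ge0// ler_expR ler_pM2l//.
  exact: le_trans (ler_norm _) (uB y).
pose f (z : 'M[R]_(k, d) * 'rV[R]_d) :=
  g (euler_step psi h de (euler_path x (row_seq z.1) k) z.2).
have Cf : Cb f.
  split; last by apply/bounded_fun_bnd; exists (expR (al * B)) => z; exact: gB.
  move=> z; apply: (continuous_comp
    (f := fun z : 'M[R]_(k, d) * 'rV[R]_d =>
      euler_step psi h de (euler_path x (row_seq z.1) k) z.2)); last exact: cg.
  apply: euler_step_continuous => {}z; last exact: cvg_snd.
  apply: (continuous_comp (f := fst)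
    (g := fun m : 'M[R]_(k, d) => euler_path x (row_seq m) k)); first exact: cvg_fst.
  exact: euler_path_continuous.
have pathE w : euler_path x (row_seq (rvs xi k w)) k = euler xi psi h de x k w.
  by rewrite euler_pathE; apply: eq_euler_path => i; exact: row_seq_rvs.
have -> : (fun w => expR (al * u (euler xi psi h de x k.+1 w))) =
    (fun w => f (rvs xi k w, xi k w)).
  by apply/funext => w; rewrite /f /= pathE.
rewrite (iid_independent xi_iid Cf); congr (E _); apply/funext => w.
rewrite (exp_entropic HE xi_iid xi_le psi h de al0)//.
pose F y := g (euler_step psi h de (euler xi psi h de x k w) y).
have CF : Cb F.
  apply: CbP; first by apply: step_continuous.
  by exists (expR (al * B)) => y; exact: gB.
transitivity (E (fun w' => F (xi k w'))); last exact: (iid_identical xi_iid k CF).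
by congr (E _); apply/funext => w'; rewrite /f /= pathE.
Qed.

Lemma entropic_euler u k x : Cb u ->
  al^-1 * ln (E (fun w => expR (al * u (euler xi psi h de x k w)))) = iter k J u x.
Proof. by move=> Cu; rewrite exp_euler// expRK mulrA mulVf ?mul1r// gt_eqF. Qed.

End EulerScheme.

(** * Convergence to the semigroup *)

Theorem theorem3p8 (R : realType) (d : nat)
  (psi : 'rV[R]_d -> 'rV[R]_d) (L : R)
  (psi_bounded : exists M : R, forall x, enorm (psi x) <= M)
  (L_ge0 : 0 <= L)
  (psi_lipschitz : forall x y, enorm (psi x - psi y) <= L * enorm (x - y))
  (Omega : Type) (H : set (Omega -> R)) (E : (Omega -> R) -> R)
  (HE : sublinear_expectation H E)
  (xi : nat -> Omega -> 'rV[R]_d) (xi_iid : iid H E xi)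
  (* [E] is real-valued on [H], so a finite third moment means membership *)
  (xi_moment : H (fun w => enorm (xi 0%N w) ^+ 3))
  (xi_centered : forall a : 'rV[R]_d,
    H (fun w => dot a (xi 0%N w)) /\ E (fun w => dot a (xi 0%N w)) = 0)
  (xi_bounded : exists M : R, forall w, enorm (xi 0%N w) <= M)
  (h delta_ alpha : nat -> R) (delta gamma : R)
  (h_gt0 : forall n, 0 < h n)
  (delta_gt0 : forall n, 0 < delta_ n)
  (alpha_gt0 : forall n, 0 < alpha n)
  (delta_ge0 : 0 <= delta) (gamma_ge0 : 0 <= gamma)
  (delta_cvg : delta_ @ \oo --> delta)
  (gamma_cvg : (fun n => alpha n * delta_ n ^+ 2) @ \oo --> gamma)
  (h_cvg : h @ \oo --> (0 : R))
  (alphah_cvg : (fun n => alpha n * h n) @ \oo --> (0 : R)) :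
  exists T : R -> ('rV[R]_d -> R) -> 'rV[R]_d -> R,
    convex_monotone_semigroup T /\
    (forall (t : R) (f : 'rV[R]_d -> R) (k : nat -> nat),
       0 <= t -> Cb f -> (fun n => (k n)%:R * h n) @ \oo --> t ->
       Cb_cvg
         (fun n => iter (k n) (entropic_op E xi psi (alpha n) (h n) (delta_ n)) f)
         (T t f) /\
       Cb_cvg
         (fun n x => (alpha n)^-1 *
            ln (E (fun w =>
              expR (alpha n * f (euler xi psi (h n) (delta_ n) x (k n) w)))))
         (T t f)) /\
    (* (i) *)
    (forall f : 'rV[R]_d -> R, Cbinfty f ->
       generator T f (entropic_generator E xi psi gamma delta f)) /\
    (* (ii) *)
    (forall (t : R) (f g : 'rV[R]_d -> R), 0 <= t -> Cb f -> Cb g ->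
       supnorm setT (fun x => T t f x - T t g x)
       <= supnorm setT (fun x => f x - g x)) /\
    (* (iii) *)
    (forall (eps r Tmax : R) (K : set 'rV[R]_d),
       0 < eps -> 0 <= r -> 0 <= Tmax -> compact K ->
       exists (c : R) (K' : set 'rV[R]_d), 0 <= c /\ compact K' /\
         forall (t : R) (f g : 'rV[R]_d -> R), 0 <= t <= Tmax ->
           Cb f -> Cb g -> supnorm setT f <= r -> supnorm setT g <= r ->
           supnorm K (fun x => T t f x - T t g x)
           <= c * supnorm K' (fun x => f x - g x) + eps) /\
    (* (iv) *)
    (forall (r t : R) (f : 'rV[R]_d -> R) (x : 'rV[R]_d),
       0 <= r -> 0 <= t -> Lipb r f ->
       supnorm setT (fun y => T t (translate x f) y - translate x (T t f) y)
       <= L * expR (L * t) * r * t * enorm x) /\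
    (forall (r t : R) (f : 'rV[R]_d -> R), 0 <= r -> 0 <= t -> Lipb r f ->
       Lipb (expR (L * t) * r) (T t f)).
Proof.
have [Mp psi_le] := psi_bounded; have [M' xi_le'] := xi_bounded.
pose M := Num.max M' 0; have M0 : 0 <= M by rewrite le_max lexx orbT.
have xi_le w : enorm (xi 0%N w) <= M by rewrite le_max xi_le'.
have S := entropic_approx_scheme HE xi_iid xi_centered xi_le M0 L_ge0 psi_le
  psi_lipschitz gamma_ge0 delta_ge0 h_gt0 delta_gt0 alpha_gt0 delta_cvg gamma_cvg
  h_cvg alphah_cvg.
set J := fun n => _ in S.
exists (limit_op J h); split; first exact: (limit_semigroup S).
split; [|split; [|split; [|split; [|split]]]].
- move=> t f k t0 Cf kt; split; first exact: (limit_Cb_cvg S).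
  rewrite (_ : (fun n x => _) = fun n => iter (k n) (J n) f).
    exact: (limit_Cb_cvg S).
  apply/funext => n; apply/funext => x.
  exact: (entropic_euler HE xi_iid xi_le L_ge0 psi_le psi_lipschitz).
- move=> f /Cbinfty_jet[C [C0 fC bf jf [pC AC]]].
  exact: (limit_generator S C0 fC bf jf pC AC).
- move=> t f g t0 Cf Cg; have Cfg := Cb_bnd (CbB Cf Cg).
  apply: supnorm_le => [|x _]; first exact: supnorm_ge0.
  apply: (limit_contraction S) => // y; apply: (le_supnorm (f := fun x => f x - g x)) => //.
  by have [B HB] := Cfg; exists B => z _; exact: HB.
- move=> eps r Tmax K eps0 r0 T0 /compact_sub_eball[rK rK0 KrK].
  have [r1 r10 H1] := limit_local S T0 r0 rK0 eps0.
  exists 1, [set x | enorm x <= r1]; split; [exact: ler01|split; first exact: compact_eball].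
  move=> t f g tT Cf Cg fr gr; rewrite mul1r.
  have le_r (u : 'rV[R]_d -> R) y : Cb u -> supnorm setT u <= r -> `|u y| <= r.
    move=> /Cb_bnd[B HB]; apply: le_trans.
    by apply: le_supnorm => //; exists B => z _; exact: HB.
  have [B HB] := Cb_bnd (CbB Cf Cg).
  apply: supnorm_le; first by rewrite addr_ge0 ?supnorm_ge0// ltW.
  move=> x /KrK xrK; apply: H1 => //.
  + by move=> y; exact: le_r.
  + by move=> y; exact: le_r.
  + exact: supnorm_ge0.
  + move=> y yr; apply: (le_supnorm (f := fun x => f x - g x)) => //.
    by exists B => z _; exact: HB.
- move=> r t f x r0 t0 [fr fB]; have bf : bnd f by exists r.
  apply: supnorm_le => [|y _]; last exact: (limit_translate S).
  by rewrite !mulr_ge0 ?expR_ge0 ?enorm_ge0.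
- move=> r t f r0 t0 [fr fB]; have bf : bnd f by exists r.
  split; first by rewrite mulrC; exact: (limit_lip S).
  move=> x; apply: (@le_trans _ _ r).
    by apply: (limit_norm_le S) => //; exact: lip_Cb fr bf.
  by rewrite ler_peMl// -expR0 ler_expR mulr_ge0.
Qed.
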